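(* Let $p(\cdot)\in\mathcal{P}_0$ with $p(\cdot)\in LH$. Then, for any $W\in\mathscr{A}_{p(\cdot),\infty}$, there exist positive constants $C,C_1,C_2,A,A_1$, depending only on $p(\cdot)$ and $n$, such that, for any $r\in(1,r_w]$ with $$r_w:=1+\frac{1}{C_1[W]_{\mathscr{A}_{p(\cdot),\infty}}^{A_1}2^{C_2[W]_{\mathscr{A}_{p(\cdot),\infty}}}},$$ any cube $Q$ in $\mathbb{R}^n$, and any matrix $M\in M_m$, $$\frac{1}{\|\mathbf{1}_Q\|_{L^{rp(\cdot)}}}\left\|\,\|W(\cdot)M\|\,\mathbf{1}_Q\right\|_{L^{rp(\cdot)}}\le C[W]_{\mathscr{A}_{p(\cdot),\infty}}^{A}\frac{1}{\|\mathbf{1}_Q\|_{L^{p(\cdot)}}}\left\|\,\|W(\cdot)M\|\,\mathbf{1}_Q\right\|_{L^{p(\cdot)}}.$$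
   Context: $m,n\in\mathbb{N}$; $M_m$ is the set of $m\times m$ complex matrices, with operator norm $\|\cdot\|$. $\mathcal{P}_0$ is the set of measurable $p:\mathbb{R}^n\to(0,\infty]$ with $p_-:=\operatorname{ess\,inf}_{x\in\mathbb{R}^n}p(x)>0$; $p_+:=\operatorname{ess\,sup}_{x\in\mathbb{R}^n}p(x)$. A measurable real-valued function $r$ on $\mathbb{R}^n$ belongs to $LH$ if there is $C_0>0$ with $|r(x)-r(y)|\le -\frac{C_0}{\log|x-y|}$ whenever $|x-y|<\frac12$, and there are positive constants $r_\infty,C_\infty$ with $|r(x)-r_\infty|\le\frac{C_\infty}{\log(e+|x|)}$ for all $x$. A constant ''depends only on $p(\cdot)$'' if it depends only on $p_-,p_+,p_\infty,C_0,C_\infty$; in particular such constants do not depend on $W$. For an exponent $q(\cdot)$ and a measurable function $f$, $\|f\|_{L^{q(\cdot)}}:=\inf\{\lambda>0:\int_{\mathbb{R}^n}|f(x)/\lambda|^{q(x)}\,dx\le1\}$ (with $\inf\emptyset=\infty$). Cubes have finite positive edge length and edges parallel to the axes (not necessarily open or closed); $\fint_Q$ denotes the average $\frac1{|Q|}\int_Q$. A matrix weight is a function $W:\mathbb{R}^n\to M_m$ such that $W(x)$ is nonnegative definite and invertible for almost every $x$ and all entries of $W$ are locally integrable. $\mathscr{A}_{p(\cdot),\infty}$ is the class of matrix weights $W$ with $$[W]_{\mathscr{A}_{p(\cdot),\infty}}:=\sup_Q\exp\left(\fint_Q\log\left(\frac{1}{\|\mathbf{1}_Q\|_{L^{p(\cdot)}}}\left\|\,\|W(\cdot)W^{-1}(y)\|\,\mathbf{1}_Q(\cdot)\right\|_{L^{p(\cdot)}}\right)dy\right)<\infty,$$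 the supremum being over all cubes. *)

(* Defs.v *)
From HB Require Import structures.
From mathcomp Require Import all_boot all_order all_algebra.
From mathcomp Require Import complex.
From mathcomp Require Import all_classical all_reals all_analysis.
From mathcomp Require Import measurable_realfun ess_sup_inf.

Set Implicit Arguments.
Unset Strict Implicit.
Unset Printing Implicit Defensive.

Import Order.TTheory GRing.Theory Num.Theory.
Import numFieldNormedType.Exports.

Local Open Scope classical_set_scope.
Local Open Scope ring_scope.
Local Open Scope sesquilinear_scope.

(* R^n is 'rV[R]_n. The Borel sets are generated by the coordinate functions;
   the Borel-Lebesgue measure is the n-fold product of [lebesgue_measure], and
   the Lebesgue measure is its completion, on the Caratheodory sigma-algebra. *)

Definition rV_display : measure_display. Proof. exact. Qed.

Section measurable_rV.
Context {R : realType} {n : nat}.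

Definition rV_coord (i : 'I_n) (x : 'rV[R]_n) : measurableTypeR R := x 0 i.

Let rV_set0 : g_sigma_preimage rV_coord set0.
Proof. exact: sigma_algebra0. Qed.

Let rV_setC A : g_sigma_preimage rV_coord A -> g_sigma_preimage rV_coord (~` A).
Proof. exact: sigma_algebraC. Qed.

Let rV_bigcup (F : _^nat) : (forall i, g_sigma_preimage rV_coord (F i)) ->
  g_sigma_preimage rV_coord (\bigcup_i (F i)).
Proof. exact: sigma_algebra_bigcup. Qed.

HB.instance Definition _ := @isMeasurable.Build rV_display
  'rV[R]_n (g_sigma_preimage rV_coord) rV_set0 rV_setC rV_bigcup.

Lemma measurable_rV_coord (i : 'I_n) : measurable_fun [set: 'rV[R]_n] (rV_coord i).
Proof.
move=> _ Y mY; rewrite setTI; apply: sub_sigma_algebra => /=.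
rewrite -bigcup_seq/=; exists i => /=; first by rewrite mem_index_enum.
by exists Y => //; rewrite setTI.
Qed.

Lemma measurable_fun_rVP d (T : measurableType d) (f : T -> 'rV[R]_n) :
  (forall i, measurable_fun [set: T] (rV_coord i \o f)) ->
  measurable_fun [set: T] f.
Proof.
move=> mf; apply: (@measurability _ _ _ _ _ _
  (\big[setU/set0]_(i < n) preimage_set_system setT (rV_coord i) measurable)).
  by [].
move=> _ [B + <-]; rewrite -bigcup_seq => -[i _ [C mC <-]].
by rewrite setTI; exact: mf.
Qed.

End measurable_rV.

Section borel_lebesgue.
Context {R : realType}.
Local Open Scope ereal_scope.

Definition rV_cons n (z : measurableTypeR R * 'rV[R]_n) : 'rV[R]_(n.+1) :=
  row_mx (z.1)%:M z.2.

Definition rV_uncons n (x : 'rV[R]_(n.+1)) : measurableTypeR R * 'rV[R]_n :=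
  ((lsubmx (x : 'rV_(1 + n))) 0%R 0%R, rsubmx (x : 'rV_(1 + n))).

Lemma rV_consK n : cancel (@rV_cons n) (@rV_uncons n).
Proof.
by case=> r x; rewrite /rV_uncons /rV_cons row_mxKl row_mxKr !mxE eqxx mulr1n.
Qed.

Lemma measurable_rV_cons n :
  measurable_fun [set: (measurableTypeR R * 'rV[R]_n)%type] (@rV_cons n).
Proof.
apply: measurable_fun_rVP => i.
case: (splitP (i : 'I_(1 + n))) => j ij.
  rewrite (_ : _ \o _ = fst)//; apply/funext => z /=.
  rewrite /rV_coord /rV_cons (_ : i = lshift n j); last exact/val_inj.
  apply: (etrans (row_mxEl _ _ _ _)).
  by rewrite (ord1 j) !mxE eqxx mulr1n.
rewrite (_ : _ \o _ = rV_coord j \o snd).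
  by apply: measurableT_comp => //; exact: measurable_rV_coord.
apply/funext => z /=.
rewrite /rV_coord /rV_cons (_ : i = rshift 1 j); last exact/val_inj.
exact: row_mxEr.
Qed.

Lemma measurable_rV_uncons n : measurable_fun [set: 'rV[R]_(n.+1)] (@rV_uncons n).
Proof.
apply: measurable_fun_pair.
  rewrite (_ : (fun _ => _) = rV_coord (@lshift 1 n ord0 : 'I_(n.+1))).
    exact: measurable_rV_coord.
  by apply/funext => x; rewrite mxE.
apply: measurable_fun_rVP => i.
rewrite (_ : _ \o _ = rV_coord (@rshift 1 n i : 'I_(n.+1))).
  exact: measurable_rV_coord.
by apply/funext => x; rewrite /= /rV_coord mxE.
Qed.

Section step.
Context {n : nat}.
Variable mu : {sigma_finite_measure set 'rV[R]_n -> \bar R}.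

Definition borel_lebesgue_step : set 'rV[R]_(n.+1) -> \bar R :=
  pushforward (lebesgue_measure \x mu) (@rV_cons n).

Let step0 : borel_lebesgue_step set0 = 0.
Proof. by rewrite /borel_lebesgue_step /pushforward preimage_set0 measure0. Qed.

Let step_ge0 A : 0 <= borel_lebesgue_step A.
Proof. by rewrite /borel_lebesgue_step /pushforward; exact: measure_ge0. Qed.

Let step_sigma_additive : semi_sigma_additive borel_lebesgue_step.
Proof.
have mcons A : measurable A -> measurable (@rV_cons n @^-1` A).
  by move=> mA; rewrite -[X in measurable X]setTI; exact: measurable_rV_cons.
move=> F mF tF mUF; rewrite /borel_lebesgue_step /pushforward preimage_bigcup.
apply: measure_semi_sigma_additive.
- by move=> k; exact: mcons.
- apply/trivIsetP => /= i j _ _ ij; rewrite -preimage_setI.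
  by move/trivIsetP : tF => /(_ _ _ _ _ ij) ->//; rewrite preimage_set0.
- by rewrite -preimage_bigcup; exact: mcons.
Qed.

HB.instance Definition _ := isMeasure.Build _ _ _ borel_lebesgue_step
  step0 step_ge0 step_sigma_additive.

Let step_sigma_finite : sigma_finite setT borel_lebesgue_step.
Proof.
have [F FT mF] : sigma_finite setT (@lebesgue_measure R \x mu).
  have /sigma_finiteP[F [TF ndF Foo]] := sigma_finiteT (@lebesgue_measure R).
  have /sigma_finiteP[G [TG ndG Goo]] := sigma_finiteT mu.
  exists (fun k => F k `*` G k).
    rewrite -setXTT TF TG predeqE => -[x y]; split.
      move=> [/= [i _ Fix] [k _ Gky]]; exists (maxn i k) => //; split.
      - by move: x Fix; exact/subsetPset/ndF/leq_maxl.
      - by move: y Gky; exact/subsetPset/ndG/leq_maxr.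
    by move=> [k _ []/= ? ?]; split; exists k.
  move=> k; have [? ?] := Foo k; have [? ?] := Goo k.
  split; first exact: measurableX.
  by rewrite product_measure1E// lte_mul_pinfty// ge0_fin_numE.
exists (fun k => @rV_uncons n @^-1` F k).
  by rewrite -preimage_bigcup -FT preimage_setT.
move=> k; have [mFk Fk] := mF k; split.
  by rewrite -[X in measurable X]setTI; exact: measurable_rV_uncons.
rewrite /borel_lebesgue_step /pushforward -comp_preimage.
rewrite (_ : _ \o _ = id) ?preimage_id//.
by apply/funext => z /=; exact: rV_consK.
Qed.

HB.instance Definition _ := @Measure_isSigmaFinite.Build _ _ _
  borel_lebesgue_step step_sigma_finite.

End step.

Fixpoint borel_lebesgue n : {sigma_finite_measure set 'rV[R]_n -> \bar R} :=
  match n with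
  | 0 => \d_(0%R : 'rV[R]_0)
  | k.+1 => borel_lebesgue_step (borel_lebesgue k)
  end.

End borel_lebesgue.

Definition lebRn (R : realType) n :=
  caratheodory_type (mu_ext (@borel_lebesgue R n)).

Definition lebesgue_rV {R : realType} {n : nat} : set (lebRn R n) -> \bar R :=
  @completed_measure_extension _ _ _ (@borel_lebesgue R n).
HB.instance Definition _ (R : realType) n :=
  Measure.on (@lebesgue_rV R n).

Section variable_exponent.
Context {R : realType} {n : nat}.
Notation mu := (@lebesgue_rV R n).

Definition enorm (x : 'rV[R]_n) : R := Num.sqrt (\sum_i x 0 i ^+ 2).

Definition exponent0 (p : 'rV[R]_n -> \bar R) :=
  [/\ measurable_fun [set: lebRn R n] p,
      forall x, (0 < p x)%E
    & (0 < ess_inf mu p)%E].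

(* For x = y, both sides of the local condition are 0, since ln 0 = 0. *)
Definition log_holder (C0 r_infty C_infty : R) (r : 'rV[R]_n -> R) :=
  [/\ measurable_fun [set: lebRn R n] r,
      [/\ 0 < C0, 0 < r_infty & 0 < C_infty],
      forall x y, enorm (x - y) < 2^-1 ->
        `|r x - r y| <= - (C0 / ln (enorm (x - y)))
    & forall x, `|r x - r_infty| <= C_infty / ln (expR 1 + enorm x)].

(* ereal_inf set0 = +oo *)
Definition Lpx_norm (q f : 'rV[R]_n -> R) : \bar R :=
  ereal_inf [set l%:E | l in
    [set l : R | 0 < l /\ (\int[mu]_x (`|f x / l| `^ q x)%:E <= 1)%E]].

(* Each of the 2n faces may or may not belong to the cube. *)
Definition cube (Q : set 'rV[R]_n) :=
  exists (a : 'rV[R]_n) (l : R) (bl br : 'I_n -> bool), 0 < l /\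
    Q = [set x | forall i,
      x 0 i \in Interval (BSide (bl i) (a 0 i)) (BSide (br i) (a 0 i + l))].

Definition avg (Q : set 'rV[R]_n) (f : 'rV[R]_n -> \bar R) : \bar R :=
  ((mu Q)^-1 * \int[mu]_(y in Q) f y)%E.

Definition loc_integrable (f : 'rV[R]_n -> R) :=
  measurable_fun [set: lebRn R n] f /\
  forall K : set 'rV[R]_n, compact K -> (\int[mu]_(x in K) `|f x|%:E < +oo)%E.

End variable_exponent.

Section matrix_weight.
Context {R : realType} {n m : nat}.
Notation mu := (@lebesgue_rV R n).

Definition cvnorm (z : 'cV[R[i]]_m) : R :=
  Num.sqrt (\sum_i Normc.normc (z i 0) ^+ 2).

Definition opnorm (A : 'M[R[i]]_m) : R :=
  sup [set cvnorm (A *m z) | z in [set z | cvnorm z = 1]].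

Definition nonneg_definite (A : 'M[R[i]]_m) :=
  forall z : 'cV[R[i]]_m, 0 <= (z ^t* *m A *m z) 0 0.

Definition matrix_weight (W : 'rV[R]_n -> 'M[R[i]]_m) :=
  (\forall x \ae mu, nonneg_definite (W x) /\ W x \in unitmx) /\
  (forall i j, loc_integrable (fun x => complex.Re (W x i j)) /\
               loc_integrable (fun x => complex.Im (W x i j))).

(* invmx (W y) is the true inverse for almost every y. The negative part of the
   logarithm is integrable over Q as soon as the entries of W are, since
   opnorm (W x) <= opnorm (W x *m invmx (W y)) * opnorm (W y); so the integral
   in [avg] is never of the form +oo - oo for a matrix weight. *)
Definition Apx_infty_const (p : 'rV[R]_n -> R) (W : 'rV[R]_n -> 'M[R[i]]_m) :
    \bar R :=
  ereal_sup [set expeR (avg Q (fun y =>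
    lne (Lpx_norm p (fun x => opnorm (W x *m invmx (W y)) * \1_Q x)%R
         / Lpx_norm p \1_Q)%E)) | Q in cube].

Definition Apx_infty (p : 'rV[R]_n -> R) (W : 'rV[R]_n -> 'M[R[i]]_m) :=
  matrix_weight W /\ (Apx_infty_const p W < +oo)%E.

End matrix_weight.

(* Main.v *)
Require Import Defs.
From mathcomp Require Import all_boot all_order all_algebra.
From mathcomp Require Import complex.
From mathcomp Require Import all_classical all_reals all_analysis.
From mathcomp Require Import measurable_realfun ess_sup_inf.
From mathcomp Require Import ring lra.

Set Implicit Arguments.
Unset Strict Implicit.
Unset Printing Implicit Defensive.

Import Order.TTheory GRing.Theory Num.Theory.
Import numFieldNormedType.Exports.

Local Open Scope classical_set_scope.
Local Open Scope ring_scope.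

(** The theorem reduces to a scalar reverse Hölder inequality in the modular
    [\int_D v^p] for [v x = opnorm (W x *m M)]: only one consequence of the
    [A_{p,infty}] condition on [W] is used, and it concerns [v] alone.  Write
    [a] for the norm of [v \1_P] and [lam] for the norm of [\1_P].

    From the weight to one function.  Since
    [W x *m M = (W x *m invmx (W y)) *m (W y *m M)], the quotient of norms in
    the condition is at least [a / (lam * v y)] for almost every [y].  Taking
    logarithms and averaging over a box [P], the condition says that the
    average of [- ln (v * lam / a)] is at most the logarithm of the constant
    [w].  The positive part of [ln (v * lam / a)] has bounded average
    ([lh_average]), hence so has its negative part, and Markov's inequality
    bounds the set of [P] where [v * lam <= gam * a] by a quarter of [P], with
    [gam] a multiple of [w^-4] ([averaged_log_level]).  This is the level
    condition [level_cond].

    From the level condition to geometric decay.  If [G] fills at most half of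
    [P], then [P `\` G] contains a quarter of [P] where [v] is at least
    [gam * a / lam].  Were [p] constant, this would give
    [\int_P v^p <= K * \int_(P `\` G) v^p].  For variable [p] the powers
    [a^p(x)], [x] in [P], are comparable up to a factor unless [a] is very
    small, and in that case [\int_P v^p] is below the integral over [P] of a
    fixed integrable function, the background ([lh_dichotomy],
    [local_inequality]).  The error term is additive and has total mass at
    most [1/2], so the inequality survives summation over disjoint boxes.  A
    stopping-time choice of dyadic boxes around a set [G] of small density
    ([stopping_cubes]) then turns the local inequalities into one step of a
    decay: passing from a set [E] to the much smaller [G] inside it multiplies
    the modular by a fixed factor below [1].  Iterating, a subset of relative
    measure [2^-(n+1)i] carries a modular at most [(1 - rate)^i]
    ([level_decay]).  Stopping boxes are handled first for finite unions of
    dyadic cells; arbitrary measurable sets follow because these unions are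
    dense ([approximable_measurable]).

    From decay to higher integrability.  With [u = v / a], the level sets
    [u * lam > T * S^i] have measure below [2^-(n+1)i] of the cube, again by
    [lh_average], so that [\int u^p * max(1, u * lam)^theta] is bounded by a
    geometric series as soon as [S^theta] is close enough to [1], depending on
    [rate].  Up to the exact power of [lam] that relates the norms of [\1_Q]
    for the exponents [p] and [r * p], this integral dominates the modular of exponent [r * p]
    ([reverse_holder_modular]), for [theta = (r - 1) * pp] where [pp] bounds [p]
    from above.  The requirement on [theta] is what fixes
    [r_w]; all constants are explicit powers of [w] times numbers that depend
    on [n] and the data of the exponent only.

    Two facts make the variable exponent harmless throughout.
    First, on boxes shorter than a threshold the oscillation of [p] times the
    logarithm of the side is bounded ([lh_osc]).  Second, in powers
    of a number below [1] the exponent [p] may be replaced by its limit at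
    infinity, at the cost of an additive background ([exponent_upper],
    [exponent_lower]). *)

(** * Integrals and modulars with a variable exponent *)

Section geometric.
Context {R : realType}.

Lemma geometric_nneseries_le (a q : R) : 0 <= a -> 0 <= q -> q < 1 ->
  (\sum_(k <oo) (a * q ^+ k)%:E <= (a / (1 - q))%:E)%E.
Proof.
move=> a0 q0 q1; apply: lime_le.
  by apply: is_cvg_nneseries => k _ _; rewrite lee_fin mulr_ge0// exprn_ge0.
apply: nearW => m; rewrite sumEFin lee_fin ler_pdivlMr ?subr_gt0//.
rewrite -mulr_sumr -mulrA ler_piMr//.
suff -> : (\sum_(0 <= i < m) q ^+ i) * (1 - q) = 1 - q ^+ m.
  by rewrite gerBl exprn_ge0.
elim: m => [|m IH]; first by rewrite big_nil mul0r expr0 subrr.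
by rewrite big_nat_recr//= mulrDl IH exprSr; lra.
Qed.

Lemma gt0_powRE (t x : R) : 0 < t -> t `^ x = expR (x * ln t).
Proof. by move=> t0; rewrite /powR gt_eqF. Qed.

End geometric.

Section powR_measurable.
Context d {T : measurableType d} {R : realType}.

Lemma measurable_powR_fun (D : set T) (f q : T -> R) : measurable D ->
  measurable_fun D f -> measurable_fun D q ->
  measurable_fun D (fun x => f x `^ q x).
Proof.
move=> mD mf mq; rewrite /powR.
have meq (g : T -> R) : measurable_fun D g -> measurable_fun D (fun x => g x == 0).
  by move=> mg; apply: measurable_fun_eqr.
apply: measurable_fun_if => //; first exact: meq.
- apply: (measurable_funS mD); first exact: subIsetl.
  rewrite (_ : (fun t => _) = (fun t => if q t == 0 then 1 else 0)); last first.
    by apply/funext => t; case: (q t == 0).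
  apply: measurable_fun_if => //; first exact: meq.
- apply: (measurable_funS mD); first exact: subIsetl.
  apply: measurableT_comp => //; apply: measurable_funM => //.
  by apply: measurableT_comp => //; exact: measurable_ln.
Qed.

End powR_measurable.

Section integral_bounds.
Context d {T : measurableType d} {R : realType}.
Variable mu : {measure set T -> \bar R}.

Lemma ge0_le_integralT (D : set T) (f g : T -> \bar R) : measurable D ->
  measurable_fun [set: T] f -> measurable_fun [set: T] g ->
  (forall x, 0 <= f x)%E -> (forall x, D x -> f x <= g x)%E ->
  (\int[mu]_(x in D) f x <= \int[mu]_(x in D) g x)%E.
Proof.
move=> mD mf mg f0 fg; apply: ge0_le_integral => //; exact: measurable_funTS.
Qed.

Lemma ge0_subset_integralT (D E : set T) (f : T -> \bar R) : measurable D ->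
  measurable E -> measurable_fun [set: T] f -> (forall x, 0 <= f x)%E ->
  D `<=` E -> (\int[mu]_(x in D) f x <= \int[mu]_(x in E) f x)%E.
Proof.
move=> mD mE mf f0 DE; apply: ge0_subset_integral => //; exact: measurable_funTS.
Qed.

Lemma ge0_integralZlT (D : set T) (f : T -> \bar R) (k : R) : measurable D ->
  measurable_fun [set: T] f -> (forall x, 0 <= f x)%E -> 0 <= k ->
  (\int[mu]_(x in D) (k%:E * f x) = k%:E * \int[mu]_(x in D) f x)%E.
Proof. by move=> mD mf f0 k0; rewrite ge0_integralZl//; exact: measurable_funTS. Qed.

(** Every use of the log-Hölder condition below has this form: a pointwise
    bound by a constant, a multiple of an integrand of known modular and a
    multiple of the background. *)
Lemma le_integral_affine (D : set T) (u v : T -> R) (w : T -> \bar R) (a b c : R) :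
  measurable D -> measurable_fun [set: T] u -> measurable_fun [set: T] v ->
  measurable_fun [set: T] w -> (forall x, 0 <= u x) -> (forall x, 0 <= v x) ->
  (forall x, 0 <= w x)%E -> 0 <= a -> 0 <= b -> 0 <= c ->
  (forall x, D x -> (u x)%:E <= (a + b * v x)%:E + c%:E * w x)%E ->
  (\int[mu]_(x in D) (u x)%:E <=
   a%:E * mu D + b%:E * \int[mu]_(x in D) (v x)%:E + c%:E * \int[mu]_(x in D) w x)%E.
Proof.
move=> mD mu_ mv mw u0 v0 w0 a0 b0 c0 h.
have mvE : measurable_fun D (EFin \o v) by apply/measurable_EFinP; exact: measurable_funTS.
have mbv : measurable_fun D (fun x => b%:E * (v x)%:E)%E by exact: measurable_funeM.
have mwD : measurable_fun D w by exact: measurable_funTS.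
have mcw : measurable_fun D (fun x => c%:E * w x)%E by exact: measurable_funeM.
have bv0 x : D x -> (0 <= b%:E * (v x)%:E)%E by move=> _; rewrite -EFinM lee_fin mulr_ge0.
have cw0 x : D x -> (0 <= c%:E * w x)%E by move=> _; rewrite mule_ge0.
have abv0 x : D x -> (0 <= a%:E + b%:E * (v x)%:E)%E by move=> Dx; rewrite adde_ge0 ?bv0.
have mabv : measurable_fun D (fun x => a%:E + b%:E * (v x)%:E)%E by exact: emeasurable_funD.
apply: (@le_trans _ _ (\int[mu]_(x in D) (a%:E + b%:E * (v x)%:E + c%:E * w x))%E).
  apply: ge0_le_integral => //.
  - by move=> x Dx; rewrite lee_fin.
  - by apply/measurable_EFinP; exact: measurable_funTS.
  - exact: emeasurable_funD.
rewrite ge0_integralD// ge0_integralD// integral_cst//.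
rewrite ge0_integralZl//; last by move=> x _; rewrite lee_fin.
by rewrite ge0_integralZl.
Qed.

Lemma integral_support (D E : set T) (f : T -> \bar R) : D `<=` E ->
  (forall x, E x -> ~ D x -> f x = 0%E) ->
  (\int[mu]_(x in E) f x = \int[mu]_(x in D) f x)%E.
Proof.
move=> DE f0; rewrite [LHS]integral_mkcond [RHS]integral_mkcond.
congr (integral _ _ _); apply/funext => x; rewrite /patch.
have [xD|/negP xD] := boolP (x \in D).
  by rewrite mem_set//; apply: DE; rewrite inE in xD.
case: ifPn => // xE; apply: f0; first by rewrite inE in xE.
by move=> Dx; apply: xD; rewrite inE.
Qed.

End integral_bounds.

Section modular.
Context d {T : measurableType d} {R : realType}.
Variables (mu : {measure set T -> \bar R}) (p : T -> R) (pm pp : R).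

Definition modular (D : set T) (f : T -> R) : \bar R :=
  (\int[mu]_(x in D) (f x `^ p x)%:E)%E.

Hypotheses (mp : measurable_fun [set: T] p) (pm0 : 0 < pm) (pp0 : 0 < pp).
Hypotheses (p_ge : forall x, pm <= p x) (p_le : forall x, p x <= pp).

Lemma modular_ge0 D f : (0 <= modular D f)%E.
Proof. by apply: integral_ge0 => x _; rewrite lee_fin powR_ge0. Qed.

Lemma measurable_modular f : measurable_fun [set: T] f ->
  measurable_fun [set: T] (fun x => (f x `^ p x)%:E).
Proof. by move=> mf; apply/measurable_EFinP; exact: measurable_powR_fun. Qed.

Lemma modular_sub (D E : set T) (f : T -> R) : measurable D -> measurable E ->
  measurable_fun [set: T] f -> D `<=` E -> (modular D f <= modular E f)%E.
Proof.
move=> mD mE mf DE; apply: ge0_subset_integralT => //.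
  exact: measurable_modular.
by move=> x; rewrite lee_fin powR_ge0.
Qed.

Lemma modular_setDI (E G : set T) (f : T -> R) : measurable E -> measurable G ->
  measurable_fun [set: T] f ->
  (modular E f = modular (E `\` G) f + modular (E `&` G) f)%E.
Proof.
move=> mE mG mf; rewrite /modular -ge0_integral_setU//.
- by rewrite setUC setUIDK.
- exact: measurableD.
- exact: measurableI.
- by apply: measurable_funTS; exact: measurable_modular.
- by move=> x _; rewrite lee_fin powR_ge0.
- by rewrite disj_set2E setDE setIACA setICl setI0.
Qed.

Lemma le_modular (D : set T) (f g : T -> R) (c : R) : measurable D ->
  measurable_fun [set: T] f -> measurable_fun [set: T] g -> 0 <= c ->
  (forall x, D x -> f x `^ p x <= c * g x `^ p x) ->
  (modular D f <= c%:E * modular D g)%E.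
Proof.
move=> mD mf mg c0 h; rewrite /modular -ge0_integralZlT//; last 2 first.
- exact: measurable_modular.
- by move=> x; rewrite lee_fin powR_ge0.
apply: ge0_le_integralT => //.
- exact: measurable_modular.
- by apply: measurable_funeM; exact: measurable_modular.
- by move=> x; rewrite lee_fin powR_ge0.
Qed.

Lemma powR_p_div (x : T) (s t : R) : 0 <= s -> 1 <= t ->
  s `^ p x <= t `^ pp * (s / t) `^ p x.
Proof.
move=> s0 t1; have t0 : 0 < t by rewrite (lt_le_trans ltr01).
have sE : s = t * (s / t) by rewrite mulrC divfK// gt_eqF.
rewrite {1}sE powRM ?divr_ge0 ?(ltW t0)//.
by rewrite ler_wpM2r ?powR_ge0// ler_powR// p_le.
Qed.

Lemma powR_p_div_le (x : T) (s t : R) : 0 <= s -> 1 <= t ->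
  (s / t) `^ p x <= t `^ (- pm) * s `^ p x.
Proof.
move=> s0 t1; have t0 : 0 < t by rewrite (lt_le_trans ltr01).
rewrite mulrC powRM ?invr_ge0 ?(ltW t0)// mulrC [leRHS]mulrC ler_wpM2l ?powR_ge0//.
by rewrite -powR_inv1 ?(ltW t0)// -powRrM mulN1r ler_powR// lerN2 p_ge.
Qed.

Lemma modular_div_ge (D : set T) (f : T -> R) (t : R) : measurable D -> measurable_fun [set: T] f ->
  (forall x, 0 <= f x) -> 1 <= t ->
  (modular D f <= (t `^ pp)%:E * modular D (fun x => f x / t)%R)%E.
Proof.
move=> mD mf f0 t1; apply: le_modular => //; first exact: measurable_funM.
  exact: powR_ge0.
by move=> x _; exact: powR_p_div.
Qed.

Lemma modular_div_le (D : set T) (f : T -> R) (t : R) : measurable D -> measurable_fun [set: T] f ->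
  (forall x, 0 <= f x) -> 1 <= t ->
  (modular D (fun x => f x / t)%R <= (t `^ (- pm))%:E * modular D f)%E.
Proof.
move=> mD mf f0 t1; apply: le_modular => //; first exact: measurable_funM.
  exact: powR_ge0.
by move=> x _; exact: powR_p_div_le.
Qed.

Lemma modular_mono (D : set T) (f : T -> R) (a b : R) : measurable D -> measurable_fun [set: T] f ->
  (forall x, 0 <= f x) -> 0 < a -> a <= b ->
  (modular D (fun x => f x / b)%R <= modular D (fun x => f x / a)%R)%E.
Proof.
move=> mD mf f0 a0 ab; rewrite -[leRHS]mul1e; apply: le_modular => //.
- exact: measurable_funM.
- exact: measurable_funM.
move=> x _; rewrite mul1r ge0_ler_powR ?nnegrE//.
- by rewrite (le_trans (ltW pm0))// p_ge.
- by rewrite divr_ge0// (le_trans (ltW a0)).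
- by rewrite divr_ge0// ltW.
- by rewrite ler_wpM2l// lef_pV2 ?posrE// (lt_le_trans a0).
Qed.

(** Since [pm <= p <= pp], dividing by [t >= 1] divides the modular by a
    factor between [t^pm] and [t^pp].  So the modular of [f / a] is a
    continuous decreasing function of [a] with limits [+oo] and [0]; the value
    [a] found is the infimum of the scalings of modular at most [1]. *)
Lemma modular_normalize (D : set T) (f : T -> R) : measurable D -> measurable_fun [set: T] f ->
  (forall x, 0 <= f x) -> (0 < modular D f)%E -> (modular D f < +oo)%E ->
  exists2 a, 0 < a & modular D (fun x => f x / a) = 1%E.
Proof.
move=> mD mf f0 Mpos Mfin.
pose S := [set a : R | 0 < a /\ (modular D (fun x => f x / a)%R <= 1)%E].
have mfa a : measurable_fun [set: T] (fun x => f x / a) by exact: measurable_funM.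
have fa0 (a : R) x : 0 < a -> 0 <= f x / a by move=> a0; rewrite divr_ge0// ltW.
have Mfn : modular D f \is a fin_num by rewrite ge0_fin_numE ?modular_ge0.
set m := fine (modular D f).
have mE : modular D f = m%:E by rewrite /m fineK.
have m0 : 0 < m by rewrite -lte_fin -mE.
have pw (t q : R) : 0 < q -> 0 < t -> (t `^ (q^-1)) `^ q = t.
  by move=> q0 t0; rewrite -powRrM mulVf ?gt_eqF// powRr1// ltW.
have pw1 (t q : R) : 0 < q -> 1 <= t -> 1 <= t `^ (q^-1).
  move=> q0 t1; have := @ler_powR _ t t1 0 (q^-1).
  by rewrite powRr0; apply; rewrite invr_ge0 ltW.
have pw1' (t q : R) : 0 < q -> 1 < t -> 1 < t `^ (q^-1).
  move=> q0 t1; rewrite lt_neqAle pw1 ?(ltW t1)// andbT; apply/eqP => tE.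
  by have := pw t q q0 (lt_trans ltr01 t1); rewrite -tE powR1; lra.
have SNE : S !=set0.
  pose t := (1 + m) `^ (pm^-1).
  have t1 : 1 <= t by apply: pw1 => //; lra.
  exists t; split; first by rewrite (lt_le_trans ltr01).
  apply: (le_trans (modular_div_le mD mf f0 t1)).
  rewrite mE -EFinM lee_fin powRN pw//; last lra.
  by rewrite ler_pdivrMl ?mulr1; lra.
(* The infimum is positive: scalings below [t^-1] have modular above 1. *)
have Slow : exists2 c, 0 < c & forall a, S a -> c <= a.
  pose t := (1 + m^-1) `^ (pm^-1).
  have mV : 0 < m^-1 by rewrite invr_gt0.
  have t1 : 1 <= t by apply: pw1 => //; lra.
  have t0 : 0 < t by rewrite (lt_le_trans ltr01).
  exists t^-1; first by rewrite invr_gt0.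
  move=> a [a0 Ma]; rewrite leNgt; apply/negP => at1.
  have : (modular D f <= (t `^ (- pm))%:E * modular D (fun x => f x / t^-1)%R)%E.
    have := @modular_div_le D (fun x => f x / t^-1) t mD (mfa _) _ t1.
    rewrite (_ : (fun x => f x / t^-1 / t) = f); last first.
      by apply/funext => x; rewrite invrK mulfK// gt_eqF.
    by apply => x; rewrite fa0// invr_gt0.
  rewrite mE powRN pw//; last lra.
  have := modular_mono mD mf f0 a0 (ltW at1) => h1 h2.
  have := le_trans h1 Ma => h3.
  have : (m%:E <= ((1 + m^-1)^-1)%:E * 1)%E.
    by apply: (le_trans h2); rewrite lee_wpmul2l// lee_fin invr_ge0; lra.
  rewrite mule1 lee_fin -[leLHS]mulr1 -ler_pdivlMl// => h4.
  have : m^-1 * (1 + m^-1)^-1 < 1 by rewrite ltr_pdivrMr; lra.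
  by lra.
have [c c0 cS] := Slow.
have hinf : has_inf S by split=> //; exists c => a /cS.
pose a := inf S.
have ca : c <= a by apply: lb_le_inf => //.
have a0 : 0 < a by rewrite (lt_le_trans c0).
exists a => //.
have Mafin : (modular D (fun x => f x / a)%R < +oo)%E.
  have [b [b0 Mb] ba] := inf_adherent a0 hinf.
  rewrite -/a in ba.
  have h1 : 1 <= b / a by rewrite ler_pdivlMr// mul1r ge_inf// -?/a//; case: hinf.
  apply: (le_lt_trans (modular_div_ge mD (mfa a) (fun x => fa0 a x a0) h1)).
  rewrite (_ : (fun x => _) = (fun x => f x / b)); last first.
    by apply/funext => x; rewrite invf_div mulrA mulfVK// gt_eqF.
  apply: (@le_lt_trans _ _ (((b / a) `^ pp)%:E * 1)%E); last by rewrite mule1 ltry.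
  by rewrite lee_wpmul2l// lee_fin powR_ge0.
have Man : modular D (fun x => f x / a) \is a fin_num by rewrite ge0_fin_numE ?modular_ge0.
set q := fine (modular D (fun x => f x / a)).
have qE : modular D (fun x => f x / a) = q%:E by rewrite /q fineK.
have q0 : 0 <= q by rewrite -lee_fin -qE modular_ge0.
rewrite qE; congr EFin; apply/eqP; rewrite eq_le; apply/andP; split.
  rewrite leNgt; apply/negP => q1.
  pose t := ((1 + q) / 2) `^ (pp^-1).
  have t1 : 1 < t by apply: pw1' => //; lra.
  have t0 : 0 < t by rewrite (lt_trans ltr01).
  have [b [b0 Mb] ba] : exists2 b, S b & b < a * t.
    by apply: inf_lt => //; rewrite -/a ltr_pMr.
  have : (modular D (fun x => f x / a)%R <= (t `^ pp)%:E * 1)%E.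
    apply: (le_trans (modular_div_ge mD (mfa a) (fun x => fa0 a x a0) (ltW t1))).
    apply: lee_wpmul2l; first by rewrite lee_fin powR_ge0.
    apply: le_trans Mb.
    rewrite (_ : (fun x => _) = (fun x => f x / (a * t))); last first.
      by apply/funext => x; rewrite invfM mulrA.
    by apply: modular_mono => //; exact: ltW.
  by rewrite mule1 qE lee_fin pw//; lra.
rewrite leNgt; apply/negP => q1.
pose t := (2 / (1 + q)) `^ (pp^-1).
have q2 : 1 < 2 / (1 + q) by rewrite ltr_pdivlMr; lra.
have t1 : 1 < t by exact: pw1'.
have t0 : 0 < t by rewrite (lt_trans ltr01).
have at0 : 0 < a / t by rewrite divr_gt0.
have Sat : S (a / t).
  split=> //.
  apply: (le_trans (modular_div_ge mD (mfa _) (fun x => fa0 _ x at0) (ltW t1))).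
  rewrite (_ : (fun x => _) = (fun x => f x / a)); last first.
    by apply/funext => x; field; rewrite !gt_eqF.
  by rewrite qE -EFinM lee_fin pw//; [rewrite mulrAC ler_pdivrMr; lra|lra].
have : a <= a / t by apply: ge_inf => //; case: hinf.
by rewrite ler_pdivlMr// -[leRHS]mulr1 ler_pM2l//; lra.
Qed.

(** Needed to pass from unions of dyadic cells to measurable sets: the
    modular of the symmetric difference is negligible. *)
Lemma modular_abs_continuous (B : set T) (f : T -> R) (e : R) : measurable B ->
  measurable_fun [set: T] f -> (modular B f < +oo)%E -> 0 < e ->
  exists2 dl : R, 0 < dl & forall A, measurable A -> A `<=` B ->
    (mu A < dl%:E -> modular A f <= e%:E)%E.
Proof.
move=> mB mf Bf e0.
pose g : T -> R := fun x => f x `^ p x * \1_B x.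
have mg : measurable_fun [set: T] g.
  apply: measurable_funM; first exact: measurable_powR_fun.
  exact: measurable_indic.
have g0 x : 0 <= g x by rewrite mulr_ge0 ?powR_ge0.
have gA A : A `<=` B -> (\int[mu]_(x in A) (g x)%:E = modular A f)%E.
  by move=> AB; apply: eq_integral => x; rewrite inE => /AB Bx; rewrite /g indicE mem_set// mulr1.
have ig : mu.-integrable setT (EFin \o g).
  apply/integrableP; split; first exact/measurable_EFinP.
  under eq_integral do rewrite /= ger0_norm//.
  rewrite (@integral_support _ _ _ mu B setT) ?gA//.
  by move=> x _ Bx; rewrite /g indicE memNset// mulr0.
have [dl [dl0 h]] := integral_normr_continuous ig e0.
exists dl => // A mA AB Adl; have := h A mA Adl.
rewrite /Rintegral; under eq_integral do rewrite ger0_norm//.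
rewrite gA// => h1; rewrite -(@fineK _ (modular A f)) ?lee_fin ?ltW//.
rewrite ge0_fin_numE ?modular_ge0//; apply: le_lt_trans Bf.
exact: modular_sub.
Qed.

End modular.

(** * Lebesgue measure of boxes *)

Section boxes.
Context {R : realType}.

Definition prod_itv n (J : 'I_n -> interval R) : set 'rV[R]_n :=
  [set x | forall i, x 0 i \in J i].

Lemma measurable_prod_itv n (J : 'I_n -> interval R) : measurable (prod_itv J).
Proof.
have -> : prod_itv J = \bigcap_(i in [set: 'I_n]) (rV_coord i @^-1` [set` J i]).
  by apply/seteqP; split=> x /= h i; [move=> _; exact: h|exact: (h i)].
apply: fin_bigcap_measurable; first exact: finite_finset.
move=> i _; rewrite -[X in measurable X]setTI.
exact: measurable_rV_coord.
Qed.

(** [borel_lebesgue] is an iterated product measure, so a box of dimension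
    [n.+1] is the product of its first edge with a box of dimension [n]. *)
Lemma borel_lebesgue_prod_itv n (J : 'I_n -> interval R) (l : R) :
  (forall i, lebesgue_measure [set` J i] = l%:E) ->
  borel_lebesgue n (prod_itv J) = (l ^+ n)%:E.
Proof.
elim: n J => [|n IH] J Jl.
  rewrite /= diracE mem_set ?expr0// => i; by case: i.
rewrite /= /borel_lebesgue_step /pushforward.
have -> : @rV_cons R n @^-1` prod_itv J =
    [set` J ord0] `*` prod_itv (fun i : 'I_n => J (lift ord0 i)).
  apply/seteqP; split=> -[r x] /=.
    move=> h; split=> /=.
      have := h ord0; rewrite /rV_cons.
      have -> : (ord0 : 'I_(n.+1)) = lshift n (ord0 : 'I_1) by exact/val_inj.
      rewrite (@row_mxEl _ _ 1 n) !mxE eqxx mulr1n/=.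
      by [].
    move=> i; have := h (lift ord0 i); rewrite /rV_cons.
    have -> : lift ord0 i = rshift 1 i :> 'I_(1 + n) by exact/val_inj.
    by rewrite (@row_mxEr _ _ 1 n).
  move=> [/= h0 h] i; rewrite /rV_cons.
  have [->|[j ->]] : i = ord0 \/ exists j, i = lift ord0 j.
    by case: (unliftP ord0 i) => [j ->|->]; [right; exists j|left].
    have E : ord0 = lshift n (ord0 : 'I_1) :> 'I_(1 + n) by exact/val_inj.
    by rewrite [X in fun_of_matrix _ _ X]E (@row_mxEl _ _ 1 n) !mxE eqxx mulr1n.
  have E : lift ord0 j = rshift 1 j :> 'I_(1 + n) by exact/val_inj.
  by rewrite [X in fun_of_matrix _ _ X]E (@row_mxEr _ _ 1 n); exact: h.
rewrite product_measure1E//; last exact: measurable_prod_itv.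
rewrite exprS EFinM; congr (_ * _)%E; first exact: Jl.
by apply: IH => i; exact: Jl.
Qed.

Lemma measurable_borel_lebRn n (A : set 'rV[R]_n) :
  measurable A -> measurable (A : set (lebRn R n)).
Proof. exact: caratheodory_measurable_mu_ext. Qed.

Lemma lebesgue_rV_borel n (A : set 'rV[R]_n) : measurable A ->
  lebesgue_rV A = borel_lebesgue n A.
Proof. by move=> mA; exact: measurable_mu_extE. Qed.

Definition box n (a : 'rV[R]_n) (l : R) (bl br : 'I_n -> bool) : set 'rV[R]_n :=
  prod_itv (fun i => Interval (BSide (bl i) (a 0 i)) (BSide (br i) (a 0 i + l))).

Lemma measurable_box n (a : 'rV[R]_n) l bl br :
  measurable (box a l bl br : set (lebRn R n)).
Proof. apply: measurable_borel_lebRn; exact: measurable_prod_itv. Qed.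

Lemma lebesgue_rV_box n (a : 'rV[R]_n) l bl br : 0 < l ->
  lebesgue_rV (box a l bl br) = (l ^+ n)%:E.
Proof.
move=> l0; rewrite lebesgue_rV_borel; last exact: measurable_prod_itv.
apply: borel_lebesgue_prod_itv => i.
by rewrite lebesgue_measure_itv/= lte_fin ltrDl l0 -EFinB addrAC subrr add0r.
Qed.

End boxes.

(** * Dyadic subdivision of a box *)

Section dyadic.
Context {R : realType} {n : nat}.
Notation T := (lebRn R n).
Notation mu := (@lebesgue_rV R n).

(** The flags say which faces belong to the box.  They cannot be ignored:
    with them the [2 ^+ n] children form an exact partition. *)
Record dbox := DBox {
  corner : 'rV[R]_n; side : R; lflag : 'I_n -> bool; rflag : 'I_n -> bool }.

Definition bset (B : dbox) : set T :=
  box (corner B) (side B) (lflag B) (rflag B).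

Definition child (B : dbox) (c : {ffun 'I_n -> bool}) : dbox :=
  DBox (\row_i (corner B 0 i + (if c i then side B / 2 else 0))) (side B / 2)
    (fun i => c i || lflag B i) (fun i => c i ==> rflag B i).

Lemma measurable_bset B : measurable (bset B).
Proof. exact: measurable_box. Qed.

Lemma mu_bset B : 0 < side B -> mu (bset B) = (side B ^+ n)%:E.
Proof. exact: lebesgue_rV_box. Qed.

Lemma cube_bset B : 0 < side B -> cube (bset B).
Proof. by move=> ?; exists (corner B), (side B), (lflag B), (rflag B). Qed.

Lemma side_child B c : side (child B c) = side B / 2.
Proof. by []. Qed.

Lemma side_child_gt0 B c : 0 < side B -> 0 < side (child B c).
Proof. by move=> ?; rewrite side_child divr_gt0. Qed.

(** The child in which a point lies: coordinate [i] is [true] when the point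
    is in the upper half of the box in that direction. *)
Definition cell_of (B : dbox) (x : T) : {ffun 'I_n -> bool} :=
  [ffun i => corner B 0 i + side B / 2 <= (x : 'rV_n) 0 i].

Lemma child_bset B c : 0 < side B ->
  bset (child B c) = bset B `&` [set x | cell_of B x = c].
Proof.
move=> l0; have l2 : 0 < side B / 2 by rewrite divr_gt0.
have key (x : T) i (ci := c i) :
    ((x : 'rV_n) 0 i \in Interval
      (BSide (ci || lflag B i) (corner B 0 i + (if ci then side B / 2 else 0)))
      (BSide (ci ==> rflag B i)
             (corner B 0 i + (if ci then side B / 2 else 0) + side B / 2))) =
    ((x : 'rV_n) 0 i \in Interval (BSide (lflag B i) (corner B 0 i))
       (BSide (rflag B i) (corner B 0 i + side B))) &&
    ((corner B 0 i + side B / 2 <= (x : 'rV_n) 0 i) == ci).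
  move: (lflag B i) (rflag B i) ((x : 'rV_n) 0 i) (corner B 0 i) (side B) l0 l2 ci.
  move=> bl br y a l l0 l2 ci.
  rewrite !in_itv/=.
  case: ci; rewrite ?eqb_id ?eqbF_neg -?ltNge /=;
    case: bl; case: br => /=; apply/idP/idP; lra.
apply/seteqP; split=> [x h|x [h1 h2] i]; last first.
  by rewrite mxE key h1/= -h2 ffunE eqxx.
split=> [i|].
  by have := h i; rewrite mxE key => /andP[].
apply/ffunP => i; rewrite ffunE.
by have := h i; rewrite mxE key => /andP[_ /eqP].
Qed.

Lemma child_sub B c : 0 < side B -> bset (child B c) `<=` bset B.
Proof. by move=> l0; rewrite child_bset//; exact: subIsetl. Qed.

Lemma mu_child B c : 0 < side B ->
  mu (bset B) = ((2 ^+ n)%:E * mu (bset (child B c)))%E.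
Proof.
move=> l0; rewrite !mu_bset ?side_child_gt0// side_child -EFinM.
by rewrite expr_div_n mulrC divfK// expf_neq0.
Qed.

Lemma trivIset_child B (D : set T) : 0 < side B ->
  trivIset setT (fun c => bset (child B c) `&` D).
Proof.
move=> l0; apply/trivIsetP => /= c d _ _ cd; apply/seteqP; split=> // x /=.
rewrite !child_bset// => -[[[_ /= hc] _] [[_ /= hd] _]].
by move/eqP: cd; apply; rewrite -hc -hd.
Qed.

Lemma bset_cover B (D : set T) : 0 < side B ->
  bset B `&` D =
  \big[setU/set0]_(c <- index_enum {ffun 'I_n -> bool}) (bset (child B c) `&` D).
Proof.
move=> l0; rewrite -bigcup_seq; apply/seteqP; split=> x /=.
  move=> [Bx Dx]; exists (cell_of B x); first by rewrite /= mem_index_enum.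
  by split=> //; rewrite child_bset.
by move=> [c _ [+ Dx]]; rewrite child_bset// => -[].
Qed.

Lemma integral_cells B (D : set T) (f : T -> \bar R) : 0 < side B ->
  measurable D -> measurable_fun [set: T] f -> (forall x, 0 <= f x)%E ->
  (\int[mu]_(x in bset B `&` D) f x =
   \sum_c \int[mu]_(x in bset (child B c) `&` D) f x)%E.
Proof.
move=> l0 mD mf f0; rewrite bset_cover// ge0_integral_bigsetU//.
- by move=> c; apply: measurableI => //; exact: measurable_bset.
- exact: index_enum_uniq.
- by apply: (@sub_trivIset _ _ _ setT) => //; exact: trivIset_child.
- exact: measurable_funTS.
Qed.

Lemma mu_cells B (D : set T) : 0 < side B -> measurable D ->
  mu (bset B `&` D) = (\sum_c mu (bset (child B c) `&` D))%E.
Proof.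
move=> l0 mD.
have mI (A : set T) : measurable A -> mu A = (\int[mu]_(x in A) cst 1 x)%E.
  by move=> mA; rewrite integral_cst// mul1e.
rewrite mI; last by apply: measurableI => //; exact: measurable_bset.
rewrite integral_cells//.
apply: eq_bigr => c _; rewrite -mI//.
by apply: measurableI => //; exact: measurable_bset.
Qed.

End dyadic.

(** * Density of finite unions of dyadic cells *)

Section simple_sets.
Context {R : realType} {n : nat}.
Notation T := (lebRn R n).
Notation mu := (@lebesgue_rV R n).

(** [G] is, inside [B], a union of dyadic cells of generation [k]. *)
Fixpoint simple (k : nat) (B : dbox) (G : set T) : Prop :=
  if k is k'.+1 then forall c, simple k' (child B c) G
  else bset B `<=` G \/ bset B `&` G = set0.

Lemma simple_eq k (B : @dbox R n) (G H : set T) : 0 < side B ->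
  bset B `&` G = bset B `&` H -> simple k B G -> simple k B H.
Proof.
elim: k B => [|k IH] B l0 GH /=.
  move=> [BG|BG]; [left|right]; last by rewrite -GH.
  move=> x Bx; have : (bset B `&` G) x by split=> //; exact: BG.
  by rewrite GH => -[].
move=> h c; apply: IH (h c); first exact: side_child_gt0.
rewrite -(setIidl (child_sub (c := c) l0)).
by rewrite -!setIA GH.
Qed.

Lemma simple_full k (B : @dbox R n) (G : set T) : 0 < side B ->
  bset B `<=` G -> simple k B G.
Proof.
elim: k B => [|k IH] B l0 BG /=; first by left.
move=> c; apply: IH; first exact: side_child_gt0.
exact: subset_trans (child_sub l0) BG.
Qed.

Lemma simple_empty k (B : @dbox R n) (G : set T) : 0 < side B ->
  bset B `&` G = set0 -> simple k B G.
Proof.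
elim: k B => [|k IH] B l0 BG /=; first by right.
move=> c; apply: IH; first exact: side_child_gt0.
by rewrite -(setIidl (child_sub (c := c) l0)) -setIA BG setI0.
Qed.

Lemma simple_le k k' (B : @dbox R n) (G : set T) : 0 < side B -> (k <= k')%N ->
  simple k B G -> simple k' B G.
Proof.
elim: k k' B => [|k IH] k' B l0 kk' /=.
  by case=> ?; [exact: simple_full|exact: simple_empty].
case: k' kk' => // k' kk' h c; apply: IH (h c) => //; exact: side_child_gt0.
Qed.

Lemma simpleC k (B : @dbox R n) (G : set T) : simple k B G -> simple k B (~` G).
Proof.
elim: k B => [|k IH] B /=; last by move=> h c; exact: IH.
case=> BG; [right|left]; last by rewrite -disjoints_subset.
by apply/seteqP; split=> // x [/BG].
Qed.

Lemma simpleU k (B : @dbox R n) (G H : set T) :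
  simple k B G -> simple k B H -> simple k B (G `|` H).
Proof.
elim: k B => [|k IH] B /=; last by move=> h h' c; exact: IH.
case=> BG; first by left=> x /BG; left.
case=> BH; first by left=> x /BH; right.
by right; rewrite setIUr BG BH setU0.
Qed.

Lemma measurable_simple k (B : @dbox R n) (G : set T) : 0 < side B ->
  simple k B G -> measurable (bset B `&` G).
Proof.
elim: k B => [|k IH] B l0 /=.
  by case=> [BG|->]//; rewrite setIidl//; exact: measurable_bset.
move=> h; rewrite bset_cover//; apply: bigsetU_measurable => c _.
by apply: IH => //; exact: side_child_gt0.
Qed.

Definition approximable (B : @dbox R n) (E : set T) :=
  measurable E /\ forall e : R, 0 < e -> exists k (G : set T),
    [/\ measurable G, simple k B G & (mu (bset B `&` (E `+` G)) < e%:E)%E].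

Lemma mu_bset_setI_fin (B : @dbox R n) (E : set T) : 0 < side B -> measurable E ->
  (mu (bset B `&` E) < +oo)%E.
Proof.
move=> l0 mE; apply: (@le_lt_trans _ _ (mu (bset B))); last by rewrite mu_bset// ltry.
apply: le_measure; rewrite ?inE; last exact: subIsetl.
  by apply: measurableI => //; exact: measurable_bset.
exact: measurable_bset.
Qed.

Lemma measurable_setY (E F : set T) : measurable E -> measurable F ->
  measurable (E `+` F).
Proof. by move=> mE mF; apply: measurableU; exact: measurableD. Qed.

Lemma approximable_lim (B : @dbox R n) (E : set T) : 0 < side B -> measurable E ->
  (forall e : R, 0 < e -> exists2 F, approximable B F &
     (mu (bset B `&` (E `+` F)) < e%:E)%E) ->
  approximable B E.
Proof.
move=> l0 mE h; split=> // e e0; have e20 : 0 < e / 2 by rewrite divr_gt0.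
have [F [mF aF] EF] := h _ e20; have [k [G [mG sG FG]]] := aF _ e20.
exists k, G; split=> //; have mB := measurable_bset B.
apply: (@le_lt_trans _ _ (mu (bset B `&` (E `+` F)) + mu (bset B `&` (F `+` G)))%E).
  apply: le_trans (measureU2 _ _ _); last 2 first.
  - by apply: measurableI => //; exact: measurable_setY.
  - by apply: measurableI => //; exact: measurable_setY.
  apply: le_measure; rewrite ?inE.
  - by apply: measurableI => //; exact: measurable_setY.
  - by apply: measurableU; apply: measurableI => //; exact: measurable_setY.
  - move=> x [Bx] /=; have := EM (F x); tauto.
by rewrite (splitr e) EFinD lteD.
Qed.

Lemma approximableC (B : @dbox R n) (E : set T) : approximable B E ->
  approximable B (~` E).
Proof.
move=> [mE aE]; split=> [|e e0]; first exact: measurableC.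
have [k [G [mG sG EG]]] := aE _ e0; exists k, (~` G); split.
- exact: measurableC.
- exact: simpleC.
- rewrite [X in bset B `&` X](_ : _ = E `+` G)//.
  by apply/seteqP; split=> x /=; have := EM (E x); have := EM (G x); tauto.
Qed.

Lemma approximableU (B : @dbox R n) (E F : set T) : 0 < side B ->
  approximable B E -> approximable B F -> approximable B (E `|` F).
Proof.
move=> l0 [mE aE] [mF aF]; split=> [|e e0]; first exact: measurableU.
have e20 : 0 < e / 2 by rewrite divr_gt0.
have [k [G [mG sG EG]]] := aE _ e20; have [k' [G' [mG' sG' EG']]] := aF _ e20.
exists (maxn k k'), (G `|` G'); split; first exact: measurableU.
  apply: simpleU; [apply: simple_le sG|apply: simple_le sG'] => //.
    exact: leq_maxl.
  exact: leq_maxr.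
have mB := measurable_bset B.
apply: (@le_lt_trans _ _ (mu (bset B `&` (E `+` G)) + mu (bset B `&` (F `+` G')))%E).
  apply: le_trans (measureU2 _ _ _); last 2 first.
  - by apply: measurableI => //; exact: measurable_setY.
  - by apply: measurableI => //; exact: measurable_setY.
  apply: le_measure; rewrite ?inE.
  - by apply: measurableI => //; apply: measurable_setY; exact: measurableU.
  - by apply: measurableU; apply: measurableI => //; exact: measurable_setY.
  - by move=> x [Bx] /=; tauto.
by rewrite (splitr e) EFinD lteD.
Qed.

Lemma approximable0 (B : @dbox R n) : approximable B set0.
Proof.
split=> // e e0; exists 0%N, set0; split=> //; first by right; rewrite setI0.
by rewrite setYK setI0 measure0.
Qed.

Lemma approximable_bigcup (B : @dbox R n) (F : (set T)^nat) : 0 < side B ->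
  (forall j, approximable B (F j)) -> approximable B (\bigcup_j F j).
Proof.
move=> l0 aF; have mB := measurable_bset B.
have mF j : measurable (F j) by case: (aF j).
have mU : measurable (\bigcup_j F j) by exact: bigcupT_measurable.
pose S N := \big[setU/set0]_(j < N) F j.
have aS N : approximable B (S N).
  rewrite /S; elim: N => [|N IH]; first by rewrite big_ord0; exact: approximable0.
  by rewrite big_ord_recr/=; exact: approximableU.
have mS N : measurable (S N) by case: (aS N).
apply: approximable_lim => // e e0.
have cvgS : (mu \o (fun N => bset B `&` S N)) @ \oo --> mu (bset B `&` \bigcup_j F j).
  rewrite [X in bset B `&` X](_ : _ = \bigcup_N S N).
    rewrite setI_bigcupr; apply: nondecreasing_cvg_mu => //.
    - by move=> N; exact: measurableI.
    - by rewrite -setI_bigcupr; apply: measurableI => //; exact: bigcupT_measurable.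
    - move=> i j ij; apply/subsetPset; apply: setIS.
      exact: subset_bigsetU.
  apply/seteqP; split=> x [j _ Fj].
    by exists j.+1 => //; rewrite /S -bigcup_mkord; exists j => /=.
  by move: Fj; rewrite /S -bigcup_mkord => -[i _ Fi]; exists i.
have fin := mu_bset_setI_fin l0 mU.
have finE : mu (bset B `&` \bigcup_j F j) \is a fin_num by rewrite ge0_fin_numE.
have /(cvgS _) : nbhs (mu (bset B `&` \bigcup_j F j))
    [set y : \bar R | (mu (bset B `&` \bigcup_j F j) - e%:E < y)%E].
  apply: open_ereal_gt'.
  by rewrite -(fineK finE) -EFinB lte_fin ltrBlDr ltrDl.
move=> [N _ hN]; exists (S N) => //.
have SU : S N `<=` \bigcup_j F j by rewrite /S -bigcup_mkord => x [i _ Fi]; exists i.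
have /= := hN N (leqnn N); rewrite EFinN lteBlDl//.
have -> : mu (bset B `&` \bigcup_j F j) =
    (mu (bset B `&` (\bigcup_j F j `+` S N)) + mu (bset B `&` S N))%E.
  rewrite -measureU.
  - congr (mu _); apply/seteqP; split=> x /=; have := @SU x; have := EM (S N x); tauto.
  - by apply: measurableI => //; exact: measurable_setY.
  - exact: measurableI.
  - by apply/seteqP; split=> x //=; have := @SU x; tauto.
by rewrite lteD2rE// ge0_fin_numE//; exact: mu_bset_setI_fin.
Qed.

Lemma measurable_coord_lt (i : 'I_n) (c : R) :
  measurable [set x : T | (x : 'rV[R]_n) 0 i < c].
Proof.
apply: measurable_borel_lebRn.
rewrite (_ : [set x | _] = rV_coord i @^-1` `]-oo, c[%classic).
  by rewrite -[X in measurable X]setTI; exact: measurable_rV_coord.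
by apply/seteqP; split=> x /=; rewrite in_itv.
Qed.

(** Flipping the bit [i] exchanges the two halves of the index set. *)
Lemma sum_half_cells (i : 'I_n) (b : bool) (a : R) :
  \sum_(c : {ffun 'I_n -> bool} | c i == b) a =
  2^-1 * \sum_(c : {ffun 'I_n -> bool}) a.
Proof.
pose flip (c : {ffun 'I_n -> bool}) := [ffun j => if j == i then ~~ c j else c j].
have flipK : involutive flip.
  by move=> c; apply/ffunP => j; rewrite !ffunE; case: eqP => // _; rewrite negbK.
have E : \sum_(c : {ffun 'I_n -> bool} | c i == b) a =
         \sum_(c : {ffun 'I_n -> bool} | ~~ (c i == b)) a.
  rewrite (reindex_inj (inv_inj flipK)); apply: eq_bigl => c.
  by rewrite ffunE eqxx; case: (c i); case: b.
by rewrite [in RHS](bigID (fun c : {ffun 'I_n -> bool} => c i == b))/= -E; lra.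
Qed.

(** Only the cells crossed by the hyperplane of equation [x_i = t] are
    approximated badly.  At each generation the cells on one side of the
    median are decided, so that half of the volume remains. *)
Lemma simple_approx_lt k (B : @dbox R n) (i : 'I_n) (t : R) : 0 < side B ->
  exists2 G : set T, simple k B G &
    (mu (bset B `&` ([set x : T | ((x : 'rV_n) 0 i < t)%R] `+` G))
    <= (2 ^- k * side B ^+ n)%:E)%E.
Proof.
pose E := [set x : T | (x : 'rV_n) 0 i < t]; rewrite -/E.
have mE : measurable E by exact: measurable_coord_lt.
elim: k B => [|k IH] B l0.
  exists set0; first by right; rewrite setI0.
  rewrite expr0 invr1 mul1r -mu_bset// setY0; apply: le_measure; rewrite ?inE.
  - by apply: measurableI => //; exact: measurable_bset.
  - exact: measurable_bset.
  - exact: subIsetl.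
pose m := corner B 0 i + side B / 2.
pose b := m < t.
have l2 : 0 < side B / 2 by rewrite divr_gt0.
have /choice[Gc hGc] : forall c : {ffun 'I_n -> bool}, exists G : set T,
    simple k (child B c) G /\
    (mu (bset (child B c) `&` (E `+` G)) <=
     (if c i == b then 2 ^- k * (side B / 2) ^+ n else 0)%:E)%E.
  move=> c; case: eqP => cb.
    by have [G sG hG] := IH (child B c) l2; exists G.
  have [bT|bF] := boolP b.
    exists setT; split; first by apply: simple_full.
    rewrite [X in mu X](_ : _ = set0) ?measure0//.
    apply/seteqP; split=> // x /= [+ [[_ nT]|[_ nE]]] //; rewrite child_bset// => -[_ /= xc].
    apply: nE; move: cb; rewrite -xc ffunE -/m bT => /negP; rewrite -ltNge => xm.
    exact: lt_trans bT.
  exists set0; split; first by apply: simple_empty => //; rewrite setI0.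
  rewrite [X in mu X](_ : _ = set0) ?measure0//.
  apply/seteqP; split=> // x /= [+ [[+ _]|[]//]].
  rewrite child_bset// => -[_ /= xc] Ex; move: cb; rewrite -xc ffunE -/m (negbTE bF).
  move/eqP; rewrite eqbF_neg negbK => mx; move: bF; rewrite /b -leNgt => tm.
  by move: Ex; rewrite /E/= ltNge (le_trans tm mx).
pose G := [set x : T | bset B x /\ Gc (cell_of B x) x].
have GE c : bset (child B c) `&` G = bset (child B c) `&` Gc c.
  apply/seteqP; split=> x /= [].
    move=> xc [_ Gx]; split=> //.
    by move: Gx xc; rewrite child_bset// => + [_ /= <-].
  move=> xc Gx; split=> //; split; first exact: child_sub xc.
  by move: xc; rewrite child_bset// => -[_ /= ->].
have sG : simple k.+1 B G.
  by move=> c; apply: (@simple_eq _ _ (Gc c)); [exact: l2|rewrite GE|case: (hGc c)].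
have mG : measurable G.
  by rewrite (_ : G = bset B `&` G); [exact: (measurable_simple l0 sG)|apply/seteqP; split=> x //= []].
exists G => //; rewrite mu_cells//; last exact: measurable_setY.
apply: (@le_trans _ _ (\sum_(c : {ffun 'I_n -> bool})
  (if c i == b then 2 ^- k * (side B / 2) ^+ n else 0)%:E)%E).
  apply: lee_sum => c _; have [_] := hGc c; apply: le_trans.
  rewrite (_ : _ `&` _ = bset (child B c) `&` (E `+` Gc c))//.
  by rewrite !setIYr GE.
rewrite sumEFin -big_mkcond/= sum_half_cells lee_fin.
rewrite sumr_const card_ffun card_bool card_ord -[X in _ * X <= _]mulr_natl natrX.
have n0 : (2 : R) ^+ n != 0 by rewrite expf_neq0.
have k0 : (2 : R) ^+ k != 0 by rewrite expf_neq0.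
by rewrite expr_div_n exprS le_eqVlt; apply/orP; left; apply/eqP; field; rewrite n0 k0.
Qed.

Lemma approximable_lt (B : @dbox R n) (i : 'I_n) (c : R) : 0 < side B ->
  approximable B [set x : T | (x : 'rV[R]_n) 0 i < c].
Proof.
move=> l0; split; first exact: measurable_coord_lt.
move=> e e0.
have [k hk] : exists k, 2 ^- k * side B ^+ n < e.
  have B0 : 0 < side B ^+ n by rewrite exprn_gt0.
  exists (Num.truncn (side B ^+ n / e)).+1.
  rewrite mulrC ltr_pdivrMr ?exprn_gt0// -ltr_pdivrMl// mulrC.
  apply: (lt_le_trans (truncnS_gt _)).
  by rewrite -natrX ler_nat ltnW// ltn_expl.
have [G sG hG] := simple_approx_lt k i c l0.
exists k, (bset B `&` G); split.
- exact: (measurable_simple l0 sG).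
- by apply: simple_eq sG => //; rewrite setIA setIid.
- apply: (@le_lt_trans _ _ (2 ^- k * side B ^+ n)%:E); last by rewrite lte_fin.
  apply: le_trans hG.
  rewrite (_ : _ `&` _ = bset B `&` ([set x : T | (x : 'rV_n) 0 i < c] `+` G))//.
  by apply/seteqP; split=> x /=; tauto.
Qed.

Lemma approximable_borel (B : @dbox R n) (E : set 'rV[R]_n) : 0 < side B ->
  measurable E -> approximable B (E : set T).
Proof.
move=> l0; move: E.
have sC : sigma_algebra setT (approximable B).
  split; first exact: approximable0.
    by move=> A aA; rewrite setTD; exact: approximableC.
  by move=> F aF; exact: approximable_bigcup.
apply: smallest_sub => // E /=; rewrite -bigcup_seq => -[i _ [Y mY <-]].
rewrite setTI.
have sD : sigma_algebra setT [set Y : set R | approximable B (rV_coord i @^-1` Y)].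
  have [s0 sC' sU] := sC.
  split; first by rewrite /= preimage_set0.
    by move=> A /= aA; rewrite setTD preimage_setC -setTD; exact: sC'.
  by move=> F /= aF; rewrite preimage_bigcup; exact: sU.
have : (@ocitv R).-sigma.-measurable Y by [].
rewrite RGenInftyO.measurableE; move: Y {mY}.
apply: smallest_sub => // _ [c ->] /=.
rewrite [X in approximable B X](_ : _ = [set x : T | (x : 'rV_n) 0 i < c]);
  first exact: approximable_lt.
by apply/seteqP; split=> x /=; rewrite in_itv.
Qed.

(** Half-spaces are approximable, approximable sets form a sigma-algebra, and
    a Lebesgue measurable set differs little from a Borel set that covers it
    inside the box. *)
Lemma approximable_measurable (B : @dbox R n) (E : set T) : 0 < side B ->
  measurable E -> approximable B E.
Proof.
move=> l0 mE; apply: approximable_lim => // e e0.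
have fin := mu_bset_setI_fin l0 mE.
have mB := measurable_bset B.
have finE : mu (bset B `&` E) \is a fin_num by rewrite ge0_fin_numE.
have : (mu (bset B `&` E) < mu (bset B `&` E) + e%:E)%E by rewrite lteDl.
rewrite {1}/lebesgue_rV {1}/completed_measure_extension {1}/mu_ext.
move=> /ereal_inf_lt[_ [A [mA EA] <-] Alt].
pose U := \bigcup_k A k.
have mU : measurable (U : set 'rV[R]_n) by exact: bigcupT_measurable.
have mU' : measurable (U : set T) by exact: measurable_borel_lebRn.
exists U; first exact: approximable_borel.
have muU : (mu U < mu (bset B `&` E) + e%:E)%E.
  apply: le_lt_trans Alt; rewrite [leLHS]lebesgue_rV_borel//.
  exact: measure_sigma_subadditive.
apply: (@le_lt_trans _ _ (mu (U `\` (bset B `&` E)))).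
  apply: le_measure; rewrite ?inE.
  - by apply: measurableI => //; exact: measurable_setY.
  - by apply: measurableD => //; exact: measurableI.
  - by move=> x [Bx] /= [[Ex nUx]|]; [case: nUx; exact: EA|tauto].
rewrite measureD//; [|exact: measurableI|].
  rewrite (_ : U `&` _ = bset B `&` E); last by apply/setIidr; exact: EA.
  by rewrite lteBlDl.
by rewrite (lt_le_trans muU)// leey.
Qed.

End simple_sets.

(** * Stopping boxes *)

Section stopping_cubes.
Context {R : realType} {n : nat}.
Notation T := (lebRn R n).
Notation mu := (@lebesgue_rV R n).
Local Open Scope ereal_scope.

(** The local inequality is a hypothesis on the boxes inside [E] only, and
    [E] is chosen before [f]: the inequality will be available only for
    functions whose modular over [E] is already known to be at most [1]. *)
Definition stopping_ineq (G E : set T) := forall (f g : T -> \bar R) (K : R),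
  (0 <= K)%R ->
  measurable_fun [set: T] f -> (forall x, 0 <= f x) ->
  measurable_fun [set: T] g -> (forall x, 0 <= g x) ->
  (forall P : @dbox R n, (0 < side P)%R -> bset P `<=` E ->
    mu (bset P `&` G) <= (2^-1)%:E * mu (bset P) ->
    \int[mu]_(x in bset P) f x <=
      K%:E * \int[mu]_(x in bset P `\` G) f x + \int[mu]_(x in bset P) g x) ->
  \int[mu]_(x in E) f x <=
    K%:E * \int[mu]_(x in E `\` G) f x + \int[mu]_(x in E) g x.

(** The maximal dyadic boxes in which the density of [G] exceeds
    [2 ^- n.+1] cover [G], and their parents have smaller density; as a child
    has [2 ^- n] of the measure of its parent, [G] fills at most half of each of
    them.  The union [E] of these boxes is constructed by recursion on the
    generation. *)
Lemma stopping_cubes (G : set T) k (B : @dbox R n) :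
  (0 < side B)%R -> measurable G -> simple k B G ->
  mu (bset B `&` G) <= (2 ^- n.+1)%:E * mu (bset B) ->
  exists E : set T,
    [/\ measurable E, simple k B E, E `<=` bset B & bset B `&` G `<=` E] /\
    (2 ^- n.+1)%:E * mu E <= mu (bset B `&` G) /\ stopping_ineq G E.
Proof.
move=> + mG; elim: k B => [|k IH] B l0.
  move=> /= [BG|BG] muG.
    exfalso; move: muG; rewrite setIidl// mu_bset// -EFinM lee_fin leNgt.
    by rewrite gtr_pMl ?exprn_gt0// invf_lt1 ?exprn_gt0// exprn_egt1// ltr1n.
  exists set0; split.
    split => //; first by right; rewrite setI0.
    by rewrite BG.
  rewrite measure0 mule0; split=> // f g K *.
  by rewrite set0D !integral_set0 mule0 adde0.
move=> sG muG.
have mB (P : @dbox R n) := measurable_bset P.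
have /choice[Ec hEc] : forall c : {ffun 'I_n -> bool}, exists E : set T,
    [/\ measurable E, simple k (child B c) E, E `<=` bset (child B c) &
      bset (child B c) `&` G `<=` E] /\
    (2 ^- n.+1)%:E * mu E <= mu (bset (child B c) `&` G) /\ stopping_ineq G E.
  move=> c; have cl0 := side_child_gt0 c l0.
  have [small|big] := leP (mu (bset (child B c) `&` G))
      ((2 ^- n.+1)%:E * mu (bset (child B c))).
    exact: IH.
  (* A stopping box: the parent [B] has density at most [2 ^- n.+1]. *)
  exists (bset (child B c)); split; last split.
  - by split=> //; exact: simple_full.
  - exact: ltW.
  - move=> f g K K0 mf f0 mg g0; apply => //.
    apply: (@le_trans _ _ (mu (bset B `&` G))).
      apply: le_measure; rewrite ?inE; try exact: measurableI.
      by apply: setSI; exact: child_sub.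
    apply: (le_trans muG); rewrite (mu_child c)// muleA -EFinM.
    by rewrite exprSr invfM mulrAC mulVf ?mul1r// expf_neq0.
pose E := [set x : T | bset B x /\ Ec (cell_of B x) x].
have EE c : bset (child B c) `&` E = Ec c.
  have [[_ _ sub _] _] := hEc c; apply/seteqP; split=> x /=.
    by move=> [+ [Bx]]; rewrite child_bset// => -[_ /= <-].
  move=> Ex; have xc := sub _ Ex; split => //; split; first exact: child_sub xc.
  by move: xc; rewrite child_bset// => -[_ /= ->].
have EDE c : bset (child B c) `&` (E `\` G) = Ec c `\` G.
  by rewrite setIDA EE.
have EB : E `<=` bset B by move=> x [].
have sE : simple k.+1 B E.
  move=> c; have [[_ sEc _ _] _] := hEc c.
  apply: simple_eq sEc; first exact: side_child_gt0.
  by rewrite EE setIC setIidl//; have [[]] := hEc c.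
have mE : measurable E.
  by rewrite -(setIidr EB); exact: (measurable_simple l0 sE).
exists E; split; [split=> //|split].
- move=> x [Bx Gx]; split=> //.
  by have [[_ _ _ h] _] := hEc (cell_of B x); apply: h; split => //; rewrite child_bset.
- rewrite -[X in mu X](setIidr EB) !mu_cells// ge0_sume_distrr//.
  by apply: lee_sum => c _; rewrite EE; have [_ []] := hEc c.
- move=> f g K K0 mf f0 mg g0 loc.
  have EGB : E `\` G `<=` bset B by move=> x [/EB].
  rewrite -[X in K%:E * \int[mu]_(x in X) _](setIidr EGB).
  rewrite -[X in \int[mu]_(x in X) f x <= _](setIidr EB).
  rewrite -[X in _ <= _ + \int[mu]_(x in X) _](setIidr EB).
  have mEG : measurable (E `\` G) by exact: measurableD.
  rewrite !integral_cells//.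
  rewrite ge0_sume_distrr//; last by move=> c _; exact: integral_ge0.
  rewrite -big_split/=; apply: lee_sum => c _; rewrite EE EDE.
  have [_ [_ h]] := hEc c; apply: h => // P lP PE; apply: loc => //.
  by apply: subset_trans PE _; rewrite -EE; exact: subIsetr.
Qed.

End stopping_cubes.

(** * An integrable background of polynomial decay *)

Section background.
Context {R : realType} {n : nat}.
Notation T := (lebRn R n).
Notation mu := (@lebesgue_rV R n).

Definition bigbox k : @dbox R n :=
  DBox (const_mx (- 2 ^+ k)) (2 ^+ k.+1) (fun=> true) (fun=> false).

Lemma bigboxE k (x : T) :
  bset (bigbox k) x <-> forall i, `|(x : 'rV_n) 0 i| <= 2 ^+ k.
Proof.
rewrite /bset /box /prod_itv/=; split=> h i; have := h i;
  rewrite mxE in_itv/= ler_norml exprS; lra.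
Qed.

Lemma side_bigbox k : 0 < side (bigbox k).
Proof. exact: exprn_gt0. Qed.

(** The box [bigbox k] has measure [2 ^+ (k.+1 * n)], so the [k]-th term of
    the background has integral [2 ^- k.+1]. *)
Definition bgcoef k : R := 2 ^- (k.+1 * n.+1).

Definition background (x : T) : \bar R :=
  (\sum_(k <oo) (bgcoef k * \1_(bset (bigbox k)) x)%:E)%E.

Lemma bgcoef_ge0 k : 0 <= bgcoef k.
Proof. by rewrite invr_ge0 exprn_ge0. Qed.

Let term_ge0 k x : (0 <= (bgcoef k * \1_(bset (bigbox k)) x)%:E)%E.
Proof. by rewrite lee_fin mulr_ge0 ?bgcoef_ge0. Qed.

Let measurable_indic_bigbox k :
  measurable_fun [set: T] (\1_(bset (bigbox k)) : T -> R).
Proof. exact: measurable_indic (measurable_bset _). Qed.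

Let measurable_term k :
  measurable_fun [set: T] (fun x => (bgcoef k * \1_(bset (bigbox k)) x)%:E).
Proof.
have mc : measurable_fun [set: T] (fun x : T => bgcoef k * \1_(bset (bigbox k)) x).
  exact: measurable_funM (measurable_cst _) (measurable_indic_bigbox k).
exact/measurable_EFinP.
Qed.

Lemma background_ge0 x : (0 <= background x)%E.
Proof. by apply: nneseries_ge0 => k _ _; exact: term_ge0. Qed.

Lemma measurable_background : measurable_fun [set: T] background.
Proof. by apply: ge0_emeasurable_sum => k *; [exact: term_ge0|exact: measurable_term]. Qed.

Lemma integral_background_le1 : (\int[mu]_x background x <= 1)%E.
Proof.
rewrite integral_nneseries//; last first.
apply: (@le_trans _ _ (\sum_(k <oo) (2^-1 * 2^-1 ^+ k)%:E)%E).
  apply: lee_nneseries => k _; first by move=> _; exact: integral_ge0.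
  under eq_integral do rewrite EFinM.
  rewrite ge0_integralZlT; last 4 first.
  - exact: measurableT.
  - apply/measurable_EFinP; exact: measurable_indic_bigbox.
  - by move=> x; rewrite lee_fin.
  - exact: bgcoef_ge0.
  rewrite integral_indic ?setIT; [|exact: measurableT|exact: measurable_bset].
  rewrite [X in (_ * X <= _)%E](mu_bset (side_bigbox k)) -EFinM lee_fin /= -exprM /bgcoef.
  by rewrite mulnS exprD invfM -mulrA mulVf ?expf_neq0// mulr1 exprS invfM exprVn.
have h2 : (2^-1 : R) < 1 by lra.
apply: (le_trans (geometric_nneseries_le _ _ h2)); rewrite ?invr_ge0//.
by rewrite lee_fin (_ : 1 - 2^-1 = 2^-1 :> R) ?divff//; lra.
Qed.

Lemma integral_background_sub (D : set T) : measurable D ->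
  (\int[mu]_(x in D) background x <= 1)%E.
Proof.
move=> mD; apply: le_trans integral_background_le1.
apply: ge0_subset_integralT mD measurableT measurable_background background_ge0 _.
exact: subsetT.
Qed.

Definition bgexp : R := (3 * n.+1)%:R.

(** Polynomial decay is all that is used of the background.  With [k] minimal
    such that [2 ^+ k] bounds the coordinates, the [k]-th coefficient is at
    least [(e + s) ^- (3 * n.+1)]. *)
Lemma background_ge (x : T) (s : R) : 0 <= s ->
  (forall i, `|(x : 'rV_n) 0 i| <= s) ->
  ((expR (- (bgexp * ln (expR 1 + s))))%:E <= background x)%E.
Proof.
move=> s0 xs.
have e2 : 2 <= expR 1 :> R by have := expR_ge1Dx (1 : R); lra.
have es0 : 0 < expR 1 + s by lra.
have [k sk k2] : exists2 k, s <= 2 ^+ k & (2 : R) ^+ k <= 2 * s + 1.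
  have ex : exists k, s <= 2 ^+ k.
    exists (Num.truncn s).+1; apply: ltW; apply: (lt_le_trans (truncnS_gt _)).
    by rewrite -natrX ler_nat ltnW// ltn_expl.
  have [[|k] sk kmin] := ex_minnP ex.
    by exists 0%N => //; rewrite expr0; lra.
  exists k.+1 => //; have : ~~ (s <= 2 ^+ k) by apply/negP => /kmin; rewrite ltnn.
  by rewrite -ltNge exprS; lra.
apply: (@le_trans _ _ (bgcoef k * \1_(bset (bigbox k)) x)%:E).
  rewrite indicE mem_set; last by apply/bigboxE => i; exact: le_trans (xs i) sk.
  rewrite mulr1 lee_fin expRN /bgcoef lef_pV2 ?posrE ?expR_gt0 ?exprn_gt0//.
  rewrite /bgexp expRM_natl lnK ?posrE// exprM [X in _ <= X]exprM.
  apply: lerXn2r; rewrite ?nnegrE ?exprn_ge0//; first lra.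
  set a := expR 1 + s; have a2 : 2 <= a by rewrite /a; lra.
  have k2a : 2 ^+ k.+1 <= 4 * a by rewrite exprS /a; lra.
  have : 4 <= a * a by nra.
  by rewrite (_ : a ^+ 3 = a * a * a); [nra|rewrite !exprS expr0; ring].
have := @nneseries_lim_ge R (fun k => (bgcoef k * \1_(bset (bigbox k)) x)%:E) xpredT 0%N k.+1.
move=> /(_ (fun k _ _ => term_ge0 k x)); apply: le_trans.
rewrite big_nat_recr//= leeDr//.
by apply: sume_ge0 => i _; exact: term_ge0.
Qed.

End background.

(** * Powers with a log-Hölder exponent *)

Section exponent.
Context {R : realType} {n : nat}.
Notation T := (lebRn R n).

(** The data of a log-Hölder exponent, with a lower bound valid at every
    point instead of almost every point. *)
Record lh_exponent (pm pinf C0 Ci : R) (p : 'rV[R]_n -> R) : Prop := LHExponent {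
  lh_n : (0 < n)%N;
  lh_pm : 0 < pm;
  lh_pinf : 0 < pinf;
  lh_C0 : 0 < C0;
  lh_Ci : 0 < Ci;
  lh_meas : measurable_fun [set: T] (p : T -> R);
  lh_ge : forall x, pm <= p x;
  lh_loc : forall x y, enorm (x - y) < 2^-1 ->
    `|p x - p y| <= - (C0 / ln (enorm (x - y)));
  lh_inf : forall x, `|p x - pinf| <= Ci / ln (expR 1 + enorm x) }.

Variables (pm pinf C0 Ci : R).
(** An upper bound of the exponent, because [ln (e + |x|) >= 1]. *)
Definition lh_max : R := pinf + Ci.
(** The solution [eps] of [eps + eps / pinf * Ci = pm]: it leaves room for
    the deviation of [p] from its limit in [exponent_lower]. *)
Definition lh_eps : R := pm * pinf / (pinf + Ci).
Notation N := (@bgexp R n).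
(** Loss factors: [lh_K1] and [lh_K2] in replacing [p] by its limit at
    infinity, [lh_Ka] in comparing powers on a short box, [lh_kG] (as an
    exponent) in the dichotomy, [lh_CJ] in the average over a box.  A box is
    short when its side is below [lh_thr]. *)
Definition lh_K1 : R := expR ((1 + N) * Ci / pm).
Definition lh_K2 : R := expR (N * Ci / pinf).
Definition lh_thr : R := (2 * n%:R ^+ 2)^-1.
Definition lh_kG : R :=
  4 * Ci * (1 + n%:R * ln (lh_thr^-1) + 2 * N) / pm + 4 * C0 * n%:R / pm.
Definition lh_Ka : R := expR (2 * n%:R * C0 / pm).
Definition lh_CJ : R :=
  (1 + lh_Ka ^+ 2) + (1 + lh_thr ^- n) + (1 + 2 * lh_K1 * (lh_K2 + 1)).

Lemma enorm_ge0 (x : 'rV[R]_n) : 0 <= enorm x.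
Proof. exact: sqrtr_ge0. Qed.

Lemma ler_coord_enorm (x : 'rV[R]_n) i : `|x 0 i| <= enorm x.
Proof.
rewrite -sqrtr_sqr ler_sqrt; last by apply: sumr_ge0 => j _; exact: sqr_ge0.
by rewrite (bigD1 i)//= lerDl; apply: sumr_ge0 => j _; exact: sqr_ge0.
Qed.

Lemma enorm_le (x : 'rV[R]_n) s : 0 <= s -> (forall i, `|x 0 i| <= s) ->
  enorm x <= n%:R * s.
Proof.
move=> s0 xs; rewrite -(@ger0_norm _ (n%:R * s)); last by rewrite mulr_ge0.
rewrite -sqrtr_sqr ler_wsqrtr//.
apply: (@le_trans _ _ (\sum_(i < n) s ^+ 2)).
  by apply: ler_sum => i _; rewrite -real_normK ?num_real// lerXn2r// nnegrE.
rewrite sumr_const card_ord -[leLHS]mulr_natl exprMn ler_wpM2r ?sqr_ge0//.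
by rewrite -natrX ler_nat; case: (n) => // k; rewrite expnS expn1 leq_pmulr.
Qed.

Definition lnH (x : 'rV[R]_n) : R := ln (expR 1 + enorm x).

Lemma lnH_ge1 x : 1 <= lnH x.
Proof.
rewrite -[leLHS](expRK (1 : R)) /lnH ler_ln ?posrE ?expR_gt0 ?lerDl ?enorm_ge0//.
by rewrite ltr_wpDr ?enorm_ge0 ?expR_gt0.
Qed.

Lemma background_ge_lnH (x : T) : ((expR (- (N * lnH x)))%:E <= background x)%E.
Proof. apply: background_ge; [exact: enorm_ge0|exact: ler_coord_enorm]. Qed.

Context (p : 'rV[R]_n -> R).
Hypothesis Hp : lh_exponent pm pinf C0 Ci p.

Let n0 := lh_n Hp.
Let pm0 := lh_pm Hp.
Let pinf0 := lh_pinf Hp.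
Let C00 := lh_C0 Hp.
Let Ci0 := lh_Ci Hp.
Let N0 : 0 <= N. Proof. exact: ler0n. Qed.

Lemma lh_max_gt0 : 0 < lh_max. Proof. exact: addr_gt0. Qed.

Lemma lh_infM x : `|p x - pinf| * lnH x <= Ci.
Proof.
rewrite -ler_pdivlMr ?(lt_le_trans _ (lnH_ge1 x))//.
exact: (lh_inf Hp).
Qed.

Lemma lh_le x : p x <= lh_max.
Proof.
have := lh_infM x; have := lnH_ge1 x; rewrite /lh_max.
by have [h|h] := ler0P (p x - pinf); nra.
Qed.

Lemma lh_eps_gt0 : 0 < lh_eps.
Proof. by rewrite divr_gt0// ?mulr_gt0// addr_gt0. Qed.

Lemma lh_epsE : lh_eps + lh_eps / pinf * Ci = pm.
Proof.
rewrite /lh_eps; field.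
by rewrite !gt_eqF//; have := lh_max_gt0; rewrite /lh_max.
Qed.

Lemma lh_eps_le : lh_eps <= pm.
Proof.
have := lh_epsE; have : 0 <= lh_eps / pinf * Ci.
  by apply: mulr_ge0; [apply: divr_ge0|]; apply: ltW => //; exact: lh_eps_gt0.
lra.
Qed.

(** With [t = expR (- tau)], this is [t^p(x) <= K1 * t^pinf + h(x) / 2] where
    [h] is a power of [1 / (e + |x|)].  If [tau * pm >= 1 + N * ln (e + |x|)],
    the left side is below [h / 2]; otherwise [tau * |p(x) - pinf|] is bounded
    by the decay of the exponent. *)
Lemma exponent_upper tau x : 0 <= tau ->
  expR (- (tau * p x)) <=
  lh_K1 * expR (- (tau * pinf)) + 2^-1 * expR (- (N * lnH x)).
Proof.
move=> tau0; have L1 := lnH_ge1 x; have pL := lh_infM x; have pmp := lh_ge Hp x.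
have [big|small] := leP (1 + N * lnH x) (tau * pm).
  apply: (@le_trans _ _ (2^-1 * expR (- (N * lnH x)))); last first.
    by rewrite lerDr mulr_ge0 ?expR_ge0.
  have e2 : expR (-1) <= 2^-1 :> R.
    rewrite expRN lef_pV2 ?posrE ?expR_gt0//.
    by have := expR_ge1Dx (1 : R); lra.
  apply: (@le_trans _ _ (expR (-1) * expR (- (N * lnH x)))); last first.
    by rewrite ler_wpM2r ?expR_ge0.
  by rewrite -expRD ler_expR; nra.
apply: (@le_trans _ _ (lh_K1 * expR (- (tau * pinf)))); last first.
  by rewrite lerDl mulr_ge0 ?expR_ge0.
rewrite /lh_K1 -expRD ler_expR.
suff : tau * `|p x - pinf| <= (1 + N) * Ci / pm.
  by have := ler_norm (- (p x - pinf)); rewrite normrN; nra.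
rewrite ler_pdivlMr//.
have : (tau * pm) * `|p x - pinf| <= (1 + N) * lnH x * `|p x - pinf|.
  by rewrite ler_wpM2r//; nra.
have : (1 + N) * (`|p x - pinf| * lnH x) <= (1 + N) * Ci.
  by rewrite ler_wpM2l// addr_ge0.
lra.
Qed.

(** With [t = expR (- tau) <= 1] and [V = expR sig >= 1], this is
    [V^eps * t^pinf <= K2 * (V * t)^p(x) + h(x)].  If
    [V^eps * t^pinf <= h], the second term suffices; otherwise [tau] is at most
    of order [ln (e + |x|)] plus a multiple of [sig], and the choice of [lh_eps]
    absorbs this multiple. *)
Lemma exponent_lower tau sig x : 0 <= tau -> 0 <= sig ->
  expR (lh_eps * sig - tau * pinf) <=
  lh_K2 * expR ((sig - tau) * p x) + expR (- (N * lnH x)).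
Proof.
move=> tau0 sig0; have L1 := lnH_ge1 x; have pL := lh_infM x; have pmp := lh_ge Hp x.
have e0 := lh_eps_gt0; have epsE := lh_epsE.
have [big|small] := leP (N * lnH x + lh_eps * sig) (tau * pinf).
  rewrite -[leLHS]add0r lerD ?mulr_ge0 ?expR_ge0// ler_expR; lra.
rewrite -[leLHS]addr0 lerD ?expR_ge0// /lh_K2 -expRD ler_expR.
have h1 : tau * `|p x - pinf| <= N * Ci / pinf + lh_eps / pinf * Ci * sig.
  have -> : N * Ci / pinf + lh_eps / pinf * Ci * sig =
      (N * Ci + lh_eps * sig * Ci) / pinf by ring.
  rewrite ler_pdivlMr//.
  have : (tau * pinf) * `|p x - pinf| <= (N * lnH x + lh_eps * sig) * `|p x - pinf|.
    by rewrite ler_wpM2r// ltW.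
  have : N * (`|p x - pinf| * lnH x) <= N * Ci by rewrite ler_wpM2l.
  have : lh_eps * sig * `|p x - pinf| <= lh_eps * sig * Ci.
    have aCi : `|p x - pinf| <= Ci by have := normr_ge0 (p x - pinf); nra.
    by apply: ler_wpM2l => //; apply: mulr_ge0 => //; exact: ltW.
  lra.
have h2 : (pm - lh_eps) * sig <= (p x - lh_eps) * sig by rewrite ler_wpM2r//; lra.
have h3 : tau * (p x - pinf) <= tau * `|p x - pinf| by rewrite ler_wpM2l// ler_norm.
have : lh_eps / pinf * Ci * sig = (pm - lh_eps) * sig by rewrite -epsE; ring.
lra.
Qed.

End exponent.

(** * Oscillation of the exponent on a box *)

Section oscillation.
Context {R : realType} {n : nat}.
Notation T := (lebRn R n).
Notation mu := (@lebesgue_rV R n).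
Notation N := (@bgexp R n).

Lemma bset_itv (P : @dbox R n) (x : T) i : bset P x ->
  corner P 0 i <= (x : 'rV_n) 0 i <= corner P 0 i + side P.
Proof.
move=> /(_ i); rewrite in_itv/=; case: (lflag P i); case: (rflag P i) => /=; lra.
Qed.

Lemma bset_dist (P : @dbox R n) (x y : T) i : bset P x -> bset P y ->
  `|((x : 'rV_n) - y) 0 i| <= side P.
Proof.
move=> /(@bset_itv _ _ i) hx /(@bset_itv _ _ i) hy; rewrite !mxE ler_norml; lra.
Qed.

Lemma integral_cst_mu (D : set T) (c : R) : measurable D ->
  (\int[mu]_(x in D) c%:E = c%:E * mu D)%E.
Proof. by move=> mD; rewrite integral_cst. Qed.

Context (pm pinf C0 Ci : R) (p : 'rV[R]_n -> R).
Hypothesis Hp : lh_exponent pm pinf C0 Ci p.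
Notation kG := (@lh_kG R n pm C0 Ci).
Notation thr := (@lh_thr R n).

Let n0 := lh_n Hp.
Let pm0 := lh_pm Hp.
Let C00 := lh_C0 Hp.
Let N0 : 0 <= N. Proof. exact: ler0n. Qed.
Let nR1 : 1 <= n%:R :> R. Proof. by rewrite ler1n. Qed.

Lemma lh_thr_gt0 : 0 < thr.
Proof. by rewrite invr_gt0 mulr_gt0// exprn_gt0// (lt_le_trans ltr01 nR1). Qed.

Lemma lh_thr_lt1 : thr < 1.
Proof.
have n2 : 1 <= n%:R ^+ 2 :> R by rewrite exprn_ege1.
by rewrite invf_lt1; lra.
Qed.

(** Two points of the box are at distance at most [d = n * l].  For [l] below
    the threshold, [d^2 <= l], hence [ln (1 / l) <= 2 * ln (1 / d)], and the
    local condition bounds [|p x - p y| * ln (1 / d)]. *)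
Lemma lh_osc (P : @dbox R n) (x y : T) : 0 < side P -> side P < thr ->
  bset P x -> bset P y -> `|p x - p y| * ln ((side P)^-1) <= 2 * C0.
Proof.
move=> l0 lthr Px Py; set l := side P in l0 lthr *.
have n2l : 2 * n%:R ^+ 2 * l < 1.
  have nn0 : 0 < 2 * n%:R ^+ 2 :> R.
    by rewrite mulr_gt0// exprn_gt0// (lt_le_trans ltr01 nR1).
  by move: lthr; rewrite /lh_thr -[X in _ < X]mul1r ltr_pdivlMr// mulrC.
have nl : n%:R * (n%:R * l) < 2^-1 by move: n2l; rewrite expr2; lra.
have nl0 : 0 < n%:R * l by rewrite mulr_gt0// (lt_le_trans ltr01 nR1).
have nl2 : n%:R * l < 2^-1 by apply: le_lt_trans nl; rewrite ler_peMl// ltW.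
have d2 : enorm ((x : 'rV_n) - y) <= n%:R * l.
  by apply: enorm_le; [exact: ltW|move=> i; exact: bset_dist].
have := lh_loc Hp (le_lt_trans d2 nl2).
set d := enorm _ in d2 *.
have d0 : 0 <= d by exact: enorm_ge0.
have [->|dn0] := eqVneq d 0.
  rewrite ln0// invr0 mulr0 oppr0 normr_le0 => /eqP ->.
  by rewrite normr0 mul0r mulr_ge0 ?(ltW C00).
have dp : 0 < d by rewrite lt_def dn0.
have lnd : ln d < 0 by rewrite ln_lt0// dp/=; lra.
rewrite -mulrN -invrN => h.
have lnl : ln (l^-1) <= 2 * - ln d.
  rewrite lnV ?posrE// mulrN lerN2 -[2]/(2%:R) mulr_natl -lnXn// ler_ln ?posrE ?exprn_gt0//.
  rewrite expr2; apply: (@le_trans _ _ ((n%:R * l) * (n%:R * l))); last by nra.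
  by rewrite ler_pM.
have nd : 0 < - ln d by rewrite oppr_gt0.
apply: (@le_trans _ _ (C0 / - ln d * (2 * - ln d))).
  apply: ler_pM => //; rewrite ln_ge0// invf_ge1//.
  by apply: ltW; apply: lt_trans lthr lh_thr_lt1.
by rewrite mulrCA divfK// gt_eqF.
Qed.

(** The box contains a box [P'] of side [min(l, 1)] near [z], whose points
    have coordinates at most [|z| + 1], and [e + |z| + 1 <= (e + |z|)^2]: hence
    the factor [2] in the exponent. *)
Lemma background_box_ge (P : @dbox R n) (z : T) : 0 < side P -> bset P z ->
  ((Num.min (side P) 1 ^+ n * expR (- (2 * N * lnH (z : 'rV_n))))%:E <=
   \int[mu]_(x in bset P) background x)%E.
Proof.
move=> l0 Pz; set s := Num.min _ _.
have s0 : 0 < s by rewrite lt_min l0 ltr01.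
have sl : s <= side P by rewrite ge_min lexx.
have s1 : s <= 1 by rewrite ge_min lexx orbT.
(* Along each edge, the lower end is the larger of that of [P] and [z_i - s],
   so that the side [s] fits into [P]. *)
pose P' : @dbox R n := DBox (\row_i Num.max (corner P 0 i) ((z : 'rV_n) 0 i - s)) s
  (fun=> false) (fun=> true).
have hP' x i : bset P' x ->
   [/\ corner P 0 i < (x : 'rV_n) 0 i, (x : 'rV_n) 0 i < corner P 0 i + side P
     & `|(x : 'rV_n) 0 i| <= enorm (z : 'rV_n) + 1].
  move=> /(_ i); rewrite in_itv/= mxE => /andP[].
  rewrite gt_max => /andP[h1 h2] h3.
  have /andP[z1 z2] := bset_itv i Pz.
  have h4 : (x : 'rV_n) 0 i < corner P 0 i + s \/ (x : 'rV_n) 0 i < (z : 'rV_n) 0 i.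
    move: h3; rewrite /Num.max/=; case: ifP => _ h3; [right|left]; lra.
  split; first lra.
    by case: h4; lra.
  have := ler_coord_enorm (z : 'rV_n) i.
  rewrite !ler_norml => /andP[e1 e2]; apply/andP; split; first lra.
  by case: h4; lra.
have P'P : bset P' `<=` bset P.
  move=> x P'x i; have [h1 h2 _] := hP' x i P'x; rewrite in_itv/=.
  by case: (lflag P i); case: (rflag P i) => /=; lra.
apply: (@le_trans _ _ (\int[mu]_(x in bset P') background x)%E); last first.
  apply: ge0_subset_integral => //; try exact: measurable_bset.
    apply: measurable_funTS; exact: measurable_background.
  by move=> x _; exact: background_ge0.
rewrite mulrC EFinM.
have -> : ((s ^+ n)%:E = mu (bset P'))%E by rewrite mu_bset.
rewrite -integral_cst_mu; last exact: measurable_bset.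
apply: ge0_le_integral => //; first exact: measurable_bset.
- apply: measurable_funTS; exact: measurable_background.
- move=> x P'x; have e0 := enorm_ge0 (z : 'rV_n).
  have z10 : 0 <= enorm (z : 'rV_n) + 1 by lra.
  have hx i : `|(x : 'rV_n) 0 i| <= enorm (z : 'rV_n) + 1 by have [] := hP' x i P'x.
  apply: le_trans (background_ge z10 hx).
  have e2 : 2 <= expR 1 :> R by have := expR_ge1Dx (1 : R); lra.
  rewrite lee_fin ler_expR lerN2 -mulrA mulrCA ler_wpM2l//.
  rewrite -[2]/(2%:R) mulr_natl /lnH -lnXn; last by lra.
  rewrite ler_ln ?posrE ?exprn_gt0//; [|lra|lra].
  by rewrite expr2; nra.
Qed.

(** With [a = expR (- alpha)]: either [a^p] varies on the box by at most the
    factor [expR kG], or [a^pm] is below half of the background mass of the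
    box.  If the first fails, [alpha] is at least a large multiple of the
    logarithm of [e + |z|], by the decay condition, and of the logarithm of
    the inverse of the side, by [lh_osc] when the box is short; by
    [background_box_ge] both together control the background mass. *)
Lemma lh_dichotomy (P : @dbox R n) alpha : 0 < side P -> 0 <= alpha ->
  (forall x y : T, bset P x -> bset P y -> alpha * (p x - p y) <= kG) \/
  ((expR (- (alpha * pm)))%:E <=
   (2^-1)%:E * \int[mu]_(x in bset P) background x)%E.
Proof.
move=> l0 a0; apply/or_asboolP; rewrite -implyNb; apply/implyP => /asboolP.
move=> /existsNP[x /existsNP[y /not_implyP[Px /not_implyP[Py /negP]]]].
rewrite -ltNge => big; apply/asboolP.
have hCi := lh_Ci Hp; have hC0 := lh_C0 Hp; have hpm := lh_pm Hp.
have hN : 0 <= N by exact: ler0n.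
have {}big : kG < alpha * `|p x - p y|.
  by apply: lt_le_trans big _; rewrite ler_wpM2l// ler_norm.
(* The decay condition is used at the point of smaller norm. *)
pose z : T := if lnH (x : 'rV_n) <= lnH (y : 'rV_n) then x else y.
have Pz : bset P z by rewrite /z; case: ifP.
have L1 := lnH_ge1 (z : 'rV_n); set L := lnH _ in L1.
have zx : L <= lnH (x : 'rV_n).
  by rewrite /L /z; case: (leP (lnH (x : 'rV_n)) (lnH (y : 'rV_n))) => [_|/ltW] /=.
have zy : L <= lnH (y : 'rV_n) by rewrite /L /z; case: (leP (lnH (x : 'rV_n)) (lnH (y : 'rV_n))) => /=.
have oscL : `|p x - p y| * L <= 2 * Ci.
  have := lh_infM Hp x; have := lh_infM Hp y.
  have := ler_distD pinf (p x) (p y); rewrite (distrC pinf).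
  have := normr_ge0 (p x - pinf); have := normr_ge0 (p y - pinf).
  by nra.
set s := Num.min (side P) 1.
have s0 : 0 < s by rewrite lt_min l0 ltr01.
have lnthr : 0 <= ln (thr^-1) by rewrite ln_ge0// invf_ge1 ?lh_thr_gt0 ?ltW ?lh_thr_lt1.
have A : 2 * (1 + n%:R * ln (thr^-1) + 2 * N) * L <= alpha * pm.
  have kGC : kG * L <= alpha * (2 * Ci).
    apply: (@le_trans _ _ (alpha * (`|p x - p y| * L))); last by rewrite ler_wpM2l.
    by rewrite mulrA ler_wpM2r// ?ltW//; lra.
  have : 4 * Ci * (1 + n%:R * ln (thr^-1) + 2 * N) / pm <= kG.
    by rewrite /lh_kG lerDl; apply: divr_ge0; [apply: mulr_ge0 => //; apply: mulr_ge0 => //|]; exact: ltW.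
  rewrite ler_pdivrMr// => h.
  rewrite -(ler_pM2r (_ : 0 < 2 * Ci)); last lra.
  have := ler_wpM2r (_ : 0 <= L) h; have := ler_wpM2r (ltW pm0) kGC.
  by move=> h1 /(_ ltac:(lra)) h2; nra.
have key : 1 + n%:R * ln (s^-1) + 2 * N * L <= alpha * pm.
  have nth0 : 0 <= n%:R * ln (thr^-1) by rewrite mulr_ge0.
  have A' : 2 * (1 + n%:R * ln (thr^-1) + 2 * N * L) <= alpha * pm.
    by apply: le_trans A; nra.
  have [sthr|thrs] := ltP (side P) thr.
    have sE : s = side P by rewrite /s min_l// ltW// (lt_trans sthr lh_thr_lt1).
    rewrite sE.
    have lnl0 : 0 <= ln ((side P)^-1).
      by rewrite ln_ge0// invf_ge1// -sE ge_min lexx orbT.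
    have h1 : kG * ln ((side P)^-1) <= alpha * (2 * C0).
      apply: (@le_trans _ _ (alpha * (`|p x - p y| * ln ((side P)^-1)))).
        by rewrite mulrA ler_wpM2r// ltW.
      by rewrite ler_wpM2l// lh_osc.
    have h2 : 4 * C0 * n%:R / pm <= kG.
      rewrite /lh_kG lerDr; apply: divr_ge0; last exact: ltW.
      by apply: mulr_ge0; [apply: mulr_ge0 => //; exact: ltW|nra].
    have {}h2 : 4 * C0 * n%:R * ln ((side P)^-1) <= alpha * (2 * C0) * pm.
      rewrite ler_pdivrMr// in h2.
      apply: (@le_trans _ _ (kG * pm * ln ((side P)^-1))); first by rewrite ler_wpM2r.
      by rewrite mulrAC ler_wpM2r// ltW.
    have : 2 * (n%:R * ln ((side P)^-1)) <= alpha * pm.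
      by rewrite -(ler_pM2r (_ : 0 < 2 * C0)); [nra|lra].
    by lra.
  have : ln (s^-1) <= ln (thr^-1).
    have t0 := lh_thr_gt0.
    have e1 : ln (s^-1) = - ln s by rewrite lnV.
    have e2 : ln (thr^-1) = - ln thr by rewrite (@lnV _ thr).
    rewrite e1 e2 lerN2 ler_ln ?posrE//.
    by rewrite le_min thrs ltW// lh_thr_lt1.
  move=> /(ler_wpM2l (ler0n R n)).
  have : 0 <= 2 * N * L by rewrite mulr_ge0//; nra.
  by lra.
apply: le_trans (lee_wpmul2l _ (background_box_ge l0 Pz)); last by rewrite lee_fin.
rewrite -EFinM lee_fin -/s -/L.
have -> : s ^+ n = expR (- (n%:R * ln (s^-1))).
  by rewrite lnV ?posrE// mulrN opprK expRM_natl lnK ?posrE.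
have e2 : expR (-1) <= 2^-1 :> R.
  rewrite expRN lef_pV2 ?posrE ?expR_gt0//.
  by have := expR_ge1Dx (1 : R); lra.
rewrite -expRD; apply: (@le_trans _ _ (expR (-1) * expR (- (n%:R * ln s^-1) - 2 * N * L))).
  by rewrite -expRD ler_expR; lra.
by rewrite ler_wpM2r ?expR_ge0.
Qed.

End oscillation.

(** * Averages of functions of unit norm *)

Section norm_one.
Context {R : realType} {n : nat}.
Notation T := (lebRn R n).
Notation mu := (@lebesgue_rV R n).

Context (pm pinf C0 Ci : R) (p : 'rV[R]_n -> R).
Hypothesis Hp : lh_exponent pm pinf C0 Ci p.
Notation thr := (@lh_thr R n).
Notation Ka := (@lh_Ka R n pm C0).
Notation K1 := (@lh_K1 R n pm Ci).
Notation K2 := (@lh_K2 R n pinf Ci).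
Notation eps := (lh_eps pm pinf Ci).
Notation CJ := (@lh_CJ R n pm pinf C0 Ci).

Lemma powR_eps_le (t q : R) : 0 <= t -> eps <= q -> t `^ eps <= 1 + t `^ q.
Proof.
move=> t0 eq; have [t1|t1] := leP t 1.
  have e0 := ltW (lh_eps_gt0 Hp).
  have : t `^ eps <= 1 `^ eps by apply: ge0_ler_powR => //; rewrite nnegrE.
  by rewrite powR1; have := powR_ge0 t q; lra.
have : t `^ eps <= t `^ q by apply: ler_powR => //; exact: ltW.
lra.
Qed.

Lemma measurable_powR_p (f : T -> R) : measurable_fun [set: T] f ->
  measurable_fun [set: T] (fun x => f x `^ p x).
Proof. by move=> mf; exact: measurable_powR_fun measurableT mf (lh_meas Hp). Qed.

(** For constant [p], [lam^-p] is the inverse of the measure of [P] and the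
    bound follows from [t^eps <= 1 + t^p].  If [lam > 1], the comparison with
    the exponent at infinity brings back this case up to the background.  If
    [lam <= 1] and [P] is short, [lam^-p] is comparable on [P] to the inverse of
    its measure by [lh_osc]; if [P] is not short, [lam^-p >= 1] is enough. *)
Lemma lh_average (P : @dbox R n) (lam : R) (f : T -> R) : 0 < side P -> 0 < lam ->
  measurable_fun [set: T] f -> (forall x, 0 <= f x) ->
  (\int[mu]_(x in bset P) (lam^-1 `^ p x)%:E = 1)%E ->
  (\int[mu]_(x in bset P) ((f x / lam) `^ p x)%:E <= 1)%E ->
  (\int[mu]_(x in bset P) (f x `^ eps)%:E <= CJ%:E * mu (bset P))%E.
Proof.
move=> l0 lam0 mf f0 lam1 flam1.
have hpm := lh_pm Hp; have hCi := lh_Ci Hp; have hpi := lh_pinf Hp; have hC0 := lh_C0 Hp.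
have mP := measurable_bset P.
set L := ln lam.
have gE x : lam^-1 `^ p x = expR (- (L * p x)).
  by rewrite gt0_powRE ?invr_gt0// lnV ?posrE// mulrN mulrC.
have fgE x : (f x / lam) `^ p x = f x `^ p x * lam^-1 `^ p x.
  by rewrite powRM ?invr_ge0// ltW.
have mg : measurable_fun [set: T] (fun x => lam^-1 `^ p x).
  exact: (@measurable_powR_p (fun=> lam^-1)).
have mfg : measurable_fun [set: T] (fun x => (f x / lam) `^ p x).
  by apply: measurable_powR_p; exact: measurable_funM.
have mfe : measurable_fun [set: T] (fun x => f x `^ eps).
  by apply: measurable_powR_fun.
have mfp := measurable_powR_p mf.
have mbg := @measurable_background R n.
have muP : (mu (bset P) = (side P ^+ n)%:E)%E by rewrite mu_bset.
have muP' : ((mu : {measure set T -> \bar R}) (bset P) = (side P ^+ n)%:E)%E by [].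
have m0 : 0 <= side P ^+ n by rewrite exprn_ge0 ?ltW.
have Ka0 : 0 <= Ka by exact: expR_ge0.
have K10 : 0 < K1 by exact: expR_gt0.
have K20 : 0 < K2 by exact: expR_gt0.
have thr0 : 0 < thr := lh_thr_gt0 Hp.
have c1 : 0 <= 1 + Ka ^+ 2 by have := sqr_ge0 Ka; lra.
have c2 : 0 <= 1 + thr ^- n by rewrite addr_ge0// invr_ge0 exprn_ge0// ltW.
have c3 : 0 <= 1 + 2 * K1 * (K2 + 1) by nra.
have [Lpos|Lneg] := ltP 0 L.
  (* If [lam > 1], compare with the exponent at infinity. *)
  have tot : 1 <= 2 * K1 * expR (- (L * pinf)) * side P ^+ n.
    have := @le_integral_affine _ _ _ mu (bset P) (fun x => lam^-1 `^ p x) (fun=> 0)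
      background (K1 * expR (- (L * pinf))) 0 2^-1 mP mg.
    rewrite lam1 muP' => /(_ (measurable_cst _) mbg (fun=> powR_ge0 _ _)).
    move=> /(_ (fun=> lexx 0) (@background_ge0 R n)).
    have a0 : 0 <= K1 * expR (- (L * pinf)) by rewrite mulr_ge0 ?expR_ge0.
    have h0 : 0 <= 2^-1 :> R by rewrite invr_ge0.
    move=> /(_ a0 (lexx 0) h0).
    have h x : bset P x -> ((lam^-1 `^ p x)%:E <=
        (K1 * expR (- (L * pinf)) + 0 * 0)%:E + (2^-1)%:E * background x)%E.
      move=> _; rewrite mul0r addr0 gE.
      apply: (@le_trans _ _ ((K1 * expR (- (L * pinf)))%:E +
          (2^-1)%:E * (expR (- (@bgexp R n * lnH (x : 'rV_n))))%:E)%E).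
        rewrite -EFinM -EFinD lee_fin; exact: (exponent_upper Hp _ (ltW Lpos)).
      by rewrite leeD2l// lee_wpmul2l ?lee_fin// background_ge_lnH.
    move=> /(_ h); rewrite mul0e adde0 => h1.
    have : (1 <= (K1 * expR (- (L * pinf)) * side P ^+ n)%:E + (2^-1)%:E * 1)%E.
      apply: (le_trans h1); rewrite -EFinM leeD2l// lee_wpmul2l ?lee_fin//.
      exact: integral_background_sub.
    by rewrite mule1 -EFinD lee_fin; lra.
  have expLi : expR (L * pinf) * expR (- (L * pinf)) = 1 by rewrite -expRD subrr expR0.
  apply: (@le_trans _ _ (1%:E * mu (bset P) + (expR (L * pinf) * K2)%:E *
     \int[mu]_(x in bset P) ((f x / lam) `^ p x)%:E +
     (expR (L * pinf))%:E * \int[mu]_(x in bset P) background x)%E).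
    apply: le_integral_affine => //; try (by move=> x; exact: powR_ge0);
      try exact: background_ge0; try exact: expR_ge0; try exact: mulr_ge0 (expR_ge0 _) (ltW _).
    move=> x Px.
    apply: (@le_trans _ _ ((1 + expR (L * pinf) * K2 * (f x / lam) `^ p x)%:E +
       (expR (L * pinf))%:E * (expR (- (@bgexp R n * lnH (x : 'rV_n))))%:E)%E); last first.
      by rewrite leeD2l// lee_wpmul2l ?lee_fin ?expR_ge0// background_ge_lnH.
    rewrite -EFinM -EFinD lee_fin.
    have [fx1|fx1] := leP (f x) 1.
      have : f x `^ eps <= 1 `^ eps.
        by apply: ge0_ler_powR; rewrite ?nnegrE// ltW// (lh_eps_gt0 Hp).
      rewrite powR1; have : 0 <= expR (L * pinf) * K2 * (f x / lam) `^ p x.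
        by rewrite !mulr_ge0 ?expR_ge0 ?powR_ge0.
      have : 0 <= expR (L * pinf) * expR (- (@bgexp R n * lnH (x : 'rV_n))) by rewrite mulr_ge0 ?expR_ge0.
      by lra.
    have fx0 : 0 < f x by rewrite (lt_trans ltr01).
    have := exponent_lower Hp (x : 'rV_n) (ltW Lpos) (ltW (_ : 0 < ln (f x))).
    rewrite ln_gt0// => /(_ isT).
    have -> : expR ((ln (f x) - L) * p x) = (f x / lam) `^ p x.
      by rewrite fgE gE gt0_powRE// -expRD; congr expR; ring.
    have -> : expR (eps * ln (f x) - L * pinf) = f x `^ eps * expR (- (L * pinf)).
      by rewrite gt0_powRE// -expRD.
    move=> h.
    have := ler_wpM2l (expR_ge0 (L * pinf)) h.
    rewrite mulrCA expLi mulr1 mulrDr mulrA; lra.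
  rewrite mul1e muP.
  apply: (@le_trans _ _ ((side P ^+ n)%:E + (expR (L * pinf) * K2)%:E * 1 +
     (expR (L * pinf))%:E * 1)%E).
    apply: leeD; last by rewrite lee_wpmul2l ?lee_fin ?expR_ge0// integral_background_sub.
    by rewrite leeD2l// lee_wpmul2l// lee_fin mulr_ge0// expR_ge0.
  rewrite !mule1 -EFinM -!EFinD lee_fin /lh_CJ.
  have e1 : expR (L * pinf) <= 2 * K1 * side P ^+ n.
    have := ler_wpM2l (expR_ge0 (L * pinf)) tot; rewrite mulr1.
    by rewrite (_ : expR (L * pinf) * (2 * K1 * expR (- (L * pinf)) * side P ^+ n) =
      expR (L * pinf) * expR (- (L * pinf)) * (2 * K1 * side P ^+ n)); [rewrite expLi mul1r|ring].
  have : (K2 + 1) * expR (L * pinf) <= (K2 + 1) * (2 * K1 * side P ^+ n).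
    by rewrite ler_wpM2l//; lra.
  have : 0 <= ((1 + Ka ^+ 2) + (1 + thr ^- n)) * side P ^+ n by rewrite mulr_ge0// addr_ge0.
  by lra.
(* If [lam <= 1], the modular of [f] itself is at most a multiple of the
   measure of [P]. *)
suff [c [cge cle fc]] : exists c : R, [/\ 0 <= c, 1 + c <= CJ &
    (\int[mu]_(x in bset P) (f x `^ p x)%:E <= (c * side P ^+ n)%:E)%E].
  have := @le_integral_affine _ _ _ mu (bset P) (fun x => f x `^ eps) (fun x => f x `^ p x)
      (fun=> 0%E) 1 1 0 mP mfe mfp (measurable_cst _) (fun=> powR_ge0 _ _) (fun=> powR_ge0 _ _)
      (fun=> lexx _) ler01 ler01 (lexx _).
  move=> /(_ _)/le_trans; apply.
    move=> x _; rewrite mule0 adde0 lee_fin mul1r; apply: powR_eps_le => //.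
    exact: le_trans (lh_eps_le Hp) (lh_ge Hp x).
  rewrite mul0e adde0 !mul1e muP' muP -EFinM.
  apply: (@le_trans _ _ ((side P ^+ n)%:E + (c * side P ^+ n)%:E)%E); first by rewrite leeD2l.
  by rewrite -EFinD lee_fin; have := ler_wpM2r m0 cle; lra.
have [lthr|thrl] := ltP (side P) thr.
  exists (Ka ^+ 2); split; [exact: sqr_ge0|by rewrite /lh_CJ; lra|].
  have [y Py] : bset P !=set0.
    apply/set0P/eqP => P0; have := muP; rewrite P0 measure0 => -[] /esym/eqP.
    by rewrite gt_eqF// exprn_gt0.
  have lnl : - L * pm <= n%:R * ln ((side P)^-1).
    have : ((expR (- (L * pm)) * side P ^+ n)%:E <= 1)%E.
      rewrite -lam1 EFinM -muP -integral_cst_mu//.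
      apply: ge0_le_integralT => [|||x|x _].
      - exact: mP.
      - exact: measurable_cst.
      - by apply/measurable_EFinP.
      - by rewrite lee_fin expR_ge0.
      - rewrite lee_fin gE ler_expR lerN2.
        by have := lh_ge Hp x; nra.
    rewrite lee_fin -[side P ^+ n]lnK ?posrE ?exprn_gt0// -expRD expR_le1 lnXn//.
    by rewrite lnV ?posrE// -mulr_natl; lra.
  have cmp x z : bset P x -> bset P z -> - L * (p x - p z) <= 2 * n%:R * C0 / pm.
    move=> Px Pz; rewrite ler_pdivlMr//.
    have h1 := lh_osc Hp l0 lthr Px Pz.
    have h2 : - L * (p x - p z) <= - L * `|p x - p z|.
      by rewrite ler_wpM2l ?oppr_ge0// ler_norm.
    have h3 := ler_wpM2r (normr_ge0 (p x - p z)) lnl.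
    have h4 := ler_wpM2l (ler0n R n) h1.
    have h5 := ler_wpM2r (ltW hpm) h2.
    by lra.
  have e1 : expR (L * p y) <= Ka * side P ^+ n.
    have : (1 <= (Ka * expR (- (L * p y)) * side P ^+ n)%:E)%E.
      rewrite -lam1 EFinM -muP -integral_cst_mu//.
      apply: ge0_le_integralT => [|||x|x Px].
      - exact: mP.
      - by apply/measurable_EFinP.
      - exact: measurable_cst.
      - by rewrite lee_fin powR_ge0.
      - rewrite lee_fin gE -expRD ler_expR.
        by have := cmp _ _ Px Py; lra.
    rewrite lee_fin => h; have := ler_wpM2l (expR_ge0 (L * p y)) h; rewrite mulr1.
    rewrite (_ : expR (L * p y) * (Ka * expR (- (L * p y)) * side P ^+ n) =
      expR (L * p y) * expR (- (L * p y)) * (Ka * side P ^+ n)); last by ring.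
    by rewrite -expRD subrr expR0 mul1r.
  apply: (@le_trans _ _ (0%:E * mu (bset P) + (Ka * expR (L * p y))%:E *
     \int[mu]_(x in bset P) ((f x / lam) `^ p x)%:E + 0%:E * \int[mu]_(x in bset P) cst 0%E x)%E).
    apply: le_integral_affine => //; try (by move=> x; exact: powR_ge0);
      try exact: mulr_ge0 (expR_ge0 _) (expR_ge0 _).
    move=> x Px; rewrite mul0e adde0 add0r lee_fin fgE gE.
    rewrite mulrCA -[leLHS]mulr1 ler_wpM2l ?powR_ge0// -!expRD.
    by rewrite -[leLHS]expR0 ler_expR; have := cmp _ _ Py Px; lra.
  rewrite !mul0e add0e adde0.
  apply: (@le_trans _ _ ((Ka * expR (L * p y))%:E * 1)%E).
    by rewrite lee_wpmul2l// lee_fin mulr_ge0// expR_ge0.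
  by rewrite mule1 lee_fin expr2 -mulrA ler_wpM2l.
exists (thr ^- n); split.
- by rewrite invr_ge0 exprn_ge0// ltW.
- by rewrite /lh_CJ; lra.
apply: (@le_trans _ _ (\int[mu]_(x in bset P) ((f x / lam) `^ p x)%:E)%E).
  apply: ge0_le_integralT => [|||x|x _].
  - exact: mP.
  - by apply/measurable_EFinP.
  - by apply/measurable_EFinP.
  - by rewrite lee_fin powR_ge0.
  - rewrite lee_fin fgE ler_peMr ?powR_ge0// gE.
    rewrite -[leLHS]expR0 ler_expR.
    by have := lh_ge Hp x; nra.
apply: (le_trans flam1); rewrite lee_fin.
rewrite -(@mulVf _ (thr ^+ n)) ?gt_eqF ?exprn_gt0// ler_wpM2l ?invr_ge0 ?exprn_ge0 ?(ltW thr0)//.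
by rewrite lerXn2r// nnegrE ltW.
Qed.

End norm_one.

(** * The one-step inequality on a box *)

Section local.
Context {R : realType} {n : nat}.
Notation T := (lebRn R n).
Notation mu := (@lebesgue_rV R n).
Context (pm pinf C0 Ci : R) (p : 'rV[R]_n -> R).
Hypothesis Hp : lh_exponent pm pinf C0 Ci p.
Notation pp := (lh_max pinf Ci).
Notation eps := (lh_eps pm pinf Ci).
Notation CJ := (@lh_CJ R n pm pinf C0 Ci).
Notation kG := (@lh_kG R n pm C0 Ci).
Notation modular_p := (modular mu p).

Let mp : measurable_fun [set: T] (p : T -> R) := lh_meas Hp.
Let pm0 := lh_pm Hp.
Let pp0 := lh_max_gt0 Hp.
Let eps0 := lh_eps_gt0 Hp.
Let p_ge : forall x : T, pm <= p x := lh_ge Hp.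
Let p_le : forall x : T, p x <= pp := lh_le Hp.

(** Chosen so that the indicator of [D], multiplied by
    [(8 * CJ)^(1 / eps)], would contradict [lh_average] if
    [\int_D lam^-p < lh_cF] for some [D] filling a quarter of the box. *)
Definition lh_cF : R := (8 * CJ) `^ (- (pp / eps)).

Lemma lh_CJ_ge1 : 1 <= CJ.
Proof.
have h1 := sqr_ge0 (@lh_Ka R n pm C0).
have h2 : 0 <= (@lh_thr R n) ^- n.
  by rewrite invr_ge0; apply: exprn_ge0; apply: ltW; exact: (lh_thr_gt0 Hp).
have h3 : 0 < @lh_K1 R n pm Ci by rewrite /lh_K1 expR_gt0.
have h4 : 0 < @lh_K2 R n pinf Ci by rewrite /lh_K2 expR_gt0.
by rewrite /lh_CJ; nra.
Qed.

Lemma measurable_level (v : T -> R) (s c : R) : measurable_fun [set: T] v ->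
  measurable [set x | v x * s <= c].
Proof.
move=> mv; have mvs : measurable_fun [set: T] (fun x => v x * s).
  exact: measurable_funM mv (measurable_cst _).
have := mvs measurableT _ (measurable_itv `]-oo, c]%R); rewrite setTI.
by congr measurable; apply/seteqP; split=> x /=; rewrite in_itv.
Qed.

Lemma lh_mass_lower (P : @dbox R n) (D : set T) (lam : R) :
  0 < side P -> 0 < lam -> measurable D -> D `<=` bset P ->
  (mu (bset P) <= 4%:E * mu D)%E -> modular_p (bset P) (fun=> lam^-1) = 1%E ->
  (lh_cF%:E <= modular_p D (fun=> lam^-1)%R)%E.
Proof.
move=> l0 lam0 mD DP PD lam1; rewrite leNgt; apply/negP => small.
have CJ1 := lh_CJ_ge1.
have mP := measurable_bset P.
(* The function [s] on [D] has norm at most 1 on the box, but an average too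
   large for [lh_average]. *)
pose s := (8 * CJ) `^ (eps^-1).
have s0 : 0 <= s by exact: powR_ge0.
have s1 : 1 <= s.
  have h : 1 <= 8 * CJ by lra.
  have := @ler_powR _ (8 * CJ) h 0 (eps^-1).
  by rewrite powRr0; apply; rewrite invr_ge0 ltW.
pose f : T -> R := fun x => s * \1_D x.
have mf : measurable_fun [set: T] f.
  exact: measurable_funM (measurable_cst _) (measurable_indic mD).
have f0 x : 0 <= f x by rewrite mulr_ge0.
have fD x : D x -> f x = s by move=> Dx; rewrite /f indicE mem_set// mulr1.
have fN x : ~ D x -> f x = 0 by move=> Dx; rewrite /f indicE memNset// mulr0.
have modf : (modular_p (bset P) (fun x => f x / lam)%R <= 1)%E.
  rewrite /modular (@integral_support _ _ _ _ D)//; last first.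
    by move=> x _ /fN ->; rewrite mul0r powR0// gt_eqF// (lt_le_trans pm0).
  apply: (@le_trans _ _ ((s `^ pp)%:E * modular_p D (fun=> lam^-1%R))%E).
    apply: (le_modular mu mp mD).
    - exact: measurable_funM mf (measurable_cst _).
    - exact: measurable_cst.
    - exact: powR_ge0.
    - move=> x /fD ->; rewrite powRM ?invr_ge0 ?(ltW lam0)//.
      by rewrite ler_wpM2r ?powR_ge0// ler_powR.
  apply: (@le_trans _ _ ((s `^ pp)%:E * lh_cF%:E)%E).
    by apply: lee_wpmul2l; [rewrite lee_fin powR_ge0|exact: ltW].
  rewrite -EFinM lee_fin /lh_cF /s -powRrM -powRD; last first.
    by apply/implyP => _; rewrite gt_eqF//; lra.
  by rewrite (mulrC eps^-1) subrr powRr0.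
have := lh_average Hp l0 lam0 mf f0 lam1 modf.
rewrite (@integral_support _ _ _ _ D)//; last first.
  by move=> x _ /fN ->; rewrite powR0// gt_eqF.
have -> : (\int[mu]_(x in D) (f x `^ eps)%:E = (8 * CJ)%:E * mu D)%E.
  rewrite -integral_cst_mu//; apply: eq_integral => x; rewrite inE => /fD ->.
  by rewrite /s -powRrM mulVf ?gt_eqF// powRr1//; lra.
have muPfin : (mu (bset P) = (side P ^+ n)%:E)%E by rewrite mu_bset.
have muDfin : mu D \is a fin_num.
  rewrite ge0_fin_numE//; apply: (@le_lt_trans _ _ (mu (bset P))).
    by apply: le_measure; rewrite ?inE.
  by rewrite muPfin ltry.
move: PD; rewrite muPfin -(fineK muDfin) -!EFinM !lee_fin => h1 h2.
have := exprn_gt0 n l0; set q := side P ^+ n in h1 h2 *; set r := fine _ in h1 h2 * => q0.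
have : CJ * q <= CJ * (4 * r) by rewrite ler_wpM2l//; lra.
by nra.
Qed.

(** The only trace of the weight in the scalar argument: [a] and [lam] are
    the norms of [v] and of [1] on the box, and [v] exceeds [gam] times its
    mean [a / lam] on at least three quarters of the box. *)
Definition level_cond (gam : R) (v : T -> R) := forall (P : @dbox R n) (a lam : R),
  0 < side P -> 0 < a -> 0 < lam ->
  modular_p (bset P) (fun x => v x / a) = 1%E ->
  modular_p (bset P) (fun=> lam^-1) = 1%E ->
  (4%:E * mu (bset P `&` [set x | v x * lam <= gam * a]%R) <= mu (bset P))%E.

Lemma level_condZ gam (v : T -> R) b : 0 < b -> level_cond gam v ->
  level_cond gam (fun x => v x / b).
Proof.
move=> b0 hv P a lam l0 a0 lam0 va lam1.
have {}hv := hv P (b * a) lam l0 (mulr_gt0 b0 a0) lam0 _ lam1.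
have E x : (v x / b * lam <= gam * a) = (v x * lam <= gam * (b * a)).
  by rewrite mulrAC ler_pdivrMr// -mulrA (mulrC a).
rewrite (_ : [set x | _] = [set x | v x * lam <= gam * (b * a)]).
  by apply: hv; rewrite -va; congr modular; apply/funext => x; rewrite invfM mulrA.
by apply/seteqP; split=> x /=; rewrite E.
Qed.

Lemma unit_norm_box (P : @dbox R n) : 0 < side P ->
  exists2 lam, 0 < lam & modular_p (bset P) (fun=> lam^-1) = 1%E.
Proof.
move=> l0.
have E : modular_p (bset P) (fun=> 1%R) = (side P ^+ n)%:E.
  rewrite /modular; under eq_integral do rewrite powR1.
  by rewrite integral_cst_mu ?mul1e ?mu_bset//; exact: measurable_bset.
have Epos : (0 < modular_p (bset P) (fun=> 1%R))%E by rewrite E lte_fin exprn_gt0.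
have Efin : (modular_p (bset P) (fun=> 1%R) < +oo)%E by rewrite E ltry.
have [lam lam0 h] := modular_normalize mp pm0 pp0 p_ge p_le (measurable_bset P)
  (measurable_cst (1 : R)) (fun=> ler01) Epos Efin.
by exists lam => //; rewrite -h; congr modular; apply/funext => x; rewrite div1r.
Qed.

Definition lh_K (gam : R) : R := expR (2 * kG) * gam `^ (- pp) / lh_cF.

Lemma lh_cF_gt0 : 0 < lh_cF.
Proof. by apply: powR_gt0; have := lh_CJ_ge1; lra. Qed.

Lemma lh_cF_le1 : lh_cF <= 1.
Proof.
have h : 1 <= 8 * CJ by have := lh_CJ_ge1; lra.
have := @ler_powR _ (8 * CJ) h (- (pp / eps)) 0; rewrite powRr0; apply.
by rewrite oppr_le0 divr_ge0// ltW.
Qed.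

(** Let [a <= 1] be the norm of [v] on [P].  If [a^p] is comparable on [P] to
    [e0 = a^p(x0)], then [\int_P v^p] is at most [expR kG * e0], while outside
    [G] there is a quarter [F] of [P] with [v / a >= gam / lam], and
    [\int_F lam^-p] is bounded below by [lh_mass_lower].  Otherwise
    [\int_P v^p <= a^pm], which is absorbed by the background. *)
Lemma local_inequality gam (v : T -> R) (P : @dbox R n) (G : set T) :
  0 < gam -> gam <= 1 -> measurable_fun [set: T] v -> (forall x, 0 <= v x) ->
  level_cond gam v -> 0 < side P -> measurable G ->
  (modular_p (bset P) v <= 1)%E ->
  (mu (bset P `&` G) <= (2^-1)%:E * mu (bset P))%E ->
  (modular_p (bset P) v <=
    (lh_K gam)%:E * modular_p (bset P `\` G) v +
    \int[mu]_(x in bset P) ((2^-1)%:E * background x))%E.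
Proof.
move=> gam0 gam1 mv v0 hv l0 mG vP1 GP.
have mP := measurable_bset P.
have mPG : measurable (bset P `\` G) by exact: measurableD.
have [-> |vPn0] := eqVneq (modular_p (bset P) v) 0%E.
  apply: adde_ge0; last first.
    by apply: integral_ge0 => x _; apply: mule_ge0; rewrite ?lee_fin// background_ge0.
  apply: mule_ge0; last exact: modular_ge0.
  by rewrite lee_fin /lh_K divr_ge0 ?mulr_ge0 ?expR_ge0 ?powR_ge0// ltW// lh_cF_gt0.
have vP0 : (0 < modular_p (bset P) v)%E by rewrite lt_def vPn0 modular_ge0.
have [|a a0 va1] := modular_normalize mp pm0 pp0 p_ge p_le mP mv v0 vP0.
  by apply: (le_lt_trans vP1); rewrite ltry.
have [lam lam0 lam1] := unit_norm_box l0.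
have mva : measurable_fun [set: T] (fun x => v x / a).
  exact: measurable_funM mv (measurable_cst _).
have va0 x : 0 <= v x / a by rewrite divr_ge0// ltW.
(* [a] is at most 1 because the modular of [v] is. *)
have a1 : a <= 1.
  rewrite leNgt; apply/negP => a1.
  have := modular_div_le mu mp p_ge mP mv v0 (ltW a1); rewrite va1.
  have h : (1 <= a `^ pm)%R.
    by have := @ler_powR _ a (ltW a1) 0 pm; rewrite powRr0; apply; exact: ltW.
  have h' : a `^ (- pm) < 1.
    rewrite powRN invf_lt1 ?powR_gt0// lt_neqAle h andbT; apply/eqP => /esym/eqP.
    by rewrite powR_eq1 => /orP[/eqP|/orP[|/eqP]]; [lra|lra|have := pm0; lra].
  move=> h''; have : (1 <= (a `^ (- pm))%:E * 1 :> \bar R)%E.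
    by apply: (le_trans h''); apply: lee_wpmul2l => //; rewrite lee_fin powR_ge0.
  by rewrite mule1 lee_fin leNgt h'.
pose alpha := - ln a.
have alpha0 : 0 <= alpha by rewrite oppr_ge0 ln_le0.
have aE x : a `^ p x = expR (- (alpha * p x)).
  by rewrite gt0_powRE// /alpha mulNr opprK mulrC.
have vE x : v x `^ p x = (v x / a) `^ p x * a `^ p x.
  by rewrite -powRM ?(ltW a0)// divfK// gt_eqF.
have mbg := @measurable_background R n.
have [good|bad] := lh_dichotomy Hp l0 alpha0; last first.
  apply: (@le_trans _ _ (\int[mu]_(x in bset P) ((2^-1)%:E * background x))%E); last first.
    rewrite leeDr//; apply: mule_ge0; last exact: modular_ge0.
    by rewrite lee_fin /lh_K divr_ge0 ?mulr_ge0 ?expR_ge0 ?powR_ge0// ltW// lh_cF_gt0.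
  rewrite ge0_integralZlT//; last exact: background_ge0.
  apply: le_trans bad.
  rewrite -[leRHS]mule1 -va1; apply: (le_modular mu mp mP mv mva (expR_ge0 _)).
  move=> x _; rewrite vE mulrC ler_wpM2r ?powR_ge0// aE ler_expR lerN2.
  by rewrite ler_wpM2l.
pose F := (bset P `\` G) `\` [set x | v x * lam <= gam * a].
have mL : measurable [set x | v x * lam <= gam * a] by exact: measurable_level.
have mF : measurable F by exact: measurableD.
have FPG : F `<=` bset P `\` G by exact: subDsetl.
have FP : F `<=` bset P by apply: (subset_trans FPG); exact: subDsetl.
have muPfin : (mu (bset P) = (side P ^+ n)%:E)%E by rewrite mu_bset.
have muF : (mu (bset P) <= 4%:E * mu F)%E.
  have h1 := hv P a lam l0 a0 lam0 va1 lam1.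
  have fin E : measurable E -> mu (bset P `&` E) \is a fin_num.
    by move=> mE; rewrite ge0_fin_numE//; exact: mu_bset_setI_fin.
  have FE : F = bset P `&` F by rewrite setIC setIidl.
  have h2 : (mu (bset P) <= mu (bset P `&` G) +
      mu (bset P `&` [set x | v x * lam <= gam * a]%R) + mu F)%E.
    apply: (@le_trans _ _ (mu ((bset P `&` G) `|`
       (bset P `&` [set x | v x * lam <= gam * a]%R) `|` F))).
      apply: le_measure; rewrite ?inE//.
        by apply: measurableU => //; apply: measurableU; exact: measurableI.
      move=> x Px; have := EM (G x); have := EM (v x * lam <= gam * a).
      by rewrite /F /=; tauto.
    apply: (le_trans (measureU2 _ _ mF)).
      by apply: measurableU; exact: measurableI.
    by rewrite leeD2r//; apply: measureU2; exact: measurableI.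
  move: h1 h2 GP; rewrite muPfin FE.
  rewrite -(fineK (fin _ mG)) -(fineK (fin _ mL)) -(fineK (fin _ mF)).
  by rewrite -!EFinM -!EFinD !lee_fin; lra.
have cFle := lh_mass_lower l0 lam0 mF FP muF lam1.
have [x0 Px0] : bset P !=set0.
  apply/set0P/eqP => P0; have := muPfin; rewrite P0 measure0 => -[] /esym/eqP.
  by rewrite gt_eqF// exprn_gt0.
pose e0 := expR (- (alpha * p x0)).
have e00 : 0 < e0 by exact: expR_gt0.
have up : (modular_p (bset P) v <= (expR kG * e0)%:E)%E.
  rewrite -[leRHS]mule1 -va1; apply: (le_modular mu mp mP mv mva).
    by rewrite mulr_ge0 ?expR_ge0.
  move=> x Px; rewrite vE mulrC ler_wpM2r ?powR_ge0// aE -expRD ler_expR.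
  by have := good _ _ Px0 Px; lra.
have gpp : 0 < gam `^ pp by exact: powR_gt0.
have down : ((gam `^ pp * expR (- kG) * e0 * lh_cF)%:E <= modular_p (bset P `\` G) v)%E.
  apply: (@le_trans _ _ (modular_p F v)); last exact: (modular_sub mu mp mF mPG mv FPG).
  have c0 : 0 < gam `^ pp * expR (- kG) * e0 by rewrite !mulr_gt0 ?expR_gt0.
  apply: (@le_trans _ _ ((gam `^ pp * expR (- kG) * e0)%:E * modular_p F (fun=> lam^-1%R))%E).
    by rewrite EFinM; apply: lee_wpmul2l => //; rewrite lee_fin ltW.
  rewrite muleC -lee_pdivlMr// muleC.
  apply: (le_modular mu mp mF (measurable_cst _) mv).
    by rewrite invr_ge0 ltW.
  move=> x Fx; rewrite ler_pdivlMl// vE.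
  have [[Px _] /negP] : (bset P `\` G) x /\ ~ (v x * lam <= gam * a) by [].
  rewrite -ltNge => big.
  have h1 : gam * lam^-1 <= v x / a.
    by rewrite ler_pdivlMr// mulrAC ler_pdivrMr// ltW.
  have h2 : (gam * lam^-1) `^ p x <= (v x / a) `^ p x.
    apply: ge0_ler_powR; rewrite ?nnegrE//; last by rewrite divr_ge0// ltW.
    by apply: le_trans (ltW pm0) _.
  have h3 : gam `^ pp <= gam `^ p x by apply: ger_powR => //; rewrite gam0.
  have h4 : expR (- kG) * e0 <= a `^ p x.
    by rewrite aE -expRD ler_expR; have := good _ _ Px Px0; lra.
  rewrite -mulrA mulrAC; apply: ler_pM => //.
  - by rewrite mulr_ge0 ?powR_ge0.
  - by rewrite mulr_ge0 ?expR_ge0.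
  apply: le_trans h2; rewrite powRM ?invr_ge0 ?(ltW lam0) ?(ltW gam0)//.
  by rewrite ler_wpM2r ?powR_ge0.
apply: (le_trans up).
apply: (@le_trans _ _ ((lh_K gam)%:E * (gam `^ pp * expR (- kG) * e0 * lh_cF)%:E)%E).
  rewrite -EFinM lee_fin /lh_K powRN le_eqVlt; apply/orP; left; apply/eqP.
  have -> : expR (2 * kG) = expR kG * expR kG by rewrite -expRD; congr expR; ring.
  have ekG : expR kG * expR (- kG) = 1 by rewrite expRN divff// gt_eqF// expR_gt0.
  have cn := lt0r_neq0 lh_cF_gt0; have gn := lt0r_neq0 gpp.
  transitivity (expR kG * e0 * (expR kG * expR (- kG))); first by rewrite ekG mulr1.
  by field; rewrite cn gn.
apply: (@le_trans _ _ ((lh_K gam)%:E * modular_p (bset P `\` G) v)%E).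
  apply: lee_wpmul2l => //.
  by rewrite lee_fin /lh_K divr_ge0 ?mulr_ge0 ?expR_ge0 ?powR_ge0// ltW// lh_cF_gt0.
rewrite leeDl//; apply: integral_ge0 => x _; apply: mule_ge0; rewrite ?lee_fin//.
exact: background_ge0.
Qed.

End local.

(** * Geometric decay of the modular on small sets *)

Section decay.
Context {R : realType} {n : nat}.
Notation T := (lebRn R n).
Notation mu := (@lebesgue_rV R n).
Context (pm pinf C0 Ci : R) (p : 'rV[R]_n -> R).
Hypothesis Hp : lh_exponent pm pinf C0 Ci p.
Notation pp := (lh_max pinf Ci).
Notation kG := (@lh_kG R n pm C0 Ci).
Notation modular_p := (modular mu p).
Notation lh_K := (@lh_K R n pm pinf C0 Ci).
Notation level_cond := (level_cond p).

Let mp : measurable_fun [set: T] (p : T -> R) := lh_meas Hp.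
Let pm0 := lh_pm Hp.
Let pp0 := lh_max_gt0 Hp.
Let p_le : forall x : T, p x <= pp := lh_le Hp.

(** The loss of modular in one step, and the scaling of [v] that restores
    modular [1] after this loss. *)
Definition lh_kap gam : R := (4 * lh_K gam)^-1.
Definition lh_bet gam : R := (1 - lh_kap gam) `^ (pp^-1).

Lemma lh_kG_ge0 : 0 <= kG.
Proof.
have hC0 := ltW (lh_C0 Hp); have hCi := ltW (lh_Ci Hp).
have lnthr : 0 <= ln ((@lh_thr R n)^-1).
  by rewrite ln_ge0// invf_ge1 ?(lh_thr_gt0 Hp)// ltW// (lh_thr_lt1 Hp).
have hN : 0 <= @bgexp R n by exact: ler0n.
have hn : 0 <= n%:R :> R by exact: ler0n.
have A : 0 <= 1 + n%:R * ln ((@lh_thr R n)^-1) + 2 * @bgexp R n.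
  by rewrite addr_ge0 ?addr_ge0 ?mulr_ge0.
have hpm := ltW pm0.
by apply: addr_ge0; apply: divr_ge0 => //; do 2?[apply: mulr_ge0 => //].
Qed.

Lemma lh_K_ge1 gam : 0 < gam -> gam <= 1 -> 1 <= lh_K gam.
Proof.
move=> g0 g1; have c0 := lh_cF_gt0 Hp; have c1 := lh_cF_le1 Hp.
rewrite /lh_K ler_pdivlMr// mul1r; apply: (le_trans c1).
have e1 : 1 <= expR (2 * kG).
  by rewrite -[leLHS]expR0 ler_expR mulr_ge0// lh_kG_ge0.
have e2 : 1 <= gam `^ (- pp).
  rewrite -(powRr0 gam); apply: ger_powR; first by rewrite g0.
  by rewrite oppr_le0 ltW.
by rewrite -[leLHS]mul1r ler_pM.
Qed.

Lemma lh_kap_bounds gam : 0 < gam -> gam <= 1 ->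
  0 < lh_kap gam /\ lh_kap gam <= 4^-1.
Proof.
move=> g0 g1; have K1 := lh_K_ge1 g0 g1.
by split; rewrite /lh_kap ?invr_gt0 ?lef_pV2 ?posrE; lra.
Qed.

Lemma lh_bet_bounds gam : 0 < gam -> gam <= 1 -> 0 < lh_bet gam /\ lh_bet gam <= 1.
Proof.
move=> g0 g1; have [k0 k4] := lh_kap_bounds g0 g1.
have k1 : 0 < 1 - lh_kap gam by lra.
split; first exact: powR_gt0.
rewrite -(powRr0 (1 - lh_kap gam)); apply: ger_powR.
  by rewrite k1/=; lra.
by rewrite invr_ge0 ltW.
Qed.

Lemma half_background_integral (E : set T) : measurable E ->
  (\int[mu]_(x in E) ((2^-1)%:E * background x) <= (2^-1)%:E)%E.
Proof.
move=> mE; rewrite (@ge0_integralZlT _ _ _ mu E _ _ mE measurable_background background_ge0)//.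
by rewrite -[leRHS]mule1; apply: lee_wpmul2l => //; exact: integral_background_sub.
Qed.

(** Induction on [i].  The stopping set [E] of [G] has [2 ^+ n.+1] times
    larger measure at most, so the induction hypothesis applies to it.  If
    [v] is scaled to have modular at most [1] on [E], then
    [\int_E v^p <= K * \int_(E `\` G) v^p + 1/2]: either [\int_E v^p] is below
    [1 - kap], or a fixed amount [kap = 1 / (4 * K)] of it lies outside [G]. *)
Lemma decay_simple gam (v : T -> R) (B : @dbox R n) i k (G : set T) b :
  0 < gam -> gam <= 1 -> measurable_fun [set: T] v -> (forall x, 0 <= v x) ->
  level_cond gam v -> 0 < side B -> 0 < b ->
  (modular_p (bset B) (fun x => v x / b)%R <= 1)%E ->
  measurable G -> simple k B G ->
  (mu (bset B `&` G) <= ((2 ^- n.+1) ^+ i)%:E * mu (bset B))%E ->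
  (modular_p (bset B `&` G) (fun x => v x / (b * lh_bet gam ^+ i))%R <= 1)%E.
Proof.
move=> g0 g1 mv v0 hv l0 b0 vb1; have mB := measurable_bset B.
have [bet0 bet1] := lh_bet_bounds g0 g1.
have [kap0 kap4] := lh_kap_bounds g0 g1.
have K1 := lh_K_ge1 g0 g1.
have mdiv (c : R) : measurable_fun [set: T] (fun x => v x / c).
  exact: measurable_funM mv (measurable_cst _).
elim: i k G => [|i IH] k G mG sG GB.
  rewrite expr0 mulr1; apply: le_trans vb1.
  by apply: (modular_sub mu mp (measurableI _ _ mB mG) mB (mdiv b)); exact: subIsetl.
have a0 : 0 < 2 ^- n.+1 :> R by rewrite invr_gt0 exprn_gt0.
have a1 : 2 ^- n.+1 <= 1 :> R by rewrite invf_le1 ?exprn_gt0// exprn_ege1// ler1n.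
have muB : (mu (bset B) = (side B ^+ n)%:E)%E by rewrite mu_bset.
have l0n : 0 < side B ^+ n by exact: exprn_gt0.
have GB1 : (mu (bset B `&` G) <= (2 ^- n.+1)%:E * mu (bset B))%E.
  apply: (le_trans GB); rewrite muB -!EFinM lee_fin ler_pM2r// exprS.
  by rewrite -[leRHS]mulr1 ler_pM2l// exprn_ile1// ltW.
have [E [[mE sE EB GE] [muE ineq]]] := stopping_cubes l0 mG sG GB1.
have mEG : measurable (E `\` G) by exact: measurableD.
have mEIG : measurable (E `&` G) by exact: measurableI.
have E1 : (modular_p E (fun x => v x / (b * lh_bet gam ^+ i))%R <= 1)%E.
  have BE : bset B `&` E = E by exact/setIidr.
  rewrite -BE; apply: (IH k E mE sE); rewrite BE.
  have : ((2 ^- n.+1)%:E * mu E <= (2 ^- n.+1)%:E * (((2 ^- n.+1) ^+ i)%:E * mu (bset B)))%E.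
    by apply: (le_trans muE); rewrite muleA -EFinM -exprS.
  by rewrite lee_pmul2l.
set c := b * lh_bet gam ^+ i in E1.
have c0 : 0 < c by rewrite mulr_gt0// exprn_gt0.
set f : T -> R := fun x => v x / c.
have mf : measurable_fun [set: T] f := mdiv c.
have f0 x : 0 <= f x by rewrite divr_ge0// ltW.
have hf : level_cond gam f by exact: level_condZ.
have key : (modular_p E f <= (lh_K gam)%:E * modular_p (E `\` G) f + (2^-1)%:E)%E.
  apply: (@le_trans _ _ ((lh_K gam)%:E * modular_p (E `\` G) f +
     \int[mu]_(x in E) ((2^-1)%:E * background x))%E); last first.
    by rewrite leeD2l//; exact: half_background_integral.
  apply: ineq.
  - by apply: le_trans K1.
  - exact: (measurable_modular mp mf).
  - by move=> x; rewrite lee_fin powR_ge0.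
  - exact: measurable_funeM measurable_background.
  - by move=> x; apply: mule_ge0; rewrite ?lee_fin ?invr_ge0// background_ge0.
  - move=> P lP PE GP; apply: (local_inequality Hp g0 g1 mf f0 hf lP mG _ GP).
    apply: le_trans E1.
    exact: (modular_sub mu mp (measurable_bset P) mE mf PE).
have split : modular_p E f = (modular_p (E `\` G) f + modular_p (E `&` G) f)%E.
  exact: (modular_setDI mu mp mE mG mf).
have D1 : (modular_p (E `&` G) f <= (1 - lh_kap gam)%:E)%E.
  have fE : modular_p E f \is a fin_num.
    by rewrite ge0_fin_numE ?modular_ge0// (le_lt_trans E1)// ltry.
  have : modular_p (E `\` G) f \is a fin_num.
    by move: fE; rewrite split fin_numD => /andP[].
  have : modular_p (E `&` G) f \is a fin_num.
    by move: fE; rewrite split fin_numD => /andP[].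
  move=> f2 f1; move: split key E1 (modular_ge0 mu p (E `\` G) f).
  rewrite -(fineK fE) -(fineK f1) -(fineK f2) -EFinD => -[].
  set X := fine _; set Y := fine _; set Z := fine _ => -> .
  rewrite -EFinM -EFinD !lee_fin => h1 h2 h3.
  have h4 : 4 * lh_K gam * lh_kap gam = 1 by rewrite /lh_kap divff//; lra.
  have [|big] := leP (Y + Z) (1 - lh_kap gam); first lra.
  have : lh_kap gam <= Y.
    by rewrite -(ler_pM2l (_ : 0 < 4 * lh_K gam)); lra.
  lra.
have mBG : measurable (bset B `&` G) by exact: measurableI.
have D2 : (modular_p (bset B `&` G) f <= (1 - lh_kap gam)%:E)%E.
  apply: le_trans D1; apply: (modular_sub mu mp mBG mEIG mf).
  by move=> x BGx; split; [exact: GE|case: BGx].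
have ib1 : 1 <= (lh_bet gam)^-1 by rewrite invf_ge1.
have := modular_div_ge mu mp p_le mBG (mdiv (b * lh_bet gam ^+ i.+1)) _ ib1.
move=> /(_ _)/le_trans; apply.
  by move=> x; rewrite divr_ge0// mulr_ge0 ?(ltW b0)// exprn_ge0// ltW.
rewrite (_ : (fun x => _) = f); last first.
  apply/funext => x; rewrite /f /c exprSr; field.
  by rewrite !gt_eqF// exprn_gt0.
have k1 : 0 < 1 - lh_kap gam by lra.
apply: (@le_trans _ _ ((((lh_bet gam)^-1) `^ pp)%:E * (1 - lh_kap gam)%:E)%E).
  by apply: lee_wpmul2l => //; rewrite lee_fin powR_ge0.
rewrite -EFinM lee_fin /lh_bet -powRN -powRrM mulNr mulVf ?gt_eqF//.
by rewrite powR_inv1 ?(ltW k1)// mulVf// gt_eqF.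
Qed.

End decay.

Section reverse_holder.
Context {R : realType} {n : nat}.
Notation T := (lebRn R n).
Notation mu := (@lebesgue_rV R n).
Context (pm pinf C0 Ci : R) (p : 'rV[R]_n -> R).
Hypothesis Hp : lh_exponent pm pinf C0 Ci p.
Notation pp := (lh_max pinf Ci).
Notation modular_p := (modular mu p).
Notation lh_kap := (@lh_kap R n pm pinf C0 Ci).
Notation lh_bet := (@lh_bet R n pm pinf C0 Ci).
Notation level_cond := (level_cond p).
Notation alpha := (2 ^- n.+1 : R).

Let mp : measurable_fun [set: T] (p : T -> R) := lh_meas Hp.
Let pm0 := lh_pm Hp.
Let pp0 := lh_max_gt0 Hp.
Let p_ge : forall x : T, pm <= p x := lh_ge Hp.
Let p_le : forall x : T, p x <= pp := lh_le Hp.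

(** A union of cells [G] close to [D] still has small measure, because the
    hypothesis on [D] is strict; the part of [D] outside [G] has a modular
    below any given [eta]. *)
Lemma decay_measurable gam (v : T -> R) (B : @dbox R n) i (D : set T) b :
  0 < gam -> gam <= 1 -> measurable_fun [set: T] v -> (forall x, 0 <= v x) ->
  level_cond gam v -> 0 < side B -> 0 < b ->
  (modular_p (bset B) (fun x => v x / b)%R <= 1)%E ->
  measurable D -> D `<=` bset B ->
  (mu D < (alpha ^+ i)%:E * mu (bset B))%E ->
  (modular_p D (fun x => v x / (b * lh_bet gam ^+ i))%R <= 1)%E.
Proof.
move=> g0 g1 mv v0 hv l0 b0 vb1 mD DB muD; have mB := measurable_bset B.
have [bet0 bet1] := lh_bet_bounds Hp g0 g1.
have beti0 : 0 < lh_bet gam ^+ i by rewrite exprn_gt0.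
have c0 : 0 < b * lh_bet gam ^+ i by rewrite mulr_gt0.
set g : T -> R := fun x => v x / (b * lh_bet gam ^+ i).
have mg : measurable_fun [set: T] g by exact: measurable_funM mv (measurable_cst _).
have g0' x : 0 <= g x by rewrite divr_ge0// ltW.
have gfin : (modular_p (bset B) g < +oo)%E.
  have t1 : 1 <= (lh_bet gam ^+ i)^-1 by rewrite invf_ge1// exprn_ile1// ltW.
  apply: (le_lt_trans (modular_div_ge mu mp p_le mB mg g0' t1)).
  rewrite (_ : (fun x => _) = (fun x => v x / b)); last first.
    by apply/funext => x; rewrite /g; field; rewrite !gt_eqF.
  apply: (@le_lt_trans _ _ ((((lh_bet gam ^+ i)^-1) `^ pp)%:E * 1)%E).
    by apply: lee_wpmul2l => //; rewrite lee_fin powR_ge0.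
  by rewrite mule1 ltry.
apply/lee_addgt0Pr => eta eta0.
have [dl dl0 hdl] := modular_abs_continuous mp mB mg gfin eta0.
have muB : (mu (bset B) = (side B ^+ n)%:E)%E by rewrite mu_bset.
have Dfin : mu D \is a fin_num.
  by rewrite ge0_fin_numE// -(setIidr DB); exact: mu_bset_setI_fin.
set d := alpha ^+ i * side B ^+ n - fine (mu D).
have d0 : 0 < d.
  by move: muD; rewrite muB -(fineK Dfin) -EFinM lte_fin /d; lra.
have [_ /(_ (Num.min d dl))] := approximable_measurable l0 mD.
rewrite lt_min d0 dl0 => /(_ isT)[k [G [mG sG GD]]].
have mY : measurable (bset B `&` (D `+` G)).
  by apply: measurableI => //; exact: measurable_setY.
have mDG : measurable (D `\` G) by exact: measurableD.
have mDIG : measurable (D `&` G) by exact: measurableI.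
have mBG : measurable (bset B `&` G) by exact: measurableI.
have GB : (mu (bset B `&` G) <= (alpha ^+ i)%:E * mu (bset B))%E.
  apply: (@le_trans _ _ (mu D + mu (bset B `&` (D `+` G)))%E).
    apply: le_trans (measureU2 _ mD mY).
    apply: le_measure; rewrite ?inE//; first exact: measurableU.
    move=> x [Bx Gx]; have := EM (D x) => -[Dx|nDx]; first by left.
    by right; split=> //; right.
  rewrite muB -EFinM -(fineK Dfin).
  apply: (@le_trans _ _ ((fine (mu D))%:E + d%:E)%E).
    by rewrite leeD2l// ltW// (lt_le_trans GD)// lee_fin ge_min lexx.
  by rewrite -EFinD lee_fin /d; lra.
have h1 := decay_simple Hp g0 g1 mv v0 hv l0 b0 vb1 mG sG GB.
rewrite (modular_setDI mu mp mD mG mg) addeC; apply: leeD.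
  apply: le_trans h1.
  by apply: (modular_sub mu mp mDIG mBG mg) => x [Dx Gx]; split=> //; exact: DB.
apply: hdl => //; first by move=> x [/DB].
apply: (@le_lt_trans _ _ (mu (bset B `&` (D `+` G)))).
  apply: le_measure; rewrite ?inE// => x [Dx nGx]; split; first exact: DB.
  by left.
by apply: (lt_le_trans GD); rewrite lee_fin ge_min lexx orbT.
Qed.

(** Half of the first order term of [1 - (1 - kap)^(pm / pp)]. *)
Definition lh_rate gam : R := pm / pp * lh_kap gam / 2.

Lemma lh_rate_bounds gam : 0 < gam -> gam <= 1 -> 0 < lh_rate gam /\ lh_rate gam <= 8^-1.
Proof.
move=> g0 g1; have [k0 k4] := lh_kap_bounds Hp g0 g1.
have hpm := pm0; have hpp := pp0.
have s1 : pm / pp <= 1.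
  by rewrite ler_pdivrMr// mul1r (le_trans (lh_ge Hp 0))// (lh_le Hp).
have s0 : 0 < pm / pp by rewrite divr_gt0.
by rewrite /lh_rate; split; nra.
Qed.

(** As [bet <= 1], the modular of [v] is at most [bet^(pm * i)] times that of
    [v / bet^i], which [decay_measurable] bounds by [1]. *)
Lemma level_decay gam (v : T -> R) (B : @dbox R n) i (D : set T) :
  0 < gam -> gam <= 1 -> measurable_fun [set: T] v -> (forall x, 0 <= v x) ->
  level_cond gam v -> 0 < side B -> (modular_p (bset B) v <= 1)%E ->
  measurable D -> D `<=` bset B ->
  (mu D < (alpha ^+ i)%:E * mu (bset B))%E ->
  (modular_p D v <= ((1 - lh_rate gam) ^+ i)%:E)%E.
Proof.
move=> g0 g1 mv v0 hv l0 v1 mD DB muD.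
have [bet0 bet1] := lh_bet_bounds Hp g0 g1.
have [kap0 kap4] := lh_kap_bounds Hp g0 g1.
have beti0 : 0 < lh_bet gam ^+ i by rewrite exprn_gt0.
have v1' : (modular_p (bset B) (fun x => v x / 1)%R <= 1)%E.
  by rewrite (_ : (fun x => _) = v)//; apply/funext => x; rewrite divr1.
have := decay_measurable g0 g1 mv v0 hv l0 ltr01 v1' mD DB muD.
rewrite mul1r; set g : T -> R := fun x => v x / _ => h.
have mg : measurable_fun [set: T] g by exact: measurable_funM mv (measurable_cst _).
have g0' x : 0 <= g x by rewrite divr_ge0// ltW.
have t1 : 1 <= (lh_bet gam ^+ i)^-1 by rewrite invf_ge1// exprn_ile1// ltW.
have := modular_div_le mu mp p_ge mD mg g0' t1.
rewrite (_ : (fun x => _) = v); last first.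
  by apply/funext => x; rewrite /g; field; rewrite gt_eqF.
move=> /le_trans; apply.
apply: (@le_trans _ _ ((((lh_bet gam ^+ i)^-1) `^ (- pm))%:E * 1)%E).
  by apply: lee_wpmul2l => //; rewrite lee_fin powR_ge0.
have -> : ((lh_bet gam ^+ i)^-1) `^ (- pm) = (lh_bet gam `^ pm) ^+ i.
  rewrite gt0_powRE ?invr_gt0// lnV ?posrE// lnXn// (gt0_powRE _ bet0) -expRM_natl.
  by congr expR; rewrite -[ln _ *+ i]mulr_natl; ring.
rewrite mule1 lee_fin.
have k1 : 0 < 1 - lh_kap gam by lra.
have [r0 r8] := lh_rate_bounds g0 g1.
apply: lerXn2r; rewrite ?nnegrE ?powR_ge0//; first lra.
rewrite /lh_bet -powRrM gt0_powRE//.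
have lnk : ln (1 - lh_kap gam) <= - lh_kap gam.
  rewrite -[leRHS]expRK ler_ln ?posrE ?expR_gt0//.
  by have := expR_ge1Dx (- lh_kap gam).
have y0 : 0 < 2 * lh_rate gam by lra.
have h2 : pp^-1 * pm * ln (1 - lh_kap gam) <= - (2 * lh_rate gam).
  have -> : - (2 * lh_rate gam) = pp^-1 * pm * - lh_kap gam.
    by rewrite /lh_rate; field; rewrite gt_eqF.
  by rewrite ler_wpM2l// mulr_ge0 ?invr_ge0 ?(ltW pp0) ?(ltW pm0).
apply: (@le_trans _ _ (expR (- (2 * lh_rate gam)))); first by rewrite ler_expR.
have h3 := expR_ge1Dx (2 * lh_rate gam).
rewrite expRN; apply: (@le_trans _ _ ((1 + 2 * lh_rate gam)^-1)).
  by rewrite lef_pV2 ?posrE ?expR_gt0//; lra.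
by rewrite -[leLHS]mul1r ler_pdivrMr; [nra|lra].
Qed.

End reverse_holder.

(** * Reverse Hölder inequality in modular form *)

Section reverse_holder.
Context {R : realType} {n : nat}.
Notation T := (lebRn R n).
Notation mu := (@lebesgue_rV R n).
Context (pm pinf C0 Ci : R) (p : 'rV[R]_n -> R).
Hypothesis Hp : lh_exponent pm pinf C0 Ci p.
Notation pp := (lh_max pinf Ci).
Notation eps := (lh_eps pm pinf Ci).
Notation CJ := (@lh_CJ R n pm pinf C0 Ci).
Notation rate := (@lh_rate R n pm pinf C0 Ci).

Let pm0 := lh_pm Hp.
Let pp0 := lh_max_gt0 Hp.
Let eps0 := lh_eps_gt0 Hp.

(** Chosen so that [(T * S^i)^eps = 2 * CJ * 2^(n.+1 * i)]: by [lh_average]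
    the function exceeds [T * S^i] on less than [2^-(n.+1 * i)] of the box. *)
Definition lh_T : R := (2 * CJ) `^ (eps^-1).
Definition lh_S : R := (2 ^+ n.+1) `^ (eps^-1).
Definition lh_Lam gam : R := lh_T * lh_S * (1 + 2 / rate gam).

Lemma lh_T_ge1 : 1 <= lh_T.
Proof.
have h : 1 <= 2 * CJ by have := lh_CJ_ge1 Hp; lra.
by have := @ler_powR _ _ h 0 (eps^-1); rewrite powRr0; apply; rewrite invr_ge0 ltW.
Qed.

Lemma lh_S_gt1 : 1 < lh_S.
Proof.
rewrite /lh_S gt0_powRE ?exprn_gt0// expR_gt1 mulr_gt0 ?invr_gt0// ln_gt0//.
by rewrite exprn_egt1// ltr1n.
Qed.

Lemma lh_TS_powR i : (lh_T * lh_S ^+ i) `^ eps = 2 * CJ * (2 ^+ n.+1) ^+ i.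
Proof.
have T0 : 0 < lh_T by rewrite (lt_le_trans ltr01 lh_T_ge1).
have S0 : 0 < lh_S by rewrite (lt_trans ltr01 lh_S_gt1).
have C0' : 0 <= 2 * CJ by have := lh_CJ_ge1 Hp; lra.
rewrite powRM ?(ltW T0) ?exprn_ge0 ?(ltW S0)//; congr (_ * _).
  by rewrite /lh_T -powRrM mulVf ?gt_eqF// powRr1.
rewrite -powR_mulrn ?(ltW S0)// -powRrM mulrC powRrM powR_mulrn ?powR_ge0//.
by congr (_ ^+ i); rewrite /lh_S -powRrM mulVf ?gt_eqF// powRr1// exprn_ge0.
Qed.

(** The exponents are arranged so that the power of [lam] in
    [(u / lam^(1/r - 1))^(r * q)] is exactly [(r - 1) * q], which combines with
    [u^((r - 1) * q)]. *)
Lemma rescaled_integrand_le (u lam q r L : R) : 0 <= u -> 0 < lam ->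
  pm <= q -> q <= pp -> 1 < r -> 1 <= L ->
  (u / (L `^ (pm^-1) * lam `^ (r^-1 - 1))) `^ (r * q) <=
  L^-1 * (u `^ q * Num.max 1 (u * lam) `^ ((r - 1) * pp)).
Proof.
move=> u0 lam0 pq qp r1 L1; have hpm := pm0.
have q0 : 0 < q by lra.
have r0 : 0 < r by lra.
have L0 : 0 < L by lra.
have M1 : 1 <= Num.max 1 (u * lam) by rewrite le_max lexx.
have [->|un0] := eqVneq u 0.
  rewrite [X in X `^ _ <= _]mul0r (@powR0 _ (r * q)) ?gt_eqF ?mulr_gt0//.
  by rewrite mulr_ge0 ?mulr_ge0 ?powR_ge0// invr_ge0 ltW.
have up : 0 < u by rewrite lt_def un0.
have K0 : 0 < L `^ (pm^-1) * lam `^ (r^-1 - 1) by rewrite mulr_gt0 ?powR_gt0.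
have -> : (u / (L `^ (pm^-1) * lam `^ (r^-1 - 1))) `^ (r * q) =
   (L `^ (- (r * q / pm))) * (u `^ q * (u * lam) `^ ((r - 1) * q)).
  rewrite gt0_powRE ?divr_gt0// ln_div ?posrE// lnM ?posrE ?powR_gt0// !ln_powR.
  rewrite !gt0_powRE ?mulr_gt0// lnM ?posrE// -!expRD; congr expR.
  by field; rewrite !gt_eqF.
have h1 : L `^ (- (r * q / pm)) <= L^-1.
  rewrite -[leRHS]powR_inv1 ?(ltW L0)//; apply: ler_powR => //.
  by rewrite lerN2 ler_pdivlMr// mul1r; nra.
apply: ler_pM => //; rewrite ?powR_ge0 ?mulr_ge0 ?powR_ge0//.
rewrite ler_wpM2l ?powR_ge0//.
have r10 : 0 <= (r - 1) * q by rewrite mulr_ge0//; lra.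
apply: (@le_trans _ _ (Num.max 1 (u * lam) `^ ((r - 1) * q))).
  have hm : 0 <= Num.max 1 (u * lam) by lra.
  have ul : 0 <= u * lam by rewrite mulr_ge0// ltW.
  by apply: ge0_ler_powR; rewrite ?nnegrE// le_max lexx orbT.
by apply: ler_powR => //; rewrite ler_wpM2l//; lra.
Qed.

Lemma layer_bound (V theta : R) : 0 <= V -> 0 <= theta -> theta <= 1 ->
  lh_T < V -> exists i : nat, lh_T * lh_S ^+ i < V /\
    V `^ theta <= lh_T * lh_S * (lh_S `^ theta) ^+ i.
Proof.
move=> V0 t0 t1 TV; have T1 := lh_T_ge1; have S1 := lh_S_gt1.
have T0 : 0 < lh_T by lra.
have S0 : 0 < lh_S by lra.
have Vp : 0 < V by lra.
have ex : exists j, V <= lh_T * lh_S ^+ j.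
  have lnS : 0 < ln lh_S by rewrite ln_gt0.
  exists (Num.truncn (ln (V / lh_T) / ln lh_S)).+1.
  rewrite -ler_pdivrMl// mulrC -ler_ln ?posrE ?divr_gt0 ?exprn_gt0// lnXn//.
  rewrite -[leRHS]mulr_natl -ler_pdivrMr//.
  by apply: ltW; exact: truncnS_gt.
have [[|i] Vj jmin] := ex_minnP ex.
  by move: Vj; rewrite expr0 mulr1; lra.
exists i; split.
  by rewrite ltNge; apply/negP => /jmin; rewrite ltnn.
apply: (@le_trans _ _ ((lh_T * lh_S ^+ i.+1) `^ theta)).
  by apply: ge0_ler_powR; rewrite ?nnegrE// mulr_ge0 ?exprn_ge0// ltW.
rewrite exprSr powRM ?mulr_ge0 ?exprn_ge0 ?(ltW T0) ?(ltW S0)//.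
rewrite powRM ?exprn_ge0 ?(ltW S0)//.
have h1 : lh_T `^ theta <= lh_T.
  by rewrite -[leRHS]powRr1 ?(ltW T0)//; exact: ler_powR.
have h2 : lh_S `^ theta <= lh_S.
  by rewrite -[leRHS]powRr1 ?(ltW S0)//; apply: ler_powR => //; exact: ltW.
have -> : (lh_S ^+ i) `^ theta = (lh_S `^ theta) ^+ i.
  by rewrite -powR_mulrn ?(ltW S0)// -powRrM mulrC powRrM powR_mulrn ?powR_ge0.
rewrite -[leRHS]mulrA; apply: ler_pM => //; rewrite ?mulr_ge0 ?exprn_ge0 ?powR_ge0//.
by rewrite mulrC ler_wpM2r// exprn_ge0// powR_ge0.
Qed.

End reverse_holder.

Section reverse_holder.
Context {R : realType} {n : nat}.
Notation T := (lebRn R n).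
Notation mu := (@lebesgue_rV R n).
Context (pm pinf C0 Ci : R) (p : 'rV[R]_n -> R).
Hypothesis Hp : lh_exponent pm pinf C0 Ci p.
Notation pp := (lh_max pinf Ci).
Notation eps := (lh_eps pm pinf Ci).
Notation CJ := (@lh_CJ R n pm pinf C0 Ci).
Notation modular_p := (modular mu p).
Notation rate := (@lh_rate R n pm pinf C0 Ci).
Notation level_cond := (level_cond p).
Notation alpha := (2 ^- n.+1 : R).
Notation lT := (@lh_T R n pm pinf C0 Ci).
Notation lS := (@lh_S R n pm pinf Ci).
Notation Lam := (@lh_Lam R n pm pinf C0 Ci).

Let mp : measurable_fun [set: T] (p : T -> R) := lh_meas Hp.
Let pp0 := lh_max_gt0 Hp.
Let eps0 := lh_eps_gt0 Hp.
Let p_ge : forall x : T, pm <= p x := lh_ge Hp.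
Let p_le : forall x : T, p x <= pp := lh_le Hp.

Lemma lh_powS_rate theta gam : 0 < gam -> gam <= 1 ->
  theta * ln lS <= rate gam / 4 -> lS `^ theta * (1 - rate gam) <= 1 - rate gam / 2.
Proof.
move=> g0 g1 h; have [r0 r8] := lh_rate_bounds Hp g0 g1.
have S0 : 0 < lS by rewrite (lt_trans ltr01 (lh_S_gt1 Hp)).
rewrite gt0_powRE//.
have h1 : expR (theta * ln lS) <= expR (rate gam / 4) by rewrite ler_expR.
have h2 : expR (rate gam / 4) <= 1 + rate gam / 2.
  have h3 := expR_ge1Dx (- (rate gam / 4)).
  rewrite -[rate gam / 4]opprK expRN; apply: (@le_trans _ _ ((1 - rate gam / 4)^-1)).
    by rewrite lef_pV2 ?posrE ?expR_gt0//; lra.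
  by rewrite -[leLHS]mul1r ler_pdivrMr; [nra|lra].
have h4 : expR (theta * ln lS) <= 1 + rate gam / 2 by exact: le_trans h2.
have := ler_wpM2r (_ : 0 <= 1 - rate gam) h4; move=> /(_ ltac:(lra)); nra.
Qed.

(** Chebyshev's inequality applied to [lh_average]. *)
Lemma level_measure (Q : @dbox R n) (u : T -> R) (lam : R) i : 0 < side Q -> 0 < lam ->
  measurable_fun [set: T] u -> (forall x, 0 <= u x) ->
  (modular_p (bset Q) u <= 1)%E -> modular_p (bset Q) (fun=> lam^-1) = 1%E ->
  (mu (bset Q `\` [set x | u x * lam <= lT * lS ^+ i]%R) < (alpha ^+ i)%:E * mu (bset Q))%E.
Proof.
move=> l0 lam0 mu_ u0 u1 lam1; set D := _ `\` _.
have CJ1 := lh_CJ_ge1 Hp.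
have mQ := measurable_bset Q.
have mD : measurable D by apply: measurableD => //; exact: measurable_level.
have DQ : D `<=` bset Q by exact: subDsetl.
pose f : T -> R := fun x => u x * lam.
have mf : measurable_fun [set: T] f by exact: measurable_funM mu_ (measurable_cst _).
have f0 x : 0 <= f x by rewrite mulr_ge0// ltW.
have fl : (\int[mu]_(x in bset Q) ((f x / lam) `^ p x)%:E <= 1)%E.
  rewrite (eq_integral (fun x => (u x `^ p x)%:E))// => x _.
  by rewrite /f mulfK// gt_eqF.
have J := lh_average Hp l0 lam0 mf f0 lam1 fl.
have muQ : (mu (bset Q) = (side Q ^+ n)%:E)%E by rewrite mu_bset.
have q0 : 0 < side Q ^+ n by rewrite exprn_gt0.
have mfe : measurable_fun [set: T] (fun x => (f x `^ eps)%:E).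
  apply/measurable_EFinP; exact: measurable_powR_fun measurableT mf (measurable_cst _).
have J1 : (((2 * CJ) * (2 ^+ n.+1) ^+ i)%:E * mu D <= CJ%:E * mu (bset Q))%E.
  apply: le_trans J; rewrite -(lh_TS_powR Hp) -integral_cst_mu//.
  apply: (@le_trans _ _ (\int[mu]_(x in D) (f x `^ eps)%:E)%E).
    apply: ge0_le_integralT => [|||x|x [Qx /negP]].
    - exact: mD.
    - exact: measurable_cst.
    - exact: mfe.
    - by rewrite lee_fin powR_ge0.
    - rewrite -ltNge => /ltW h; rewrite lee_fin; apply: ge0_ler_powR; rewrite ?nnegrE//.
        exact: ltW.
      by rewrite mulr_ge0 ?exprn_ge0// ltW// ?(lt_le_trans ltr01 (lh_T_ge1 Hp))//
        (lt_trans ltr01 (lh_S_gt1 Hp)).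
  by apply: (ge0_subset_integralT mu mD mQ mfe _ DQ) => x; rewrite lee_fin powR_ge0.
have Dfin : mu D \is a fin_num.
  by rewrite ge0_fin_numE// -(setIidr DQ); exact: mu_bset_setI_fin.
move: J1; rewrite muQ -(fineK Dfin) -!EFinM lee_fin lte_fin => J1.
have A0 : 0 < (2 ^+ n.+1) ^+ i :> R by rewrite !exprn_gt0.
rewrite exprVn mulrC ltr_pdivlMr//.
have : 2 * CJ * (fine (mu D) * (2 ^+ n.+1) ^+ i) <= CJ * side Q ^+ n by lra.
have CJq := mulr_gt0 (lt_le_trans ltr01 CJ1) q0.
have CJ2 : 0 < 2 * CJ by lra.
by rewrite -(ltr_pM2l CJ2); lra.
Qed.

(** On the layer where [u * lam] is between [T * S^i] and [T * S^i.+1], the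
    extra factor [(u * lam)^theta] is at most [T * S * (S^theta)^i], and [u^p]
    has modular at most [(1 - rate)^i] there; the condition on
    [theta = (r - 1) * pp] makes the product summable with ratio
    [1 - rate / 2].  [Lam] is an upper bound for the sum, and dividing [u] by
    [Lam^(1 / pm)] brings the modular down to [1]. *)
Lemma reverse_holder_modular gam (v : T -> R) (Q : @dbox R n) (a lam r : R) :
  0 < gam -> gam <= 1 -> measurable_fun [set: T] v -> (forall x, 0 <= v x) ->
  level_cond gam v -> 0 < side Q -> 0 < a -> 0 < lam ->
  modular_p (bset Q) (fun x => v x / a) = 1%E ->
  modular_p (bset Q) (fun=> lam^-1) = 1%E ->
  1 < r -> (r - 1) * pp <= 1 -> (r - 1) * pp * ln lS <= rate gam / 4 ->
  (\int[mu]_(x in bset Q)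
    ((v x / a / (Lam gam `^ (pm^-1) * lam `^ (r^-1 - 1))) `^ (r * p x))%:E <= 1)%E.
Proof.
move=> g0 g1 mv v0 hv l0 a0 lam0 va1 lam1 r1 th1 thS.
have [rt0 rt8] := lh_rate_bounds Hp g0 g1.
have T1 := lh_T_ge1 Hp; have S1 := lh_S_gt1 Hp.
have mQ := measurable_bset Q.
set u : T -> R := fun x => v x / a.
have mu_ : measurable_fun [set: T] u by exact: measurable_funM mv (measurable_cst _).
have u0 x : 0 <= u x by rewrite divr_ge0// ltW.
have hu : level_cond gam u by exact: level_condZ.
have u1 : (modular_p (bset Q) u <= 1)%E by rewrite va1.
set theta := (r - 1) * pp in th1 thS.
have th0 : 0 <= theta by rewrite mulr_ge0 ?(ltW pp0)//; lra.
set sq := lS `^ theta.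
have sq0 : 0 <= sq by exact: powR_ge0.
pose D i := bset Q `\` [set x | u x * lam <= lT * lS ^+ i].
have mD i : measurable (D i) by apply: measurableD => //; exact: measurable_level.
have DQ i : D i `<=` bset Q by exact: subDsetl.
have decay i : (modular_p (D i) u <= ((1 - rate gam) ^+ i)%:E)%E.
  apply: (level_decay Hp g0 g1 mu_ u0 hu l0 u1 (mD i) (DQ i)).
  exact: (level_measure i l0 lam0 mu_ u0 u1 lam1).
pose term i (x : T) : R := lT * lS * sq ^+ i * (u x `^ p x * \1_(D i) x).
have c0 i : 0 <= lT * lS * sq ^+ i.
  by rewrite mulr_ge0 ?exprn_ge0// mulr_ge0//; lra.
have term0 i x : (0 <= (term i x)%:E)%E.
  by rewrite lee_fin mulr_ge0// mulr_ge0// powR_ge0.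
have mup : measurable_fun [set: T] (fun x => u x `^ p x).
  exact: measurable_powR_fun measurableT mu_ mp.
have mtp i : measurable_fun [set: T] (fun x => u x `^ p x * \1_(D i) x).
  exact: measurable_funM mup (measurable_indic (mD i)).
have mterm i : measurable_fun [set: T] (fun x => (term i x)%:E).
  by apply/measurable_EFinP; exact: measurable_funM (measurable_cst _) (mtp i).
(* [w] majorizes the part of the integrand above the level [T]. *)
pose w (x : T) : \bar R := (\sum_(i <oo) (term i x)%:E)%E.
have w0 x : (0 <= w x)%E by apply: nneseries_ge0 => i _ _.
have mw : measurable_fun [set: T] w.
  by apply: ge0_emeasurable_sum => [i x _ _|i _]; [exact: term0|exact: mterm].
have intw : (\int[mu]_(x in bset Q) w x <= (lT * lS * (2 / rate gam))%:E)%E.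
  rewrite integral_nneseries; [|exact: mQ|by move=> i; exact: measurable_funTS|by move=> i x _; exact: term0].
  apply: (@le_trans _ _ (\sum_(i <oo) (lT * lS * (sq * (1 - rate gam)) ^+ i)%:E)%E).
    apply: lee_nneseries => [i _ _|i _]; first exact: integral_ge0.
    rewrite exprMn mulrA EFinM.
    apply: (@le_trans _ _ ((lT * lS * sq ^+ i)%:E * modular_p (D i) u)%E); last first.
      by apply: lee_wpmul2l; [rewrite lee_fin|exact: decay].
    rewrite (integral_support mu (DQ i)); last first.
      by move=> x _ nD; rewrite /term indicE memNset// !mulr0.
    rewrite -(ge0_integralZlT mu (mD i) (measurable_modular mp mu_) _ (c0 i)); last first.
      by move=> x; rewrite lee_fin powR_ge0.
    rewrite (eq_integral (fun x => (lT * lS * sq ^+ i)%:E * (u x `^ p x)%:E)%E)// => x.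
    by rewrite inE => Dx; rewrite /term indicE mem_set// mulr1 EFinM.
  have sr := lh_powS_rate g0 g1 thS; rewrite -/sq in sr.
  have sr0 : 0 <= sq * (1 - rate gam) by rewrite mulr_ge0//; lra.
  apply: (le_trans (geometric_nneseries_le _ sr0 _)).
  - by rewrite mulr_ge0//; lra.
  - by lra.
  - rewrite lee_fin ler_wpM2l//; first by rewrite mulr_ge0//; lra.
    rewrite -[2 / rate gam]invf_div lef_pV2 ?posrE; lra.
have L0 : 1 <= Lam gam.
  have h : 0 <= 2 / rate gam by rewrite divr_ge0// ltW.
  have h' : 1 <= lT * lS by nra.
  by rewrite /lh_Lam; nra.
have Lp : 0 < Lam gam by lra.
apply: (@le_trans _ _ (0%:E * mu (bset Q) + ((Lam gam)^-1 * lT)%:E * modular_p (bset Q) u +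
   ((Lam gam)^-1)%:E * \int[mu]_(x in bset Q) w x)%E); last first.
  rewrite va1 mul0e add0e mule1.
  apply: (@le_trans _ _ (((Lam gam)^-1 * lT)%:E + ((Lam gam)^-1)%:E * (lT * lS * (2 / rate gam))%:E)%E).
    by rewrite leeD2l//; apply: lee_wpmul2l => //; rewrite lee_fin invr_ge0 ltW.
  rewrite -EFinM -EFinD lee_fin -mulrDr mulrC ler_pdivrMr// mul1r /lh_Lam.
  by nra.
have mK : measurable_fun [set: T] (fun x =>
    (v x / a / (Lam gam `^ (pm^-1) * lam `^ (r^-1 - 1))) `^ (r * p x)).
  exact: (measurable_powR_fun measurableT (measurable_funM mu_ (measurable_cst _))
    (measurable_funM (measurable_cst _) mp)).
apply: (le_integral_affine mu mQ mK mup mw) => //.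
- by move=> x; exact: powR_ge0.
- by move=> x; exact: powR_ge0.
- by rewrite mulr_ge0 ?invr_ge0//; lra.
- by rewrite invr_ge0 ltW.
move=> x Qx; rewrite add0r.
have h := rescaled_integrand_le Hp (u0 x) lam0 (p_ge x) (p_le x) r1 L0.
apply: (@le_trans _ _ (((Lam gam)^-1 * (u x `^ p x * Num.max 1 (u x * lam) `^ theta))%:E)).
  by rewrite lee_fin.
have ul0 : 0 <= u x * lam by rewrite mulr_ge0// ltW.
have Li0 : 0 <= (Lam gam)^-1 by rewrite invr_ge0 ltW.
have [small|big] := leP (u x * lam) lT.
  apply: (@le_trans _ _ (((Lam gam)^-1 * lT * u x `^ p x)%:E)); last first.
    by rewrite leeDl//; apply: mule_ge0.
  rewrite lee_fin -mulrA ler_wpM2l// mulrC ler_wpM2r ?powR_ge0//.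
  have m1 : 1 <= Num.max 1 (u x * lam) by rewrite le_max lexx.
  apply: (@le_trans _ _ (Num.max 1 (u x * lam))).
    by rewrite -[leRHS]powRr1 ?(le_trans ler01 m1)//; exact: ler_powR.
  by rewrite ge_max T1.
have [i [iV Vi]] := layer_bound Hp ul0 th0 th1 big.
have mE : Num.max 1 (u x * lam) = u x * lam by rewrite max_r//; lra.
rewrite mE.
apply: (@le_trans _ _ (((Lam gam)^-1)%:E * (term i x)%:E)%E).
  rewrite -EFinM lee_fin ler_wpM2l// /term indicE mem_set; last first.
    by split=> //=; apply/negP; rewrite -ltNge.
  by rewrite mulr1 mulrC ler_wpM2r ?powR_ge0.
apply: (@le_trans _ _ (((Lam gam)^-1)%:E * w x)%E).
  apply: lee_wpmul2l => //.
  have := @nneseries_lim_ge R (fun i => (term i x)%:E) xpredT 0%N i.+1.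
  move=> /(_ (fun k _ _ => term0 k x)); apply: le_trans.
  by rewrite big_nat_recr//= leeDr//; apply: sume_ge0 => k _; exact: term0.
rewrite leeDr// lee_fin !mulr_ge0 ?powR_ge0//; lra.
Qed.

End reverse_holder.

(** * The operator norm *)

Section operator_norm.
Context {R : realType} {m : nat}.
Notation C := R[i].
Implicit Types (A B : 'M[C]_m) (z : 'cV[C]_m).

Lemma Re_addc (x y : C) : complex.Re (x + y) = complex.Re x + complex.Re y.
Proof. by case: x; case: y. Qed.

Lemma Im_addc (x y : C) : complex.Im (x + y) = complex.Im x + complex.Im y.
Proof. by case: x; case: y. Qed.

Lemma Re_mulc (x y : C) :
  complex.Re (x * y) = complex.Re x * complex.Re y - complex.Im x * complex.Im y.
Proof. by case: x; case: y. Qed.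

Lemma Im_mulc (x y : C) :
  complex.Im (x * y) = complex.Re x * complex.Im y + complex.Im x * complex.Re y.
Proof. by case: x; case: y. Qed.

Lemma Re_sumc I (s : seq I) (f : I -> C) :
  complex.Re (\sum_(i <- s) f i) = \sum_(i <- s) complex.Re (f i).
Proof. by apply: (big_morph _ Re_addc). Qed.

Lemma Im_sumc I (s : seq I) (f : I -> C) :
  complex.Im (\sum_(i <- s) f i) = \sum_(i <- s) complex.Im (f i).
Proof. by apply: (big_morph _ Im_addc). Qed.

Lemma normc_ge0 (x : C) : 0 <= Normc.normc x.
Proof. by case: x => a b; exact: sqrtr_ge0. Qed.

Lemma normc_sqr (x : C) : Normc.normc x ^+ 2 = complex.Re x ^+ 2 + complex.Im x ^+ 2.
Proof. by case: x => a b /=; rewrite sqr_sqrtr// addr_ge0 ?sqr_ge0. Qed.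

Lemma normc_sum I (s : seq I) (f : I -> C) :
  Normc.normc (\sum_(i <- s) f i) <= \sum_(i <- s) Normc.normc (f i).
Proof.
elim/big_ind2: _ => //; first by rewrite Normc.normc0.
move=> x1 x2 y1 y2 h1 h2; apply: le_trans (lerD h1 h2); exact: le_normcD.
Qed.

Definition cvsqr z : R := \sum_i (complex.Re (z i 0) ^+ 2 + complex.Im (z i 0) ^+ 2).

Lemma cvnormE z : cvnorm z = Num.sqrt (cvsqr z).
Proof. by rewrite /cvnorm; congr Num.sqrt; apply: eq_bigr => i _; exact: normc_sqr. Qed.

Lemma cvsqr_ge0 z : 0 <= cvsqr z.
Proof. by apply: sumr_ge0 => i _; rewrite addr_ge0 ?sqr_ge0. Qed.

Lemma cvnorm_ge0 z : 0 <= cvnorm z.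
Proof. exact: sqrtr_ge0. Qed.

Lemma cvnorm_sqr z : cvnorm z ^+ 2 = cvsqr z.
Proof. by rewrite cvnormE sqr_sqrtr// cvsqr_ge0. Qed.

Lemma normc_le_cvnorm z i : Normc.normc (z i 0) <= cvnorm z.
Proof.
rewrite -(@ger0_norm _ (Normc.normc _)) ?normc_ge0// -sqrtr_sqr /cvnorm ler_wsqrtr//.
by rewrite (bigD1 i)//= lerDl; apply: sumr_ge0 => j _; exact: sqr_ge0.
Qed.

Lemma cvnorm_eq0 z : cvnorm z = 0 -> z = 0.
Proof.
move=> z0; apply/matrixP => i j; rewrite ord1 mxE; apply: Normc.eq0_normc.
by apply/eqP; rewrite eq_le normc_ge0 andbT -z0 normc_le_cvnorm.
Qed.

Lemma cvnormZ (k : C) z : cvnorm (k *: z) = Normc.normc k * cvnorm z.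
Proof.
rewrite /cvnorm -[Normc.normc k]ger0_norm ?normc_ge0// -sqrtr_sqr -sqrtrM ?sqr_ge0//.
congr Num.sqrt; rewrite mulr_sumr; apply: eq_bigr => i _.
by rewrite mxE Normc.normcM exprMn.
Qed.

Lemma cvnorm0 : cvnorm (0 : 'cV[C]_m) = 0.
Proof. by rewrite -(scale0r (0 : 'cV[C]_m)) cvnormZ Normc.normc0 mul0r. Qed.

Lemma opnorm_has_ubound A :
  has_ubound [set cvnorm (A *m z) | z in [set z | cvnorm z = 1]].
Proof.
exists (Num.sqrt (\sum_i (\sum_j Normc.normc (A i j)) ^+ 2)) => _ [z /= z1 <-].
rewrite /cvnorm ler_wsqrtr//; apply: ler_sum => i _.
apply: lerXn2r; rewrite ?nnegrE ?normc_ge0//.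
  by apply: sumr_ge0 => j _; exact: normc_ge0.
rewrite mxE; apply: (le_trans (normc_sum _ _)); apply: ler_sum => j _.
rewrite Normc.normcM ler_piMr ?normc_ge0//.
by rewrite -z1 normc_le_cvnorm.
Qed.

Lemma cvnorm_mulmx A z : cvnorm (A *m z) <= opnorm A * cvnorm z.
Proof.
have [z0|z0] := eqVneq (cvnorm z) 0.
  by rewrite (cvnorm_eq0 z0) mulmx0 cvnorm0 mulr0.
have zp : 0 < cvnorm z by rewrite lt_def z0 cvnorm_ge0.
rewrite -ler_pdivrMr//.
have nk : Normc.normc ((cvnorm z)^-1)%:C%C = (cvnorm z)^-1.
  by rewrite /= expr0n/= addr0 sqrtr_sqr ger0_norm// invr_ge0 ltW.
have -> : cvnorm (A *m z) / cvnorm z = cvnorm (A *m (((cvnorm z)^-1)%:C%C *: z)).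
  by rewrite -scalemxAr cvnormZ nk mulrC.
apply: ub_le_sup; first exact: opnorm_has_ubound.
by exists (((cvnorm z)^-1)%:C%C *: z) => //=; rewrite cvnormZ nk mulVf.
Qed.

Hypothesis m_gt0 : (0 < m)%N.

Lemma unit_sphere_neq0 : exists z : 'cV[C]_m, cvnorm z = 1.
Proof.
exists (\col_i (if i == Ordinal m_gt0 then 1 else 0)).
rewrite cvnormE /cvsqr (bigD1 (Ordinal m_gt0))//= mxE eqxx/= big1.
  by rewrite addr0 expr1n expr0n addr0 sqrtr1.
by move=> i i0; rewrite mxE (negbTE i0)/= expr0n addr0.
Qed.

Lemma opnorm_leP A (c : R) : 0 <= c ->
  opnorm A <= c <-> forall z, cvnorm (A *m z) <= c * cvnorm z.
Proof.
move=> c0; split=> [Ac z|h].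
  by apply: (le_trans (cvnorm_mulmx A z)); rewrite ler_wpM2r// cvnorm_ge0.
apply: sup_le_ub.
  by have [z z1] := unit_sphere_neq0; exists (cvnorm (A *m z)); exists z.
by move=> _ [z /= z1 <-]; have := h z; rewrite z1 mulr1.
Qed.

Lemma opnorm_ge0 A : 0 <= opnorm A.
Proof.
have [z z1] := unit_sphere_neq0.
by have := cvnorm_mulmx A z; rewrite z1 mulr1; apply: le_trans; exact: cvnorm_ge0.
Qed.

Lemma opnormM A B : opnorm (A *m B) <= opnorm A * opnorm B.
Proof.
apply/opnorm_leP => [|z]; first by rewrite mulr_ge0 ?opnorm_ge0.
rewrite -mulmxA; apply: (le_trans (cvnorm_mulmx _ _)).
by rewrite -mulrA ler_wpM2l ?opnorm_ge0// cvnorm_mulmx.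
Qed.

Lemma opnorm_eq0 A : opnorm A = 0 -> A = 0.
Proof.
move=> A0; apply/matrixP => i j.
have := cvnorm_mulmx A (\col_k (if k == j then 1 else 0)); rewrite A0 mul0r => h.
have := @cvnorm_eq0 (A *m \col_k (if k == j then 1 else 0)) => /(_ _) h'.
have {}h' : A *m \col_k (if k == j then 1 else 0) = 0.
  by apply: h'; apply/eqP; rewrite eq_le h cvnorm_ge0.
move/matrixP: h' => /(_ i 0); rewrite !mxE (bigD1 j)//= mxE eqxx mulr1 big1 ?addr0//.
by move=> k kj; rewrite mxE (negbTE kj) mulr0.
Qed.

Lemma opnorm0 : opnorm (0 : 'M[C]_m) = 0.
Proof.
apply/eqP; rewrite eq_le opnorm_ge0 andbT; apply/opnorm_leP => // z.
by rewrite mul0mx cvnorm0 mul0r.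
Qed.

(** A complex vector as a real vector of twice the dimension, real parts
    first.  The operator norm is a supremum over an uncountable sphere; its
    measurability is obtained by restricting to rational vectors. *)
Definition cvec (y : 'rV[R]_(m + m)) : 'cV[C]_m :=
  \col_i (y 0 (lshift m i) +i* y 0 (rshift m i))%C.

Lemma cvec_surj z : exists y, z = cvec y.
Proof.
exists (row_mx (\row_i complex.Re (z i 0)) (\row_i complex.Im (z i 0))).
apply/matrixP => i j; rewrite ord1 mxE row_mxEl row_mxEr !mxE.
by case: (z i 0).
Qed.

Lemma ReE_mulmx A (y : 'rV[R]_(m + m)) i : complex.Re ((A *m cvec y) i 0) =
  \sum_j (complex.Re (A i j) * y 0 (lshift m j) - complex.Im (A i j) * y 0 (rshift m j)).
Proof. by rewrite mxE Re_sumc; apply: eq_bigr => j _; rewrite Re_mulc mxE. Qed.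

Lemma ImE_mulmx A (y : 'rV[R]_(m + m)) i : complex.Im ((A *m cvec y) i 0) =
  \sum_j (complex.Re (A i j) * y 0 (rshift m j) + complex.Im (A i j) * y 0 (lshift m j)).
Proof. by rewrite mxE Im_sumc; apply: eq_bigr => j _; rewrite Im_mulc mxE. Qed.

Lemma sum_continuous k (I : Type) (s : seq I) (f : I -> 'rV[R]_k -> R) :
  (forall i, continuous (f i)) -> continuous (fun y => \sum_(i <- s) f i y).
Proof.
move=> cf; elim: s => [|i s IH].
  by under eq_fun do rewrite big_nil; exact: cst_continuous.
under eq_fun do rewrite big_cons.
by move=> y; apply: (@continuousD _ _ _ (f i) (fun y => \sum_(j <- s) f j y)); [exact: cf|exact: IH].
Qed.

Lemma cvsqr_mulmx_continuous A : continuous (fun y => cvsqr (A *m cvec y)).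
Proof.
have cc (j : 'I_(m + m)) : continuous (fun y : 'rV[R]_(m + m) => y 0 j).
  exact: coord_continuous.
have cl (a b : R) (j k : 'I_(m + m)) : continuous (fun y : 'rV[R]_(m + m) => a * y 0 j + b * y 0 k).
  move=> y; apply: (@continuousD _ _ _ (fun y : 'rV[R]_(m + m) => a * y 0 j) (fun y => b * y 0 k)).
    apply: (@continuousM _ _ (fun=> a) (fun y : 'rV[R]_(m + m) => y 0 j)); [exact: cst_continuous|exact: cc].
  apply: (@continuousM _ _ (fun=> b) (fun y : 'rV[R]_(m + m) => y 0 k)); [exact: cst_continuous|exact: cc].
have csq (f : 'rV[R]_(m + m) -> R) : continuous f -> continuous (fun y => f y ^+ 2).
  move=> cf y; under eq_fun do rewrite expr2.
  by apply: (@continuousM _ _ f f); exact: cf.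
apply: sum_continuous => i y.
apply: (@continuousD _ _ _ (fun y => complex.Re ((A *m cvec y) i 0) ^+ 2)
  (fun y => complex.Im ((A *m cvec y) i 0) ^+ 2)); apply: csq => {}y.
  under eq_fun do rewrite ReE_mulmx.
  move: y; apply: sum_continuous => j; under eq_fun do rewrite -mulNr; exact: cl.
under eq_fun do rewrite ImE_mulmx.
move: y; apply: sum_continuous => j; exact: cl.
Qed.

Definition ratvec (q : 'rV[rat]_(m + m)) : 'cV[C]_m := cvec (\row_j ratr (q 0 j)).

(** A strict violation [c * |z| < |A z|] is an open condition on [z], so it
    occurs at a rational vector too. *)
Lemma opnorm_le_ratvec A (c : R) : 0 <= c ->
  opnorm A <= c <-> forall q, cvsqr (A *m ratvec q) <= c ^+ 2 * cvsqr (ratvec q).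
Proof.
move=> c0; split=> [/(opnorm_leP _ c0) h q|h].
  by rewrite -!cvnorm_sqr -exprMn lerXn2r ?nnegrE ?mulr_ge0 ?cvnorm_ge0.
apply/opnorm_leP => // z; have [y ->] := cvec_surj z.
suff : cvsqr (A *m cvec y) <= c ^+ 2 * cvsqr (cvec y).
  rewrite -!cvnorm_sqr -exprMn => h'.
  by rewrite -(@ler_pXn2r _ 2)// nnegrE ?mulr_ge0 ?cvnorm_ge0.
rewrite leNgt; apply/negP => hy.
pose F (y : 'rV[R]_(m + m)) := cvsqr (A *m cvec y) - c ^+ 2 * cvsqr (1%:M *m cvec y).
have cF : continuous F.
  move=> u; apply: (@continuousB _ _ _ (fun y => cvsqr (A *m cvec y))
    (fun y => c ^+ 2 * cvsqr (1%:M *m cvec y))).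
    exact: cvsqr_mulmx_continuous.
  apply: (@continuousM _ _ (fun=> c ^+ 2) (fun y => cvsqr (1%:M *m cvec y))).
    exact: cst_continuous.
  exact: cvsqr_mulmx_continuous.
have Fy : 0 < F y by rewrite /F mul1mx subr_gt0.
have : nbhs y [set u | 0 < F u].
  by apply: (cF y [set t | 0 < t]); apply: open_nbhs_nbhs; split=> //; exact: open_gt.
move=> /nbhs_ballP[e /= e0 he].
have /choice[q hq] : forall j : 'I_(m + m), exists q : rat, `|y 0 j - ratr q| < e.
  move=> j; have /rat_in_itvoo[q] : y 0 j - e < y 0 j + e by lra.
  by rewrite in_itv/= => hq; exists q; rewrite ltr_norml; lra.
have : F (\row_j ratr (q j)) > 0.
  by apply: he; split=> // i j; rewrite mxE ord1; exact: hq.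
rewrite /F mul1mx subr_gt0 ltNge; apply/negP; rewrite negbK.
by have := h (\row_j q j); rewrite /ratvec; under eq_mx do rewrite mxE.
Qed.

End operator_norm.

Section measurable_opnorm.
Context d {T : measurableType d} {R : realType} {m : nat}.
Hypothesis m_gt0 : (0 < m)%N.

Lemma measurable_opnorm (F : T -> 'M[R[i]]_m) :
  (forall i j, measurable_fun [set: T] (fun x => complex.Re (F x i j)) /\
     measurable_fun [set: T] (fun x => complex.Im (F x i j))) ->
  measurable_fun [set: T] (fun x => opnorm (F x)).
Proof.
move=> mF.
have mle (c : R) : measurable [set x | opnorm (F x) <= c].
  have [c0|c0] := ltP c 0.
    rewrite (_ : [set x | _] = set0)//; apply/seteqP; split=> // x /=.
    by rewrite leNgt (lt_le_trans c0 (opnorm_ge0 m_gt0 _)).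
  pose S (q : 'rV[rat]_(m + m)) :=
    [set x | cvsqr (F x *m ratvec q) <= c ^+ 2 * cvsqr (@ratvec R m q)].
  rewrite (_ : [set x | _] = \bigcap_k (if unpickle k is Some q then S q else setT)).
    apply: bigcapT_measurable => k; case: (unpickle k) => // q.
    have mg : measurable_fun [set: T] (fun x => cvsqr (F x *m @ratvec R m q)).
      apply: measurable_sum => i; apply: measurable_funD; apply: measurable_funX.
        under eq_fun do rewrite ReE_mulmx.
        apply: measurable_sum => j; apply: measurable_funB; apply: measurable_funM => //; by case: (mF i j).
      under eq_fun do rewrite ImE_mulmx.
      apply: measurable_sum => j; apply: measurable_funD; apply: measurable_funM => //; by case: (mF i j).
    rewrite (_ : S q = setT `&` (fun x => cvsqr (F x *m @ratvec R m q)) @^-1`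
        `]-oo, c ^+ 2 * cvsqr (@ratvec R m q)]).
      by apply: mg => //; exact: measurable_itv.
    by rewrite setTI; apply/seteqP; split=> x /=; rewrite in_itv.
  apply/seteqP; split=> x /=.
    by move=> /(opnorm_le_ratvec m_gt0 _ c0) h k _; case: (unpickle k).
  move=> h; apply/(opnorm_le_ratvec m_gt0 _ c0) => q.
  by have := h (pickle q) I; rewrite pickleK.
apply: (measurability (@RGenOInfty.G R)); first exact: RGenOInfty.measurableE.
move=> _ [_ [c ->] <-]; rewrite setTI.
rewrite (_ : _ @^-1` _ = ~` [set x | opnorm (F x) <= c]); first exact: measurableC.
by apply/seteqP; split=> x /=; rewrite in_itv/= andbT ltNge => /negP.
Qed.

End measurable_opnorm.

(** * The Luxemburg norm *)

Section le_integral.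
Context d {T : measurableType d} {R : realType}.
Variable mu : {measure set T -> \bar R}.
Local Open Scope ereal_scope.

(** No measurability is required: the integral is a difference of suprema
    over simple functions, each monotone.  The integrand of the
    [A_{p,infty}] constant is not known to be measurable in advance. *)
Lemma le_integral_any (D : set T) (f g : T -> \bar R) :
  (forall x, D x -> f x <= g x) -> \int[mu]_(x in D) f x <= \int[mu]_(x in D) g x.
Proof.
move=> fg; have fgD x : (f \_ D) x <= (g \_ D) x.
  by rewrite /patch; case: ifPn => //; rewrite inE; exact: fg.
rewrite /integral; apply: leeB; apply: le_ereal_sup => _ [h hf <-]; exists h => // x;
  apply: le_trans (hf x) _.
- by rewrite !funeposE ge_max !le_max fgD lexx orbT.
- by rewrite !funenegE ge_max !le_max leeN2 fgD lexx orbT.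
Qed.

End le_integral.

Section luxemburg.
Context d {T : measurableType d} {R : realType}.
Variable mu : {measure set T -> \bar R}.

(** [Lpx_norm] over an abstract measure space. *)
Definition luxemburg (q f : T -> R) : \bar R :=
  ereal_inf [set l%:E | l in
    [set l : R | 0 < l /\ (\int[mu]_x (`|f x / l| `^ q x)%:E <= 1)%E]].

Context (q : T -> R) (qm qp : R).
Hypotheses (mq : measurable_fun [set: T] q) (qm0 : 0 < qm) (qp0 : 0 < qp).
Hypotheses (q_ge : forall x : T, qm <= q x) (q_le : forall x : T, q x <= qp).
Notation modular_q := (modular mu q).

Lemma luxemburg_modularE (Q : set T) (f : T -> R) (l : R) : (forall x, 0 <= f x) -> 0 < l ->
  (\int[mu]_x (`|f x * \1_Q x / l| `^ q x)%:E = modular_q Q (fun x => f x / l)%R)%E.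
Proof.
move=> f0 l0.
have QT : Q `<=` setT by [].
rewrite (integral_support mu QT); last first.
  move=> x _ nQ; rewrite indicE memNset// mulr0 mul0r normr0 powR0//.
  by rewrite gt_eqF// (lt_le_trans qm0).
apply: eq_integral => x; rewrite inE => Qx; rewrite indicE mem_set// mulr1 ger0_norm//.
by rewrite divr_ge0// ltW.
Qed.

Lemma luxemburgE (Q : set T) (f : T -> R) : (forall x, 0 <= f x) ->
  luxemburg q (fun x => f x * \1_Q x) =
  ereal_inf [set l%:E | l in [set l : R | 0 < l /\
    (modular_q Q (fun x => f x / l)%R <= 1)%E]].
Proof.
move=> f0; rewrite /luxemburg.
apply: (congr1 (fun S => ereal_inf S)); apply/seteqP; split=> _ [l [l0 h] <-].
  exists l; last exact: erefl.
  by split; [exact: l0|rewrite -(luxemburg_modularE Q f0 l0); exact: h].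
exists l; last exact: erefl.
by split; [exact: l0|move: h; rewrite -(luxemburg_modularE Q f0 l0); exact].
Qed.

Lemma luxemburg_le (Q : set T) (f : T -> R) (c : R) : (forall x, 0 <= f x) -> 0 < c ->
  (modular_q Q (fun x => f x / c)%R <= 1)%E ->
  (luxemburg q (fun x => f x * \1_Q x)%R <= c%:E)%E.
Proof.
by move=> f0 c0 h; rewrite luxemburgE//; apply: ereal_inf_lbound; exists c.
Qed.

Lemma luxemburg_ge0 (f : T -> R) : (0 <= luxemburg q f)%E.
Proof. by apply: le_ereal_inf_tmp => _ [l [l0 _] <-]; rewrite lee_fin ltW. Qed.

Lemma luxemburg_unit (Q : set T) (f : T -> R) (a : R) : measurable Q ->
  measurable_fun [set: T] f -> (forall x, 0 <= f x) -> 0 < a ->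
  modular_q Q (fun x => f x / a) = 1%E -> luxemburg q (fun x => f x * \1_Q x) = a%:E.
Proof.
move=> mQ mf f0 a0 h; apply/eqP; rewrite eq_le luxemburg_le//=; last by rewrite h.
rewrite luxemburgE//; apply: le_ereal_inf_tmp => _ [l [l0 hl] <-].
rewrite lee_fin leNgt; apply/negP => la.
have t1 : 1 < a / l by rewrite ltr_pdivlMr// mul1r.
have mfl : measurable_fun [set: T] (fun x => f x / l).
  exact: measurable_funM mf (measurable_cst _).
have fl0 x : 0 <= f x / l by rewrite divr_ge0// ltW.
have := modular_div_le mu mq q_ge mQ mfl fl0 (ltW t1).
rewrite (_ : (fun x => _) = (fun x => f x / a)); last first.
  by apply/funext => x; field; rewrite !gt_eqF.
rewrite h => h1.
have h2 : (1 <= ((a / l) `^ (- qm))%:E * 1 :> \bar R)%E.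
  by apply: (le_trans h1); apply: lee_wpmul2l => //; rewrite lee_fin powR_ge0.
move: h2; rewrite mule1 lee_fin leNgt => /negP; apply.
rewrite gt0_powRE ?(lt_trans ltr01 t1)// -expR0 ltr_expR mulNr oppr_lt0 mulr_gt0//.
by rewrite ln_gt0.
Qed.

Lemma luxemburg_infty (Q : set T) (f : T -> R) : measurable Q ->
  measurable_fun [set: T] f -> (forall x, 0 <= f x) -> modular_q Q f = +oo%E ->
  luxemburg q (fun x => f x * \1_Q x) = +oo%E.
Proof.
move=> mQ mf f0 h; rewrite luxemburgE//.
suff -> : [set l : R | 0 < l /\ (modular_q Q (fun x => f x / l)%R <= 1)%E] = set0.
  by rewrite image_set0 ereal_inf0.
apply/seteqP; split=> // l [l0 hl].
have m1 : 1 <= Num.max 1 l by rewrite le_max lexx.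
have h1 : (modular_q Q (fun x => f x / Num.max 1 l)%R <= 1)%E.
  apply: le_trans hl; apply: (modular_mono mu mq qm0 q_ge mQ mf f0 l0).
  by rewrite le_max lexx orbT.
have := modular_div_ge mu mq q_le mQ mf f0 m1; rewrite h leye_eq => /eqP h2.
have : ((Num.max 1 l `^ qp)%:E * modular_q Q (fun x => f x / Num.max 1 l)%R < +oo :> \bar R)%E.
  apply: (@le_lt_trans _ _ ((Num.max 1 l `^ qp)%:E * 1)%E).
    by apply: lee_wpmul2l => //; rewrite lee_fin powR_ge0.
  by rewrite mule1 ltry.
by rewrite h2.
Qed.

Lemma luxemburg_mono (Q : set T) (f g : T -> R) (c : R) : measurable Q ->
  measurable_fun [set: T] f -> measurable_fun [set: T] g ->
  (forall x, 0 <= f x) -> (forall x, 0 <= g x) -> 0 < c ->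
  (forall x, f x <= g x * c) ->
  ((c^-1)%:E * luxemburg q (fun x => f x * \1_Q x)%R <= luxemburg q (fun x => g x * \1_Q x)%R)%E.
Proof.
move=> mQ mf mg f0 g0 c0 fg; rewrite [leRHS]luxemburgE//.
apply: le_ereal_inf_tmp => _ [l [l0 hl] <-].
have cl0 : 0 < c * l by rewrite mulr_gt0.
have : (luxemburg q (fun x => f x * \1_Q x)%R <= (c * l)%:E)%E.
  apply: (luxemburg_le f0 cl0); apply: le_trans hl.
  rewrite -[leRHS]mul1e; apply: (le_modular mu mq mQ) => //.
  - exact: measurable_funM mf (measurable_cst _).
  - exact: measurable_funM mg (measurable_cst _).
  move=> x _; rewrite mul1r; apply: ge0_ler_powR.
  - by rewrite (le_trans (ltW qm0)).
  - by rewrite nnegrE divr_ge0// ltW.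
  - by rewrite nnegrE divr_ge0// ltW.
  - by rewrite ler_pdivrMr// mulrA mulrAC divfK ?gt_eqF.
rewrite EFinM => h; rewrite -[leRHS]mul1e.
have -> : (1%:E = (c^-1)%:E * c%:E :> \bar R)%E by rewrite -EFinM mulVf// gt_eqF.
by rewrite -muleA; apply: lee_wpmul2l => //; rewrite lee_fin invr_ge0 ltW.
Qed.

End luxemburg.

Lemma Lpx_normE (R : realType) n (q f : 'rV[R]_n -> R) :
  Lpx_norm q f = @luxemburg _ (lebRn R n) R (@lebesgue_rV R n) q f.
Proof. by []. Qed.

(** * The exponent is above its essential infimum everywhere *)

Section exponent_of_log_holder.
Context {R : realType} {n : nat}.
Notation T := (lebRn R n).
Notation mu := (@lebesgue_rV R n).

(** The lower bound holds almost everywhere, and [p] is continuous: if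
    [p x0 < pm], then [p < pm] on a small box at [x0]. *)
Lemma lh_exponent_of (pm pinf C0 Ci : R) (p : 'rV[R]_n -> R) : (0 < n)%N ->
  exponent0 (EFin \o p) -> ess_inf mu (EFin \o p) = pm%:E ->
  log_holder C0 pinf Ci p -> lh_exponent pm pinf C0 Ci p.
Proof.
move=> n0 [_ _ inf0] infE [mp [C00 pinf0 Ci0] loc dec].
have pm0 : 0 < pm by move: inf0; rewrite infE lte_fin.
split=> // x0; rewrite leNgt; apply/negP => lt.
pose dl := pm - p x0.
have dl0 : 0 < dl by rewrite subr_gt0.
pose d := Num.min 2^-1 (expR (- (C0 / dl))) / 2.
have m0 : 0 < Num.min 2^-1 (expR (- (C0 / dl))) by rewrite lt_min expR_gt0 invr_gt0 ltr0n.
have d0 : 0 < d by rewrite divr_gt0.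
have nn0 : 0 < n%:R :> R by rewrite ltr0n.
have d1 : d < 2^-1.
  have : Num.min 2^-1 (expR (- (C0 / dl))) <= 2^-1 by rewrite ge_min lexx.
  by rewrite /d; lra.
have d2 : d < expR (- (C0 / dl)).
  have : Num.min 2^-1 (expR (- (C0 / dl))) <= expR (- (C0 / dl)) by rewrite ge_min lexx orbT.
  by rewrite /d; lra.
pose P := DBox x0 (d / n%:R) (fun=> true) (fun=> true).
have l0 : 0 < side P by rewrite divr_gt0.
have Px0 : bset P x0.
  by move=> i /=; rewrite in_itv/= lexx ltrDl.
have small (x : T) : bset P x -> p x < pm.
  move=> Px; have ed : enorm ((x : 'rV_n) - x0) <= d.
    have := @enorm_le R n ((x : 'rV_n) - x0) _ (ltW l0) (fun i => bset_dist i Px Px0).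
    by rewrite /= mulrC divfK// gt_eqF.
  have := loc x x0 (le_lt_trans ed d1).
  suff : - (C0 / ln (enorm ((x : 'rV_n) - x0))) < dl.
    by have := ler_norm (p x - p x0); rewrite /dl; lra.
  have [e0|en0] := leP (enorm ((x : 'rV_n) - x0)) 0.
    by rewrite ln0// invr0 mulr0 oppr0.
  have lnd : ln (enorm ((x : 'rV_n) - x0)) < - (C0 / dl).
    by rewrite -[ltRHS]expRK ltr_ln ?posrE ?expR_gt0//; exact: le_lt_trans d2.
  have q0 : 0 < C0 / dl by rewrite divr_gt0.
  have lnn : 0 < - ln (enorm ((x : 'rV_n) - x0)) by lra.
  rewrite -mulrN -invrN ltr_pdivrMr// -ltr_pdivrMl// mulrC; lra.
have [N [mN N0 hN]] := ess_inf_le mu (EFin \o p).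
have PN : bset P `<=` N.
  move=> x Px; apply: hN => /=; rewrite infE lee_fin; apply/negP.
  by rewrite -ltNge small.
have : (mu (bset P) <= mu N)%E.
  by apply: le_measure; rewrite ?inE//; exact: measurable_bset.
by rewrite N0 mu_bset// lee_fin leNgt exprn_gt0.
Qed.

End exponent_of_log_holder.

(** * From the averaged logarithm to the level condition *)

Section averaged_log.
Context d {T : measurableType d} {R : realType}.
Variable mu : {measure set T -> \bar R}.

(** With [L] the average of [- ln V] over [D]: [L <= ln w] by the last
    hypothesis, while the average of the positive part of [ln V] is at most
    [CJ / e] since [e * ln V <= V^e].  So the negative part of [ln V] has average
    at most [CJ / e + ln w], and it is at least
    [4 * (CJ / e + 1 + ln w)] where [V <= gam].  The function [Phi] is arbitrary,
    possibly infinite or not measurable. *)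
Lemma averaged_log_level (D N : set T) (V : T -> R) (Phi : T -> \bar R)
    (e CJ M w : R) :
  measurable D -> mu D = M%:E -> 0 < M -> 0 < e -> 0 <= CJ ->
  measurable_fun [set: T] V -> (forall x, 0 <= V x) ->
  (\int[mu]_(x in D) (V x `^ e)%:E <= CJ%:E * mu D)%E ->
  measurable N -> mu N = 0%E ->
  (forall x, D x -> ~ N x -> 0 < V x /\ ((V x)^-1%:E <= Phi x)%E) ->
  (expeR ((mu D)^-1 * \int[mu]_(x in D) lne (Phi x)) <= w%:E)%E ->
  let gam := expR (- (4 * (CJ / e + 1))) * w `^ (- 4) in
  [/\ 0 < w, gam <= 1 & (4%:E * mu (D `&` [set x | V x <= gam]%R) <= mu D)%E].
Proof.
move=> mD muD M0 e0 CJ0 mV V0 VJ mN N0 hPhi hw gam.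
have mDN : measurable (D `\` N) by exact: measurableD.
(* On the null set [N] nothing is known of [Phi], hence the value [-oo]. *)
pose G (y : T) : \bar R := if y \in N then -oo%E else (- ln (V y))%:E.
have mL : measurable_fun [set: T] (fun y => - ln (V y)).
  by apply: measurableT_comp => //; apply: measurableT_comp => //; exact: measurable_ln.
have mG : measurable_fun [set: T] G.
  apply: measurable_fun_ifT.
  - by apply: (measurable_fun_bool true); rewrite setTI preimage_mem_true.
  - exact: measurable_cst.
  - by apply/measurable_EFinP.
have GPhi y : D y -> (G y <= lne (Phi y))%E.
  rewrite /G => Dy; case: ifPn => [_|/negP nN]; first exact: leNye.
  have [Vy h] : 0 < V y /\ ((V y)^-1%:E <= Phi y)%E.
    by apply: hPhi => // Ny; apply: nN; rewrite inE.
  rewrite -lnV ?posrE// -lne_EFin ?invr_gt0// lee_lne ?in_itv//=.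
    by rewrite lee_fin invr_ge0 ltW//= leey.
  by rewrite leey andbT; apply: le_trans h; rewrite lee_fin invr_ge0 ltW.
have le1 : (\int[mu]_(x in D) G^\+ x - \int[mu]_(x in D) G^\- x <=
    \int[mu]_(x in D) lne (Phi x))%E.
  by rewrite -integralE; exact: le_integral_any.
have mGp : measurable_fun [set: T] G^\+%E by exact: measurable_funepos.
have mGm : measurable_fun [set: T] G^\-%E by exact: measurable_funeneg.
have GDN y : (D `\` N) y -> G y = (- ln (V y))%:E.
  by move=> [_ nN]; rewrite /G memNset.
have Im : (\int[mu]_(x in D) G^\- x <= (CJ / e)%:E * mu D)%E.
  rewrite (@ge0_negligible_integral _ _ _ mu D N)//; last first.
    exact: measurable_funS mGm.
  have mVe := measurable_powR_fun measurableT mV (measurable_cst e).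
  have mVe' : measurable_fun [set: T] (fun x => e^-1 * V x `^ e).
    exact: measurable_funM (measurable_cst _) mVe.
  apply: (@le_trans _ _ (\int[mu]_(x in D `\` N) (e^-1 * V x `^ e)%:E)%E).
    apply: ge0_le_integralT => [||||x DNx].
    - exact: mDN.
    - exact: mGm.
    - exact/measurable_EFinP.
    - by move=> x; exact: funeneg_ge0.
    rewrite funenegE GDN// -EFinN opprK ge_max !lee_fin.
    have [Vx _] : 0 < V x /\ ((V x)^-1%:E <= Phi x)%E by case: DNx => *; exact: hPhi.
    apply/andP; split; last by rewrite mulr_ge0 ?invr_ge0 ?powR_ge0// ltW.
    rewrite ler_pdivlMl// gt0_powRE//; have := expR_ge1Dx (e * ln (V x)); lra.
  apply: (@le_trans _ _ (\int[mu]_(x in D) (e^-1 * V x `^ e)%:E)%E).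
    apply: ge0_subset_integralT => [||||x].
    - exact: mDN.
    - exact: mD.
    - exact/measurable_EFinP.
    - by move=> x; rewrite lee_fin mulr_ge0 ?invr_ge0 ?powR_ge0// ltW.
    by case.
  under eq_integral do rewrite EFinM.
  rewrite ge0_integralZlT ?invr_ge0 ?(ltW e0)//; last 2 first.
  - exact/measurable_EFinP.
  - by move=> x; rewrite lee_fin powR_ge0.
  rewrite (mulrC CJ) EFinM -muleA; apply: lee_wpmul2l => //.
  by rewrite lee_fin invr_ge0 ltW.
have Ip0 : (0 <= \int[mu]_(x in D) G^\+ x)%E by exact: integral_ge0.
have Im0 : (0 <= \int[mu]_(x in D) G^\- x)%E by exact: integral_ge0.
have : (expeR ((mu D)^-1 * (integral mu D G^\+%E - integral mu D G^\-%E)) <= w%:E)%E.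
  apply: le_trans hw; rewrite lee_expeR; apply: lee_wpmul2l => //.
  by rewrite inve_ge0 muD lee_fin ltW.
have Imfin : integral mu D G^\-%E \is a fin_num.
  rewrite ge0_fin_numE//; apply: (le_lt_trans Im).
  by rewrite muD -EFinM ltry.
move: Im; rewrite -(fineK Imfin) muD -EFinM lee_fin inver gt_eqF//.
set im := fine _ => Im.
case E : (integral mu D G^\+%E) Ip0 => [ip| |]//; last first.
  by rewrite addye// gt0_muley// lte_fin invr_gt0.
rewrite lee_fin -EFinB -EFinM /= lee_fin => ip0 hexp.
have w0 : 0 < w by apply: lt_le_trans hexp; exact: expR_gt0.
have hip : ip <= (CJ / e + ln w) * M.
  have : M^-1 * (ip - im) <= ln w by rewrite -(expRK (M^-1 * _)) ler_ln ?posrE ?expR_gt0.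
  by rewrite ler_pdivrMl//; lra.
pose L1 := CJ / e + 1 + ln w.
have L1_ge1 : 1 <= L1.
  have : 0 <= (CJ / e + ln w) * M by exact: le_trans hip.
  by rewrite pmulr_lge0// /L1; lra.
have gamE : gam = expR (- (4 * L1)).
  by rewrite /gam gt0_powRE// -expRD; congr expR; rewrite /L1; ring.
split=> //; first by rewrite gamE -[leRHS]expR0 ler_expR; lra.
set B := [set x | V x <= gam].
have mB : measurable B.
  have := mV measurableT _ (measurable_itv `]-oo, gam]%R); rewrite setTI.
  by congr measurable; apply/seteqP; split=> x /=; rewrite in_itv.
have mDB : measurable (D `&` B) by exact: measurableI.
have mDBN : measurable ((D `&` B) `\` N) by exact: measurableD.
have h1 : ((4 * L1)%:E * mu (D `&` B) <= ip%:E)%E.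
  have -> : ((4 * L1)%:E * mu (D `&` B) = \int[mu]_(x in (D `&` B) `\` N) (4 * L1)%:E)%E.
    rewrite -(integral_cst mu mDB); apply: ge0_negligible_integral => //.
    by move=> x _; rewrite lee_fin; lra.
  rewrite -E; apply: (@le_trans _ _ (\int[mu]_(x in (D `&` B) `\` N) G^\+ x)%E).
    apply: ge0_le_integralT => [||||x [[Dx Bx] Nx]].
    - exact: mDBN.
    - exact: measurable_cst.
    - exact: mGp.
    - by move=> x; rewrite lee_fin; lra.
    rewrite funeposE GDN// le_max lee_fin; apply/orP; left.
    have [Vx _] := hPhi x Dx Nx.
    rewrite -[leLHS]opprK lerN2 -[leRHS]expRK ler_ln ?posrE ?expR_gt0//.
    by rewrite -gamE.
  apply: ge0_subset_integralT => [||||x].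
  - exact: mDBN.
  - exact: mD.
  - exact: mGp.
  - by move=> x; exact: funepos_ge0.
  by case=> -[].
have fin : mu (D `&` B) \is a fin_num.
  rewrite ge0_fin_numE//; apply: (@le_lt_trans _ _ (mu D)).
    by apply: le_measure; rewrite ?inE.
  by rewrite muD ltry.
move: h1; rewrite -(fineK fin) -!EFinM !lee_fin; set b := fine _ => h1.
have h2 : L1 * (4 * b) <= L1 * M by rewrite /L1; move: h1 hip; rewrite /L1; nra.
by rewrite ler_pM2l// in h2; lra.
Qed.

End averaged_log.

Section A_infty.
Context {R : realType} {n m : nat}.
Notation T := (lebRn R n).
Notation mu := (@lebesgue_rV R n).
Context (pm pinf C0 Ci : R) (p : 'rV[R]_n -> R).
Hypothesis Hp : lh_exponent pm pinf C0 Ci p.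
Notation pp := (lh_max pinf Ci).
Notation eps := (lh_eps pm pinf Ci).
Notation CJ := (@lh_CJ R n pm pinf C0 Ci).
Notation modular_p := (modular mu p).

Let mp : measurable_fun [set: T] (p : T -> R) := lh_meas Hp.
Let pm0 := lh_pm Hp.
Let pp0 := lh_max_gt0 Hp.
Let eps0 := lh_eps_gt0 Hp.
Let p_ge : forall x : T, pm <= p x := lh_ge Hp.
Let p_le : forall x : T, p x <= pp := lh_le Hp.

Definition A_infty_gam (w : R) : R := expR (- (4 * (CJ / eps + 1))) * w `^ (- 4).

Hypothesis m_gt0 : (0 < m)%N.
Context (W : 'rV[R]_n -> 'M[R[i]]_m) (w : R).
Hypothesis mw : matrix_weight W.

Lemma measurable_weight_opnorm (M : 'M[R[i]]_m) :
  measurable_fun [set: T] (fun x : T => opnorm (W x *m M)).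
Proof.
apply: (measurable_opnorm m_gt0) => i j.
have mRe k l : measurable_fun [set: T] (fun x : T => complex.Re (W x k l)).
  by have [[]] := mw.2 k l.
have mIm k l : measurable_fun [set: T] (fun x : T => complex.Im (W x k l)).
  by have [_ []] := mw.2 k l.
have mc (c : R) : measurable_fun [set: T] (fun=> c) := measurable_cst c.
split.
- rewrite (_ : (fun x => _) = (fun x : T => \sum_k
    (complex.Re (W x i k) * complex.Re (M k j) - complex.Im (W x i k) * complex.Im (M k j)))).
    apply: measurable_sum => k; apply: measurable_funB.
      exact: measurable_funM (mRe _ _) (mc _).
    exact: measurable_funM (mIm _ _) (mc _).
  by apply/funext => x; rewrite mxE Re_sumc; apply: eq_bigr => k _; rewrite Re_mulc.
- rewrite (_ : (fun x => _) = (fun x : T => \sum_k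
    (complex.Re (W x i k) * complex.Im (M k j) + complex.Im (W x i k) * complex.Re (M k j)))).
    apply: measurable_sum => k; apply: measurable_funD.
      exact: measurable_funM (mRe _ _) (mc _).
    exact: measurable_funM (mIm _ _) (mc _).
  by apply/funext => x; rewrite mxE Im_sumc; apply: eq_bigr => k _; rewrite Im_mulc.
Qed.

Hypothesis hw : Apx_infty_const p W = w%:E.

Lemma A_infty_average (P : @dbox R n) : 0 < side P ->
  (expeR ((mu (bset P))^-1 * \int[mu]_(y in bset P) lne
    (Lpx_norm p (fun x => opnorm (W x *m invmx (W y)) * \1_(bset P) x)%R
      / Lpx_norm p \1_(bset P))%E) <= w%:E)%E.
Proof.
move=> l0; rewrite -hw; apply: ereal_sup_ubound.
by exists (bset P); [exact: cube_bset|].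
Qed.

Lemma Lpx_norm_box (P : @dbox R n) (lam : R) : 0 < lam ->
  modular_p (bset P) (fun=> lam^-1) = 1%E -> Lpx_norm p \1_(bset P) = lam%:E.
Proof.
move=> lam0 lam1; rewrite Lpx_normE.
have -> : \1_(bset P) = (fun x : T => 1 * \1_(bset P) x) :> (T -> R).
  by apply/funext => x; rewrite mul1r.
have lam1' : modular_p (bset P) (fun x => (fun=> 1 : R) x / lam) = 1%E.
  by rewrite -lam1; congr modular; apply/funext => x; rewrite mul1r.
exact: (luxemburg_unit mp pm0 p_ge (measurable_bset P) (measurable_cst (1 : R))
  (fun=> ler01) lam0 lam1').
Qed.

Variable (M : 'M[R[i]]_m).
Hypothesis M0 : M != 0.
Notation v := (fun x : T => opnorm (W x *m M)).

(** Factor [W x *m M] through the invertible matrix [W y]. *)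
Lemma weight_good_points : exists N : set T, [/\ measurable N, mu N = 0%E &
  forall y, ~ N y -> 0 < v y /\ forall (P : @dbox R n) (L : \bar R),
    Lpx_norm p (fun x => v x * \1_(bset P) x) = L ->
    (((v y)^-1)%:E * L <=
      Lpx_norm p (fun x => opnorm (W x *m invmx (W y)) * \1_(bset P) x)%R)%E].
Proof.
have [N [mN N0 hN]] := mw.1; exists N; split=> // y nN.
have uW : W y \in unitmx.
  by apply: contrapT => h; apply: nN; apply: hN => /= -[].
have v0 : 0 < v y.
  rewrite lt_def opnorm_ge0// andbT; apply/eqP => /opnorm_eq0 h.
  by move/eqP: M0; apply; rewrite -(mulKmx uW M) h mulmx0.
split=> [|P _ <-]; first exact: v0.
have op0 (x : T) A : 0 <= opnorm (W x *m A) by exact: opnorm_ge0.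
have WM (x : T) : opnorm (W x *m M) <= opnorm (W x *m invmx (W y)) * v y.
  have E : W x *m M = W x *m invmx (W y) *m (W y *m M).
    by rewrite (mulmxA (W x *m invmx (W y)) (W y) M) (mulmxKV uW).
  by rewrite {1}E; exact: (opnormM m_gt0).
exact: (luxemburg_mono mu mp pm0 p_ge (measurable_bset P)
  (measurable_weight_opnorm M) (measurable_weight_opnorm (invmx (W y)))
  (op0^~ M) (op0^~ (invmx (W y))) v0 WM).
Qed.

Let mv : measurable_fun [set: T] v := measurable_weight_opnorm M.
Let v_ge0 (x : T) : 0 <= v x. Proof. exact: opnorm_ge0. Qed.

(** Otherwise the quotient of norms is infinite at almost every [y], and so
    is the constant of the weight. *)
Lemma A_infty_modular_fin (P : @dbox R n) : 0 < side P -> (modular_p (bset P) v < +oo)%E.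
Proof.
move=> l0; rewrite ltey; apply/eqP => voo.
have [lam lam0 lam1] := unit_norm_box Hp l0.
have mP := measurable_bset P.
have muP : mu (bset P) = (side P ^+ n)%:E by exact: mu_bset.
have [N [mN N0 hN]] := weight_good_points.
have Loo : Lpx_norm p (fun x => v x * \1_(bset P) x) = +oo%E.
  by rewrite Lpx_normE (luxemburg_infty mp pm0 p_ge p_le mP mv v_ge0 voo).
have avg := A_infty_average l0; rewrite (Lpx_norm_box lam0 lam1) in avg.
(* Constants [V = c] are all admissible, since [Phi = +oo] off a null set;
   [c = gam] contradicts the conclusion. *)
have key (c : R) : 0 < c -> c <= 1 -> let gam := expR (- (4 * (1 / 1 + 1))) * w `^ (- 4) in
    [/\ 0 < w, gam <= 1 &
      (4%:E * mu (bset P `&` [set x | (fun=> c) x <= gam]%R) <= mu (bset P))%E].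
  move=> c0 c1; apply: (averaged_log_level mP muP _ ltr01 ler01 (measurable_cst c)
    _ _ mN N0 _ avg).
  - exact: exprn_gt0.
  - by move=> x; exact: ltW.
  - rewrite -integral_cst_mu//; apply: ge0_le_integralT => [||||x _].
    + exact: mP.
    + exact: (measurable_cst (c `^ 1)%:E).
    + exact: (measurable_cst 1%:E).
    + by move=> x; rewrite lee_fin powR_ge0.
    + by rewrite lee_fin powRr1// ltW.
  - move=> y _ Ny; have [vy hy] := hN y Ny; have {hy} := hy P _ Loo.
    have vi0 : (0 < (v y)^-1%:E)%E by rewrite lte_fin invr_gt0.
    have li0 : (0 < lam^-1%:E)%E by rewrite lte_fin invr_gt0.
    rewrite (gt0_muley vi0) leye_eq => /eqP ->; split; first exact: c0.
    by rewrite inver (gt_eqF lam0) (gt0_mulye li0) leey.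
have [w0 gam1 _] := key 1 ltr01 (lexx _).
set gam := expR _ * _ in key gam1.
have gam0 : 0 < gam by rewrite mulr_gt0 ?expR_gt0 ?powR_gt0.
have [_ _] := key gam gam0 gam1.
rewrite (_ : [set x | _] = setT); last first.
  by apply/seteqP; split=> // x _ /=; rewrite lexx.
rewrite setIT muP -EFinM lee_fin; have := exprn_gt0 n l0; lra.
Qed.

Lemma A_infty_modular_gt0 (P : @dbox R n) : 0 < side P -> (0 < modular_p (bset P) v)%E.
Proof.
move=> l0; rewrite lt_def modular_ge0 andbT; apply/eqP => v_eq0.
have mP := measurable_bset P.
have muP : mu (bset P) = (side P ^+ n)%:E by exact: mu_bset.
have [N [mN N0 hN]] := weight_good_points.
have mvp : measurable_fun [set: T] (fun x => (v x `^ p x)%:E).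
  by apply/measurable_EFinP; exact: measurable_powR_fun.
have h : (\int[mu]_(x in bset P) `|(v x `^ p x)%:E| = 0)%E.
  rewrite -[RHS]v_eq0; apply: eq_integral => x _.
  by rewrite gee0_abs// lee_fin powR_ge0.
have := ae_eq_integral_abs mu mP (measurable_funS measurableT (@subsetT _ (bset P)) mvp).
move=> [/(_ h) [N' [mN' N'0 hN']] _].
have PN : bset P `<=` N `|` N'.
  move=> x Px; have [Nx|/hN[vx _]] := EM (N x); [by left|right].
  apply: hN' => /= /(_ Px) [] /eqP; rewrite gt_eqF//; exact: powR_gt0.
have : (mu (bset P) <= mu (N `|` N'))%E.
  by apply: le_measure; rewrite ?inE//; exact: measurableU.
rewrite (etrans (measureU0 mN mN' N'0) N0) muP lee_fin; have := exprn_gt0 n l0; lra.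
Qed.

(** [averaged_log_level] for [V = v * lam / a], whose power [eps] is
    controlled by [lh_average] since [V / lam] has unit modular. *)
Lemma A_infty_level_box (P : @dbox R n) (a lam : R) : 0 < side P -> 0 < a -> 0 < lam ->
  modular_p (bset P) (fun x => v x / a) = 1%E -> modular_p (bset P) (fun=> lam^-1) = 1%E ->
  [/\ 0 < w, A_infty_gam w <= 1 &
    (4%:E * mu (bset P `&` [set x | v x * lam <= A_infty_gam w * a]%R) <= mu (bset P))%E].
Proof.
move=> l0 a0 lam0 va1 lam1; have mP := measurable_bset P.
have muP : mu (bset P) = (side P ^+ n)%:E by exact: mu_bset.
have [N [mN N0 hN]] := weight_good_points.
have va : Lpx_norm p (fun x => v x * \1_(bset P) x) = a%:E.
  by rewrite Lpx_normE (luxemburg_unit mp pm0 p_ge mP mv v_ge0 a0 va1).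
have avg := A_infty_average l0; rewrite (Lpx_norm_box lam0 lam1) in avg.
have mV : measurable_fun [set: T] (fun x => v x * (lam / a)).
  exact: measurable_funM mv (measurable_cst _).
have V0 x : 0 <= v x * (lam / a) by rewrite mulr_ge0// divr_ge0// ltW.
have VlE : modular_p (bset P) (fun x => v x * (lam / a) / lam) = 1%E.
  rewrite -va1; congr modular; apply/funext => x; field.
  by rewrite !gt_eqF.
have VlE' : (modular_p (bset P) (fun x => v x * (lam / a) / lam)%R <= 1)%E by rewrite VlE.
have CJ0 : 0 <= CJ by apply: le_trans (lh_CJ_ge1 Hp).
have VJ := lh_average Hp l0 lam0 mV V0 lam1 VlE'.
have hPhi y : bset P y -> ~ N y -> 0 < v y * (lam / a) /\
   ((v y * (lam / a))^-1%:E <=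
   Lpx_norm p (fun x => opnorm (W x *m invmx (W y)) * \1_(bset P) x)%R / lam%:E)%E.
  move=> _ Ny; have [vy hy] := hN y Ny; have {hy} h := hy P _ va; split.
    by rewrite mulr_gt0// divr_gt0.
  rewrite inver (gt_eqF lam0) [X in X%:E](_ : _ = (v y)^-1 * a * lam^-1); last first.
    by field; rewrite !gt_eqF.
  by rewrite EFinM; apply: lee_wpmul2r; [rewrite lee_fin invr_ge0 ltW|rewrite EFinM].
have := averaged_log_level mP muP (exprn_gt0 n l0) eps0 CJ0 mV V0 VJ mN N0 hPhi avg.
move=> [w0 g1 h]; split; [exact: w0|exact: g1|].
rewrite (_ : [set x | _] = [set x | v x * (lam / a) <= A_infty_gam w]); first exact: h.
by apply/seteqP; split=> x /=; rewrite mulrA ler_pdivrMr.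
Qed.

Lemma A_infty_normalize (P : @dbox R n) : 0 < side P ->
  exists2 a, 0 < a & modular_p (bset P) (fun x => v x / a) = 1%E.
Proof.
move=> l0; apply: (modular_normalize mp pm0 pp0 p_ge p_le (measurable_bset P) mv v_ge0).
  exact: A_infty_modular_gt0.
exact: A_infty_modular_fin.
Qed.

Lemma A_infty_level_cond :
  [/\ 0 < w, A_infty_gam w <= 1 & level_cond p (A_infty_gam w) v].
Proof.
pose P : @dbox R n := DBox 0 1 (fun=> true) (fun=> true).
have l0 : 0 < side P by exact: ltr01.
have [a a0 va] := A_infty_normalize l0.
have [lam lam0 lam1] := unit_norm_box Hp l0.
have [w0 g1 _] := A_infty_level_box l0 a0 lam0 va lam1.
split=> // P' a' lam' l0' a0' lam0' va' lam1'.
by have [] := A_infty_level_box l0' a0' lam0' va' lam1'.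
Qed.

End A_infty.

(** * Constants *)

Section final_constants.
Context {R : realType} {n : nat}.
Context (pm pinf C0 Ci : R).
Notation pp := (lh_max pinf Ci).
Notation lS := (@lh_S R n pm pinf Ci).
Notation lT := (@lh_T R n pm pinf C0 Ci).
Notation gam := (@A_infty_gam R n pm pinf C0 Ci).
Notation K := (@lh_K R n pm pinf C0 Ci).

(** As [gam w] is a multiple of [w^-4] and [lh_K] a multiple of
    [gam^(- pp)], the constant [lh_K] is [rh_K0 * w^(4 * pp)].  [rh_C1] is what
    the two conditions on [r] in [reverse_holder_modular] ask for, and [rh_C]
    comes from [Lam^(1 / pm)], where [Lam] is affine in [lh_K]. *)
Definition rh_K0 : R := K (gam 1).
Definition rh_C1 : R := rh_K0 * (32 * pp ^+ 2 * ln lS / pm + pp).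
Definition rh_A1 : R := 4 * pp.
Definition rh_A : R := 4 * pp / pm.
Definition rh_C : R := (lT * lS * (1 + 16 * pp / pm) * rh_K0) `^ (pm^-1).

Context (p : 'rV[R]_n -> R).
Hypothesis Hp : lh_exponent pm pinf C0 Ci p.
Let pm0 := lh_pm Hp.
Let pp0 := lh_max_gt0 Hp.

Lemma rh_K0_gt0 : 0 < rh_K0.
Proof.
rewrite /rh_K0 /lh_K divr_gt0 ?(lh_cF_gt0 Hp)// mulr_gt0 ?expR_gt0 ?powR_gt0//.
by rewrite /A_infty_gam mulr_gt0 ?expR_gt0 ?powR_gt0.
Qed.

Lemma lh_K_A_infty_gam w : 0 < w -> K (gam w) = rh_K0 * w `^ rh_A1.
Proof.
move=> w0; rewrite /rh_K0 /lh_K.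
suff -> : gam w `^ (- pp) = gam 1 `^ (- pp) * w `^ rh_A1 by ring.
rewrite /A_infty_gam powR1 mulr1 [LHS]powRM ?expR_ge0 ?powR_ge0//; congr (_ * _).
by rewrite -powRrM /rh_A1; congr (_ `^ _); ring.
Qed.

Lemma rh_constants_gt0 : [/\ 0 < rh_C, 0 < rh_C1, 0 < rh_A & 0 < rh_A1].
Proof.
have K0 := rh_K0_gt0; have T1 := lh_T_ge1 Hp; have S1 := lh_S_gt1 Hp.
have lnS : 0 < ln lS by rewrite ln_gt0.
have hpm := pm0; have hpp := pp0.
split.
- apply: powR_gt0; apply: mulr_gt0 => //; apply: mulr_gt0.
    by apply: mulr_gt0; lra.
  by rewrite addr_gt0// divr_gt0// mulr_gt0.
- apply: mulr_gt0 => //; apply: addr_gt0 => //; apply: divr_gt0 => //.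
  by apply: mulr_gt0 => //; apply: mulr_gt0 => //; exact: exprn_gt0.
- by rewrite /rh_A divr_gt0// mulr_gt0.
- by rewrite /rh_A1 mulr_gt0.
Qed.

Lemma rh_exponent_small w r : 0 < w -> gam w <= 1 -> 1 < r ->
  r <= 1 + (rh_C1 * w `^ rh_A1 * 2 `^ (1 * w))^-1 ->
  (r - 1) * pp <= 1 /\ (r - 1) * pp * ln lS <= lh_rate (n := n) pm pinf C0 Ci (gam w) / 4.
Proof.
move=> w0 g1 r1 hr.
have g0 : 0 < gam w by rewrite mulr_gt0 ?expR_gt0 ?powR_gt0.
have K1 := lh_K_ge1 Hp g0 g1.
have KE := lh_K_A_infty_gam w0.
have S1 := lh_S_gt1 Hp; have lnS : 0 < ln lS by rewrite ln_gt0.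
have hpm := pm0; have hpp := pp0.
set B := 32 * pp ^+ 2 * ln lS / pm + pp.
have B1 : 0 < 32 * pp ^+ 2 * ln lS / pm.
  apply: divr_gt0 => //; apply: mulr_gt0 => //; apply: mulr_gt0 => //.
  exact: exprn_gt0.
have B0 : 0 < B by rewrite addr_gt0.
have KB : 0 < K (gam w) * B by rewrite mulr_gt0//; lra.
have two : 1 <= 2 `^ (1 * w) :> R.
  by rewrite -[leLHS](powRr0 2); apply: ler_powR; [lra|rewrite mul1r ltW].
have h : (r - 1) * (K (gam w) * B) <= 1.
  rewrite -ler_pdivlMr// div1r.
  apply: (@le_trans _ _ (rh_C1 * w `^ rh_A1 * 2 `^ (1 * w))^-1); first lra.
  rewrite lef_pV2 ?posrE//; last first.
    have [_ C10 _ _] := rh_constants_gt0.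
    by apply: mulr_gt0; [apply: mulr_gt0; [exact: C10|]|]; exact: powR_gt0.
  rewrite /rh_C1 -/B.
  have -> : rh_K0 * B * w `^ rh_A1 = K (gam w) * B by rewrite KE; ring.
  by apply: ler_peMr; [exact: ltW|exact: two].
set t := r - 1 in h *; have t0 : 0 < t by rewrite subr_gt0.
have tB1 : t * (32 * pp ^+ 2 * ln lS / pm) * K (gam w) + t * pp * K (gam w) <= 1.
  by apply: le_trans h; rewrite /B; lra.
have x0 : 0 <= t * (32 * pp ^+ 2 * ln lS / pm) * K (gam w).
  by apply: mulr_ge0; [apply: mulr_ge0; exact: ltW|lra].
have y0 : 0 < t * pp by rewrite mulr_gt0.
split; first by nra.
rewrite /lh_rate /lh_kap.
have K0 : 0 < K (gam w) by lra.
have -> : pm / pp * (4 * K (gam w))^-1 / 2 / 4 = pm / (32 * pp * K (gam w)).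
  by field; rewrite (gt_eqF pp0) (gt_eqF K0).
rewrite ler_pdivlMr; last by apply: mulr_gt0 => //; exact: mulr_gt0.
have z0 : 0 < t * pp * K (gam w) by rewrite mulr_gt0.
have : t * (32 * pp ^+ 2 * ln lS / pm) * K (gam w) <= 1 by lra.
have -> : t * (32 * pp ^+ 2 * ln lS / pm) * K (gam w) =
   (t * pp * ln lS * (32 * pp * K (gam w))) / pm by ring.
by rewrite ler_pdivrMr// mul1r.
Qed.

Lemma rh_Lam_le w : 0 < w -> gam w <= 1 ->
  lh_Lam (n := n) pm pinf C0 Ci (gam w) `^ (pm^-1) <= rh_C * w `^ rh_A.
Proof.
move=> w0 g1.
have g0 : 0 < gam w by rewrite mulr_gt0 ?expR_gt0 ?powR_gt0.
have K1 := lh_K_ge1 Hp g0 g1.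
have KE := lh_K_A_infty_gam w0.
have T1 := lh_T_ge1 Hp; have S1 := lh_S_gt1 Hp; have K0 := rh_K0_gt0.
have hpm := pm0; have hpp := pp0.
have q0 : 0 < pp / pm by rewrite divr_gt0.
have Kp : 0 < K (gam w) by lra.
have TS : 0 < lT * lS by rewrite mulr_gt0//; lra.
have -> : rh_A = rh_A1 * pm^-1 by [].
have D0 : 0 < lT * lS * (1 + 16 * pp / pm) * rh_K0.
  apply: mulr_gt0; last exact: K0.
  apply: mulr_gt0; first exact: TS.
  by rewrite addr_gt0// divr_gt0// mulr_gt0.
rewrite powRrM /rh_C -powRM ?powR_ge0//; last first.
  exact: ltW.
apply: ge0_ler_powR; rewrite ?nnegrE ?invr_ge0 ?(ltW pm0)//.
- rewrite /lh_Lam mulr_ge0 ?(ltW TS)//.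
  by rewrite addr_ge0// divr_ge0// ltW// (lh_rate_bounds Hp g0 g1).1.
- by apply: mulr_ge0; [exact: ltW|exact: powR_ge0].
have -> : lT * lS * (1 + 16 * pp / pm) * rh_K0 * w `^ rh_A1 =
    lT * lS * ((1 + 16 * pp / pm) * K (gam w)) by rewrite KE; ring.
rewrite /lh_Lam; apply: ler_wpM2l; first exact: ltW.
rewrite /lh_rate /lh_kap.
have -> : 2 / (pm / pp * (4 * K (gam w))^-1 / 2) = 16 * (pp / pm) * K (gam w).
  by field; rewrite (gt_eqF pm0) (gt_eqF pp0) (gt_eqF Kp).
by nra.
Qed.

End final_constants.

(** * Reverse Hölder inequality for matrix weights *)

Section cube.
Context {R : realType} {n m : nat}.
Notation T := (lebRn R n).
Notation mu := (@lebesgue_rV R n).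
Context (pm pinf C0 Ci : R) (p : 'rV[R]_n -> R).
Hypothesis Hp : lh_exponent pm pinf C0 Ci p.
Notation pp := (lh_max pinf Ci).
Notation lS := (@lh_S R n pm pinf Ci).
Notation modular_p := (modular mu p).

Let mp : measurable_fun [set: T] (p : T -> R) := lh_meas Hp.
Let pm0 := lh_pm Hp.
Let p_ge : forall x : T, pm <= p x := lh_ge Hp.

(** The norm of the indicator of [Q] for the exponent [r * p] is exactly
    [lam^(1 / r)], because [(lam^(1 / r))^(r * p) = lam^p]; the powers of [lam]
    then cancel. *)
Lemma reverse_holder_normalized gam (v : T -> R) (Q : @dbox R n) (a lam r : R) :
  0 < gam -> gam <= 1 -> measurable_fun [set: T] v -> (forall x, 0 <= v x) ->
  level_cond p gam v -> 0 < side Q -> 0 < a -> 0 < lam ->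
  modular_p (bset Q) (fun x => v x / a) = 1%E ->
  modular_p (bset Q) (fun=> lam^-1) = 1%E ->
  1 < r -> (r - 1) * pp <= 1 ->
  (r - 1) * pp * ln lS <= lh_rate (n := n) pm pinf C0 Ci gam / 4 ->
  (Lpx_norm (fun x => r * p x)%R (fun x => v x * \1_(bset Q) x)%R
     / Lpx_norm (fun x => r * p x)%R \1_(bset Q)
   <= (lh_Lam (n := n) pm pinf C0 Ci gam `^ (pm^-1))%:E *
     (Lpx_norm p (fun x => v x * \1_(bset Q) x)%R / Lpx_norm p \1_(bset Q)))%E.
Proof.
move=> g0 g1 mv v0 hv l0 a0 lam0 va1 lam1 r1 h1 h2.
have mQ := measurable_bset Q.
set Lam := lh_Lam _ _ _ _ gam `^ (pm^-1).
have Lam0 : 0 < Lam.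
  apply: powR_gt0; rewrite /lh_Lam; have [rt0 _] := lh_rate_bounds Hp g0 g1.
  have T1 := lh_T_ge1 Hp; have S1 := lh_S_gt1 Hp.
  apply: mulr_gt0; first by apply: mulr_gt0; lra.
  by apply: addr_gt0 => //; exact: divr_gt0.
have r0 : 0 < r by lra.
have rp_ge (x : T) : r * pm <= r * p x by rewrite ler_pM2l.
have rpm0 : 0 < r * pm by exact: mulr_gt0.
have mrp : measurable_fun [set: T] (fun x : T => r * p x).
  exact: measurable_funM (measurable_cst _) mp.
have one_p : Lpx_norm p \1_(bset Q) = lam%:E by exact: (Lpx_norm_box Hp).
have v_p : Lpx_norm p (fun x => v x * \1_(bset Q) x) = a%:E.
  exact: (luxemburg_unit mp pm0 p_ge mQ mv v0 a0 va1).
have lr0 : 0 < lam `^ r^-1 by exact: powR_gt0.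
have one_rp : Lpx_norm (fun x => r * p x) \1_(bset Q) = (lam `^ r^-1)%:E.
  have -> : \1_(bset Q) = (fun x : T => 1 * \1_(bset Q) x) :> (T -> R).
    by apply/funext => x; rewrite mul1r.
  have h : modular mu (fun x : T => r * p x) (bset Q)
      (fun x => (fun=> 1 : R) x / lam `^ r^-1) = 1%E.
    rewrite -lam1; apply: eq_integral => x _.
    congr EFin; transitivity (lam `^ (- p x)).
      by rewrite mul1r -powRN -powRrM mulNr mulrA mulVf ?mul1r// (gt_eqF r0).
    by rewrite -[in RHS](powR_inv1 (ltW lam0)) -powRrM mulN1r.
  exact: (luxemburg_unit mrp rpm0 rp_ge mQ (measurable_cst (1 : R)) (fun=> ler01) lr0 h).
pose c := Lam * lam `^ (r^-1 - 1).
have c0 : 0 < c by apply: mulr_gt0 => //; exact: powR_gt0.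
have v_rp : (Lpx_norm (fun x => r * p x)%R (fun x => v x * \1_(bset Q) x)%R <= (a * c)%:E)%E.
  apply: (luxemburg_le rpm0 rp_ge v0 (mulr_gt0 a0 c0)).
  apply: le_trans (reverse_holder_modular Hp g0 g1 mv v0 hv l0 a0 lam0 va1 lam1 r1 h1 h2).
  by apply: le_integral_any => x _; rewrite invfM mulrA.
rewrite one_p v_p one_rp !inver (gt_eqF lr0) (gt_eqF lam0) -!EFinM.
apply: (@le_trans _ _ ((a * c)%:E * ((lam `^ r^-1)^-1)%:E)%E).
  by apply: lee_wpmul2r => //; rewrite lee_fin invr_ge0 ltW.
rewrite -EFinM lee_fin /c powRD; last by rewrite (gt_eqF lam0) implybT.
rewrite powR_inv1 ?(ltW lam0)// le_eqVlt; apply/orP; left; apply/eqP.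
by field; rewrite (gt_eqF lam0) (gt_eqF lr0).
Qed.

Hypothesis m_gt0 : (0 < m)%N.
Context (W : 'rV[R]_n -> 'M[R[i]]_m).
Hypothesis WA : Apx_infty p W.

Lemma matrix_reverse_holder (r : R) (Q : set 'rV[R]_n) (M : 'M[R[i]]_m) :
  let w := fine (Apx_infty_const p W) in
  1 < r ->
  r <= 1 + (@rh_C1 R n pm pinf C0 Ci * w `^ rh_A1 pinf Ci * 2 `^ (1 * w))^-1 -> cube Q ->
  (Lpx_norm (fun x => r * p x)%R (fun x => opnorm (W x *m M) * \1_Q x)%R
     / Lpx_norm (fun x => r * p x)%R \1_Q
   <= (@rh_C R n pm pinf C0 Ci * w `^ rh_A pm pinf Ci)%:E *
     (Lpx_norm p (fun x => opnorm (W x *m M) * \1_Q x)%R / Lpx_norm p \1_Q))%E.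
Proof.
move=> w r1 hr [cr [l [bl [br [l0 QE]]]]].
pose P : @dbox R n := DBox cr l bl br.
have -> : Q = bset P by exact: QE.
have lP : 0 < side P by exact: l0.
have [mw Afin] := WA.
have A0 : (0 <= Apx_infty_const p W)%E.
  apply: (@le_trans _ _ _ _ _ (expeR_ge0 _)); apply: ereal_sup_ubound.
  by exists (bset P); [exact: cube_bset|].
have hw : Apx_infty_const p W = w%:E by rewrite /w fineK// ge0_fin_numE.
(* For [M = 0] both sides vanish; the level condition needs [v > 0]. *)
have [M0|M0] := eqVneq M 0.
  have L0 : Lpx_norm (fun x => r * p x) (fun x => opnorm (W x *m M) * \1_(bset P) x) = 0%E.
    apply/eqP; rewrite eq_le luxemburg_ge0 andbT.
    apply/lee_addgt0Pr => e e0; rewrite add0e; apply: ereal_inf_lbound.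
    exists e => //; split=> //.
    rewrite (_ : (fun x => _) = (fun=> 0%E)) ?integral0//.
    apply/funext => x; rewrite M0 mulmx0 (opnorm0 m_gt0) !mul0r normr0 powR0//.
    by rewrite gt_eqF// mulr_gt0//; [lra|exact: lt_le_trans (lh_pm Hp) (lh_ge Hp x)].
  rewrite L0 mul0e mule_ge0// ?lee_fin ?mulr_ge0 ?powR_ge0//.
  by rewrite mule_ge0// ?inve_ge0; exact: luxemburg_ge0.
have [w0 g1 hv] := A_infty_level_cond Hp m_gt0 mw hw M0.
have [a a0 va] := A_infty_normalize Hp m_gt0 mw hw M0 lP.
have [lam lam0 lam1] := unit_norm_box Hp lP.
have g0 : 0 < A_infty_gam (n := n) pm pinf C0 Ci w.
  by rewrite mulr_gt0 ?expR_gt0 ?powR_gt0.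
have [h1 h2] := rh_exponent_small Hp w0 g1 r1 hr.
have op0 (x : T) : 0 <= opnorm (W x *m M) by exact: opnorm_ge0.
apply: (le_trans (reverse_holder_normalized g0 g1 (measurable_weight_opnorm m_gt0 mw M)
  op0 hv lP a0 lam0 va lam1 r1 h1 h2)); apply: lee_wpmul2r.
  by apply: mule_ge0; [|rewrite inve_ge0]; exact: luxemburg_ge0.
rewrite lee_fin; exact: (rh_Lam_le Hp w0 g1).
Qed.

End cube.

Theorem theorem3p15 (R : realType) (n : nat) (n_gt0 : (0 < n)%N)
    (p_minus p_plus p_infty C0 C_infty : R) :
  exists C C1 C2 A A1 : R, [/\ 0 < C, 0 < C1, 0 < C2, 0 < A & 0 < A1] /\
  forall p : 'rV[R]_n -> R,
    exponent0 (EFin \o p) ->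
    ess_inf (@lebesgue_rV R n) (EFin \o p) = p_minus%:E ->
    ess_sup (@lebesgue_rV R n) (EFin \o p) = p_plus%:E ->
    log_holder C0 p_infty C_infty p ->
  forall (m : nat) (m_gt0 : (0 < m)%N) (W : 'rV[R]_n -> 'M[R[i]]_m),
    Apx_infty p W ->
  let w := fine (Apx_infty_const p W) in
  let r_w := 1 + (C1 * w `^ A1 * 2 `^ (C2 * w))^-1 in
  forall r : R, 1 < r -> r <= r_w ->
  forall Q : set 'rV[R]_n, cube Q ->
  forall M : 'M[R[i]]_m,
    (Lpx_norm (fun x => r * p x)%R (fun x => opnorm (W x *m M) * \1_Q x)%R
       / Lpx_norm (fun x => r * p x)%R \1_Q
     <= (C * w `^ A)%:E *
       (Lpx_norm p (fun x => opnorm (W x *m M) * \1_Q x)%R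
          / Lpx_norm p \1_Q))%E.
Proof.
(* The constants precede [p], but they are positive as soon as one exponent
   has the given data; if none has, any constants will do. *)
have [[p0 Hp0]|none] := EM (exists p, @lh_exponent R n p_minus p_infty C0 C_infty p).
  have [C_gt0 C1_gt0 A_gt0 A1_gt0] := rh_constants_gt0 Hp0.
  exists (@rh_C R n p_minus p_infty C0 C_infty), (@rh_C1 R n p_minus p_infty C0 C_infty),
    1, (rh_A p_minus p_infty C_infty), (rh_A1 p_infty C_infty).
  split=> // p ep pmE _ LH m m_gt0 W WA w r_w r r1 hr Q cQ M.
  exact: (matrix_reverse_holder (lh_exponent_of n_gt0 ep pmE LH) m_gt0 WA).
exists 1, 1, 1, 1, 1; split=> // p ep pmE _ LH.
by exfalso; apply: none; exists p; exact: lh_exponent_of.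
Qed.
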